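(* Let $\beta>1$, let $\mathfrak d$ be a finite set of nonnegative reals with $0\in\mathfrak d$, $|\mathfrak d|\ge2$, let $\mathfrak b=(\beta^k)_{k\ge0}$, write $L=\log_\beta|\mathfrak d|$, and let $c\ge\rho_{\beta,\mathfrak d}$ be any integer. Then $\zeta_{\mathfrak b,\mathfrak d}(s)$ extends meromorphically to the whole complex plane and is given by $$\zeta_{\mathfrak b,\mathfrak d}(s)=\frac{1}{\Gamma(s)}\sum_{\lambda>0}\frac{r_{\mathfrak b,\mathfrak d}(\lambda)}{\lambda^s}\Gamma(s,\lambda\beta^{-c})-\frac{\beta^{-cs}}{\Gamma(s+1)}+\frac{1}{\Gamma(s)}\sum_{\ell\ge0}\frac{\beta^{-(s+\ell-L)c}\log\beta}{\beta^{s+\ell-L}-1}c_{\beta,\mathfrak d}(\ell)\int_0^1e^{P_{\beta,\mathfrak d}(u)}\beta^{(s+\ell-L)u}\,du,$$ which is holomorphic except for possible simple poles at $s=L-j-2\pi(\log\beta)^{-1}ki$ ($j\in\mathbb N_0$, $k\in\mathbb Z$), with $$\operatorname*{Res}_{s=L-j-\frac{2\pi ki}{\log\beta}}\zeta_{\mathfrak b,\mathfrak d}(s)=\frac{c_{\beta,\mathfrak d}(j)}{\Gamma\big(L-j-2\pi(\log\beta)^{-1}ki\big)}\int_0^1e^{P_{\beta,\mathfrak d}(u)}e^{-2\pi iku}\,du,$$ with the convention $1/\Gamma(-n)=0$ for $n\in\mathbb N_0$. Moreover, if $L\notin\mathbb N$ then $\zeta_{\mathfrak b,\mathfrak d}(0)=-1$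 and $\zeta_{\mathfrak b,\mathfrak d}(-n)=0$ for all $n\in\mathbb N$; if $L\in\mathbb N$ then for each $n\in\mathbb N_0$, $$\zeta_{\mathfrak b,\mathfrak d}(-n)=(-1)^nn!\,c_{\beta,\mathfrak d}(n+L)\int_0^1e^{P_{\beta,\mathfrak d}(u)}\,du-\mathbf 1_{n=0}.$$
   Context: $r_{\mathfrak b,\mathfrak d}(\lambda)$ is the number of $(\delta_k)_{k\ge0}\in\mathfrak d^{\mathbb N_0}$ with $\sum_k\delta_k\beta^k=\lambda$, and $\zeta_{\mathfrak b,\mathfrak d}(s)=\sum_{\lambda>0}r_{\mathfrak b,\mathfrak d}(\lambda)\lambda^{-s}$ (sum over the countably many $\lambda>0$ with $r_{\mathfrak b,\mathfrak d}(\lambda)>0$), which converges for $\operatorname{Re}s>\log_\beta|\mathfrak d|$. $\Gamma(s,w)=\int_w^\infty e^{-u}u^{s-1}du$ is the upper incomplete gamma function. $\mathrm L_{\mathfrak d}(y)=\log\big(\sum_{\delta\in\mathfrak d}e^{-\delta y}\big)$, $[y^h]\mathrm L_{\mathfrak d}(y)$ its $h$-th Maclaurin coefficient, and $P_{\beta,\mathfrak d}(w)=\sum_{k\in\mathbb Z}(k+w+\tfrac12)(\mathrm L_{\mathfrak d}(\beta^{k+w})-\mathrm L_{\mathfrak d}(\beta^{k+1+w}))+\tfrac12\log|\mathfrak d|$. For $m\in\mathbb N_0$, $$c_{\beta,\mathfrak d}(m)=\sum_{\substack{\ell_1,\dots,\ell_m\ge0\\ 1\cdot\ell_1+\cdots+m\ell_m=m}}\prod_{1\le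 h\le m}\frac{1}{\ell_h!}\left(\frac{[y^h]\mathrm L_{\mathfrak d}(y)}{1-\beta^h}\right)^{\ell_h}.$$ The function $t\mapsto\prod_{k\ge1}|\mathfrak d|/\sum_{\delta\in\mathfrak d}e^{-\delta\beta^{-k}t}$ is analytic near $0$; $\sigma_{\beta,\mathfrak d}>0$ is a constant such that its Maclaurin series converges absolutely for $|t|<\sigma_{\beta,\mathfrak d}$, and $\rho_{\beta,\mathfrak d}=\min\{h\in\mathbb N_0:\beta^{-h}<\sigma_{\beta,\mathfrak d}\}$. *)

(* Defs.v *)
From Stdlib Require Import Reals ZArith Arith List Lra Lia ClassicalEpsilon.
From Coquelicot Require Import Coquelicot.

Definition Rsum {T : Type} (f : T -> R) (l : list T) : R :=
  fold_right Rplus 0%R (map f l).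

Definition Rprod {T : Type} (f : T -> R) (l : list T) : R :=
  fold_right Rmult 1%R (map f l).

Definition Csum {T : Type} (f : T -> C) (l : list T) : C :=
  fold_right Cplus (RtoC 0) (map f l).

Definition Cprod {T : Type} (f : T -> C) (l : list T) : C :=
  fold_right Cmult (RtoC 1) (map f l).

Definition least (P : nat -> Prop) (n : nat) : Prop :=
  P n /\ forall m, P m -> (n <= m)%nat.

Definition is_card {T : Type} (P : T -> Prop) (n : nat) : Prop :=
  exists l : list T, NoDup l /\ length l = n /\ forall x, In x l <-> P x.

(* Unspecified when [P] is infinite. *)
Definition card {T : Type} (P : T -> Prop) : nat :=
  epsilon (inhabits 0%nat) (is_card P).

(* Unordered (equivalently, absolutely convergent) sum of [f] over [A]: the net
   of finite partial sums tends to [S]. *)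
Definition has_sum {T : Type} (A : T -> Prop) (f : T -> C) (S : C) : Prop :=
  forall eps : posreal, exists F0 : list T,
    NoDup F0 /\ List.Forall A F0 /\
    forall F : list T, NoDup F -> List.Forall A F -> incl F0 F ->
      (Cmod (Csum f F - S)%C < eps)%R.

Definition Zseries (f : Z -> R) : R :=
  (Series (fun n => f (Z.of_nat n)) + Series (fun n => f (- Z.of_nat (S n))%Z))%R.

(* Complex-valued integrals of functions of a real variable. *)
Definition CInt (f : R -> C) (a b : R) : C :=
  RInt (V := C_R_CompleteNormedModule) f a b.

Definition CInt_gen (f : R -> C) (Fa Fb : (R -> Prop) -> Prop) : C :=
  RInt_gen (V := C_R_CompleteNormedModule) f Fa Fb.

Definition Cexp (z : C) : C :=
  (exp (Re z) * cos (Im z), exp (Re z) * sin (Im z))%R.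

(* [x ^ s] for real [x > 0]. *)
Definition cpow (x : R) (s : C) : C := Cexp (s * RtoC (ln x))%C.

Definition holomorphic_at (f : C -> C) (z : C) : Prop :=
  locally (T := C_UniformSpace) z
    (fun w => ex_derive (K := C_AbsRing) (V := C_NormedModule) f w).

Definition has_pole (f : C -> C) (z : C) (n : nat) : Prop :=
  (1 <= n)%nat /\
  exists g : C -> C, holomorphic_at g z /\ g z <> RtoC 0 /\
    locally' (T := C_UniformSpace) z (fun w => f w = (g w / (w - z) ^ n)%C).

(* The value of a meromorphic function at a removable singularity has to be the
   limit; at a pole the value of the total function is irrelevant. *)
Definition meromorphic (f : C -> C) : Prop :=
  forall z : C, holomorphic_at f z \/ exists n, has_pole f z n.

(* Coefficient of [(w - z)^-1] in a Laurent expansion of [f] at [z] with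
   principal part [nth 0 p / (w - z) + nth 1 p / (w - z)^2 + ...]; in particular
   [f] has at most a pole at [z]. *)
Definition is_residue (f : C -> C) (z a : C) : Prop :=
  exists (p : list C) (h : C -> C),
    holomorphic_at h z /\ nth 0 p (RtoC 0) = a /\
    locally' (T := C_UniformSpace) z (fun w =>
      f w = (h w + Csum (fun k => nth k p (RtoC 0) / (w - z) ^ (S k))%C
                        (seq 0 (length p)))%C).

(* Euler's integral, convergent for [0 < Re s]. *)
Definition Gamma_int (s : C) : C :=
  CInt_gen (fun u => RtoC (exp (- u)) * cpow u (s - RtoC 1))%C
    (at_right 0) (Rbar_locally p_infty).

(* The entire function 1/Gamma: Gamma is continued to the left by
   Gamma(s) = Gamma(s + n) / (s (s + 1) ... (s + n - 1)), where n is the least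
   natural number with [0 < Re s + n]. *)
Definition inv_Gamma (s : C) : C :=
  let n := Z.to_nat (up (- Re s)) in
  (Cprod (fun k => s + RtoC (INR k)) (seq 0 n) / Gamma_int (s + RtoC (INR n)))%C.

Definition inc_Gamma (s : C) (w : R) : C :=
  CInt_gen (fun u => RtoC (exp (- u)) * cpow u (s - RtoC 1))%C
    (at_point w) (Rbar_locally p_infty).

Lemma inv_Gamma_nonpos_int (n : nat) : inv_Gamma (RtoC (- INR n)) = RtoC 0.
Proof.
unfold inv_Gamma.
assert (Hn : Z.to_nat (up (- Re (RtoC (- INR n)))) = S n).
{ replace (- Re (RtoC (- INR n)))%R with (IZR (Z.of_nat n)).
  - rewrite <- (tech_up (IZR (Z.of_nat n)) (Z.of_nat (S n))); [apply Nat2Z.id| |];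
      rewrite Nat2Z.inj_succ, succ_IZR; lra.
  - rewrite <- INR_IZR_INZ; simpl; lra. }
rewrite Hn, seq_S; unfold Cprod; rewrite map_app, fold_right_app; simpl.
replace ((RtoC (- INR n) + RtoC (INR n)) * RtoC 1)%C with (RtoC 0).
- assert (H0 : forall l, fold_right Cmult (RtoC 0) l = RtoC 0).
  { induction l as [|a l IH]; simpl; [reflexivity|]. now rewrite IH, Cmult_0_r. }
  rewrite H0; unfold Cdiv; now rewrite Cmult_0_l.
- rewrite <- RtoC_plus, Rplus_opp_l; now rewrite Cmult_0_l.
Qed.

Definition maclaurin_coef (f : R -> R) (h : nat) : R :=
  (Derive_n f h 0 / INR (fact h))%R.

(* [d] is a finite set of digits, given as a list without repetitions. *)
Definition rep_count (b : nat -> R) (d : list R) (lambda : R) : nat :=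
  card (fun delta : nat -> R =>
    (forall k, In (delta k) d) /\ is_series (fun k => (delta k * b k)%R) lambda).

(* [S] is the value at [s] of the Dirichlet series zeta_{b,d}. *)
Definition is_zeta (b : nat -> R) (d : list R) (s S : C) : Prop :=
  has_sum (fun lambda => (0 < lambda)%R /\ (0 < rep_count b d lambda)%nat)
    (fun lambda => RtoC (INR (rep_count b d lambda)) * cpow lambda (- s))%C S.

Definition Lexp (beta : R) (d : list R) : R :=
  (ln (INR (length d)) / ln beta)%R.

Definition Ld (d : list R) (y : R) : R :=
  ln (Rsum (fun delta => exp (- delta * y)) d).

Definition Pfun (beta : R) (d : list R) (w : R) : R :=
  (Zseries (fun k => (IZR k + w + / 2) *
      (Ld d (Rpower beta (IZR k + w)) - Ld d (Rpower beta (IZR k + 1 + w))))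
   + / 2 * ln (INR (length d)))%R.

(* All lists of length [m] with entries at most [b]. *)
Fixpoint bounded_tuples (m b : nat) : list (list nat) :=
  match m with
  | O => nil :: nil
  | S m' => flat_map (fun x => map (cons x) (bounded_tuples m' b)) (seq 0 (S b))
  end.

(* [entry l h] is l_h, with h counted from 1. *)
Definition entry (l : list nat) (h : nat) : nat := nth (h - 1) l 0%nat.

(* The condition sum_h h l_h = m forces l_h <= m. *)
Definition weighted_tuples (m : nat) : list (list nat) :=
  filter (fun l => Nat.eqb (list_sum (map (fun h => (h * entry l h)%nat) (seq 1 m))) m)
    (bounded_tuples m m).

Definition ccoef (beta : R) (d : list R) (m : nat) : R :=
  Rsum (fun l =>
    Rprod (fun h => (/ INR (fact (entry l h)) *
             (maclaurin_coef (Ld d) h / (1 - beta ^ h)) ^ (entry l h))%R)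
      (seq 1 m))
    (weighted_tuples m).

(* t |-> prod_{k >= 1} |d| / sum_{delta in d} e^{- delta beta^{-k} t} *)
Definition prod_fun (beta : R) (d : list R) (t : R) : R :=
  real (Lim_seq (fun n =>
    Rprod (fun k => INR (length d) /
                    Rsum (fun delta => exp (- delta * / beta ^ k * t)) d)%R
      (seq 1 n))).

(* The defining property of an admissible constant sigma_{beta,d}. *)
Definition is_sigma (beta : R) (d : list R) (sigma : R) : Prop :=
  (0 < sigma)%R /\
  forall t : R, (Rabs t < sigma)%R ->
    ex_series (fun h => Rabs (maclaurin_coef (prod_fun beta d) h * t ^ h)).

Definition is_rho (beta sigma : R) (rho : nat) : Prop :=
  least (fun h => (/ beta ^ h < sigma)%R) rho.

Definition pole_point (beta : R) (d : list R) (j : nat) (k : Z) : C :=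
  (RtoC (Lexp beta d - INR j) - RtoC (2 * PI * / ln beta * IZR k) * Ci)%C.

(* Main.v *)
(* Put D(y) = sum_{delta in d} e^{-delta y} and F(t) = prod_{k >= 0} D(beta^k t).  Expanding the
   product gives F(t) - 1 = sum_lambda r(lambda) e^{- lambda t}, so that Gamma(s) zeta(s) is the
   Mellin transform of F - 1.  Put Phi(t) = prod_{k >= 1} |d| / D(t / beta^k).  The functional
   equations of F and Phi show that t^L F(t) / Phi(t) is invariant under t |-> beta t; summation by
   parts identifies it with E(t) = exp (P (log_beta t)).  Moreover Phi(t) = sum_l c(l) t^l for
   t < sigma, because log Phi has the Maclaurin coefficients ([y^h] L_d) / (1 - beta^h).

   Split the Mellin integral at a = beta^{-c} < sigma.  On (a, oo) it is entire and equals the sum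
   of incomplete gamma functions.  On (0, a) one has F = t^{-L} E sum_l c(l) t^l, and by periodicity
   int_0^a t^{e-1} E(t) dt is the integral over (a, beta a) divided by beta^e - 1, where
   e = s + l - L; subtracting N terms leaves an integral that converges for Re s > L - N.

   The theorem on removable singularities is avoided: every function involved is shown to have
   a holomorphic divided difference at each point.  For Mellin transforms this follows from
   Taylor expansions of order four under the integral sign.  1/Gamma is entire because Gamma has no
   zeros, which is seen for large real part and propagated by the functional equation. *)

Require Import Defs.
From Stdlib Require Import Reals ZArith List.
From Stdlib Require Import Lra Lia Permutation ClassicalEpsilon FunctionalExtensionality.
From Coquelicot Require Import Coquelicot.

Local Open Scope C_scope.

(** * Complex differentiability *)

(** Holomorphy means complex differentiability on a neighbourhood, while poles and residues ask for
    an explicit holomorphic numerator or regular part. Near a pole point the singular factor is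
    [1 / (beta^e - 1)], so the quotient of [beta^e - 1] by [w - z] has to be inverted, and its
    reciprocal must again have a divided difference; expansions of order four leave room for both.
    The number [sigma] only bounds a disc on which a Maclaurin series converges absolutely. The
    functional equation, proved near 0, is turned into an identity of coefficients, which carries it
    to the whole disc; iterating it towards 0 shows that the series still represents the product
    there. The strict inequality [a < sigma] makes the remainder after [N] terms tend to 0 uniformly
    on [(0, a]], and this yields the infinite sum over [l]. The sum over [lambda] is a limit of
    finite products [F_n], whose distance from [F] is at most [K x^n F(t) t^(- eta)]; this estimate
    is integrated directly. As [F] tends to 1 at infinity and grows like [t^(-L)] at 0, the limit is
    taken separately on the two sides of [a]. *)

Lemma locally_Cmod (z : C) (P : C -> Prop) :
  locally (T := C_UniformSpace) z P <->
  exists del : R, (0 < del)%R /\ forall w, (Cmod (w - z) < del)%R -> P w.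
Proof.
split.
- intros H. apply (locally_norm_le_locally (V := C_NormedModule)) in H.
  destruct H as [del H]. exists del; split; [apply cond_pos|].
  intros w Hw. now apply H.
- intros [del [Hd H]]. apply (locally_le_locally_norm (V := C_NormedModule)).
  exists (mkposreal del Hd). intros w Hw. now apply H.
Qed.

Lemma locally'_Cmod (z : C) (P : C -> Prop) :
  locally' (T := C_UniformSpace) z P <->
  exists del : R, (0 < del)%R /\ forall w, (Cmod (w - z) < del)%R -> w <> z -> P w.
Proof. apply (locally_Cmod z (fun w => w <> z -> P w)). Qed.

Lemma locally_all (z : C) (P : C -> Prop) :
  (forall w, P w) -> locally (T := C_UniformSpace) z P.
Proof. intros H. now apply filter_forall. Qed.

Lemma locally_C_imp (z : C) (P Q : C -> Prop) :
  locally (T := C_UniformSpace) z P -> (forall w, P w -> Q w) -> locally (T := C_UniformSpace) z Q.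
Proof. intros HP H. revert HP. now apply filter_imp. Qed.

Lemma locally_C_imp2 (z : C) (P Q S : C -> Prop) :
  locally (T := C_UniformSpace) z P -> locally (T := C_UniformSpace) z Q ->
  (forall w, P w -> Q w -> S w) -> locally (T := C_UniformSpace) z S.
Proof.
intros HP HQ H. generalize (filter_and _ _ HP HQ). apply filter_imp. intros w [A B]. now apply H.
Qed.

Section ContinuousC.
Context {U : UniformSpace}.

Lemma continuous_Rplus (f g : U -> R) (t : U) :
  continuous f t -> continuous g t -> continuous (fun t => f t + g t)%R t.
Proof. exact (continuous_plus (V := R_NormedModule) f g t). Qed.

Lemma continuous_Rmult (f g : U -> R) (t : U) :
  continuous f t -> continuous g t -> continuous (fun t => f t * g t)%R t.
Proof. exact (continuous_mult (K := R_AbsRing) f g t). Qed.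

Lemma continuous_Ropp (f : U -> R) (t : U) :
  continuous f t -> continuous (fun t => - f t)%R t.
Proof. exact (continuous_opp (V := R_NormedModule) f t). Qed.

Lemma continuous_C (f : U -> C) (t : U) :
  continuous (fun t => Re (f t)) t -> continuous (fun t => Im (f t)) t ->
  continuous (U := C_UniformSpace) f t.
Proof.
intros H1 H2.
apply filterlim_locally. intros eps.
apply filterlim_locally with (eps := eps) in H1.
apply filterlim_locally with (eps := eps) in H2.
generalize (filter_and _ _ H1 H2). apply filter_imp. intros x [h1 h2]. split; assumption.
Qed.

Lemma continuous_Re (f : U -> C) (t : U) :
  continuous (U := C_UniformSpace) f t -> continuous (fun t => Re (f t)) t.
Proof.
intros H. apply filterlim_locally. intros eps.
apply filterlim_locally with (eps := eps) in H.
revert H; apply filter_imp; intros x [h _]; exact h.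
Qed.

Lemma continuous_Im (f : U -> C) (t : U) :
  continuous (U := C_UniformSpace) f t -> continuous (fun t => Im (f t)) t.
Proof.
intros H. apply filterlim_locally. intros eps.
apply filterlim_locally with (eps := eps) in H.
revert H; apply filter_imp; intros x [_ h]; exact h.
Qed.

Lemma continuous_Cplus (f g : U -> C) (t : U) :
  continuous (U := C_UniformSpace) f t -> continuous (U := C_UniformSpace) g t ->
  continuous (U := C_UniformSpace) (fun t => f t + g t) t.
Proof.
intros Hf Hg.
assert (A := continuous_Re f t Hf). assert (B := continuous_Im f t Hf).
assert (A' := continuous_Re g t Hg). assert (B' := continuous_Im g t Hg).
apply continuous_C; simpl.
- exact (continuous_Rplus _ _ t A A').
- exact (continuous_Rplus _ _ t B B').
Qed.

Lemma continuous_Cmult (f g : U -> C) (t : U) :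
  continuous (U := C_UniformSpace) f t -> continuous (U := C_UniformSpace) g t ->
  continuous (U := C_UniformSpace) (fun t => f t * g t) t.
Proof.
intros Hf Hg.
assert (A := continuous_Re f t Hf). assert (B := continuous_Im f t Hf).
assert (A' := continuous_Re g t Hg). assert (B' := continuous_Im g t Hg).
apply continuous_C; simpl.
- exact (continuous_Rplus _ _ t (continuous_Rmult _ _ t A A')
    (continuous_Ropp _ t (continuous_Rmult _ _ t B B'))).
- exact (continuous_Rplus _ _ t (continuous_Rmult _ _ t A B') (continuous_Rmult _ _ t B A')).
Qed.

Lemma continuous_RtoC (f : U -> R) (t : U) :
  continuous f t -> continuous (U := C_UniformSpace) (fun t => RtoC (f t)) t.
Proof. intros H; apply continuous_C; simpl; [exact H | apply continuous_const]. Qed.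

Lemma continuous_Cinv (f : U -> C) (t : U) :
  continuous (U := C_UniformSpace) f t -> f t <> 0 ->
  continuous (U := C_UniformSpace) (fun t => / f t) t.
Proof.
intros Hf H0.
assert (Hn : (Re (f t) ^ 2 + Im (f t) ^ 2 <> 0)%R).
{ rewrite <- Cmod2_alt. apply pow_nonzero. intro E. apply H0. now apply Cmod_eq_0. }
assert (Hd : continuous (fun t => / (Re (f t) ^ 2 + Im (f t) ^ 2))%R t).
{ apply (continuous_comp (fun t => Re (f t) ^ 2 + Im (f t) ^ 2)%R Rinv).
  - assert (A := continuous_Re f t Hf). assert (B := continuous_Im f t Hf).
    apply continuous_ext with (f := fun t => (Re (f t) * Re (f t) + Im (f t) * Im (f t))%R).
    + intros x; simpl; ring.
    + exact (continuous_Rplus _ _ t (continuous_Rmult _ _ t A A) (continuous_Rmult _ _ t B B)).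
  - now apply continuous_Rinv. }
apply continuous_C.
- exact (continuous_Rmult _ _ t (continuous_Re f t Hf) Hd).
- exact (continuous_Rmult _ _ t (continuous_Ropp _ t (continuous_Im f t Hf)) Hd).
Qed.

End ContinuousC.

(* Caratheodory's form of complex differentiability; sums, products and
   quotients then reduce to continuity of the difference quotients. *)
Definition cdiff (f : C -> C) (z : C) : Prop :=
  exists phi : C -> C, continuous (T := C_UniformSpace) (U := C_UniformSpace) phi z /\
    locally (T := C_UniformSpace) z (fun w => f w = f z + (w - z) * phi w).

Definition dquot (f : C -> C) (z l w : C) : C :=
  if excluded_middle_informative (w = z) then l else (f w - f z) / (w - z).

Lemma Cminus_neq_0 (w z : C) : w <> z -> w - z <> 0.
Proof. intros H Q. apply H. replace w with (w - z + z) by ring. rewrite Q. ring. Qed.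

Lemma dquot_eq (f : C -> C) (z l : C) : dquot f z l z = l.
Proof. unfold dquot. now destruct (excluded_middle_informative (z = z)). Qed.

Lemma dquot_neq (f : C -> C) (z l w : C) : w <> z -> dquot f z l w = (f w - f z) / (w - z).
Proof. unfold dquot. now destruct (excluded_middle_informative (w = z)). Qed.

Lemma dquot_spec (f : C -> C) (z l w : C) : f w = f z + (w - z) * dquot f z l w.
Proof.
destruct (excluded_middle_informative (w = z)) as [->|E]; [ring|].
rewrite dquot_neq by exact E. field. now apply Cminus_neq_0.
Qed.

Lemma Cmod_triangle_minus (x y : C) : (Cmod (x - y) <= Cmod x + Cmod y)%R.
Proof.
unfold Cminus. eapply Rle_trans; [apply Cmod_triangle|]. rewrite Cmod_opp. lra.
Qed.

Lemma continuous_C_eps (f : C -> C) (z : C) :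
  continuous (T := C_UniformSpace) (U := C_UniformSpace) f z <->
  forall eps, (0 < eps)%R -> exists del, (0 < del)%R /\
    forall w, (Cmod (w - z) < del)%R -> (Cmod (f w - f z) < eps)%R.
Proof.
split.
- intros H eps He.
  assert (L : locally (T := C_UniformSpace) (f z) (fun y => (Cmod (y - f z) < eps)%R))
    by (apply locally_Cmod; exists eps; now split).
  apply H in L. unfold filtermap in L. now apply locally_Cmod in L.
- intros H P HP. apply locally_Cmod in HP. destruct HP as [eps [He HP]].
  destruct (H eps He) as [del [Hd H']]. apply locally_Cmod. exists del. split; [easy|].
  intros w Hw. apply HP. now apply H'.
Qed.

Lemma ex_derive_C_iff (f : C -> C) (z : C) :
  ex_derive (K := C_AbsRing) (V := C_NormedModule) f z <->
  exists l, forall eps, (0 < eps)%R -> exists del, (0 < del)%R /\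
    forall w, (Cmod (w - z) < del)%R ->
      (Cmod (f w - f z - (w - z) * l) <= eps * Cmod (w - z))%R.
Proof.
split.
- intros [l [_ H]]. exists l. intros eps He.
  specialize (H z (fun P HP => HP) (mkposreal eps He)).
  apply locally_C in H. apply locally_Cmod in H. exact H.
- intros [l H]. exists l. split; [apply is_linear_scal_l|].
  intros x Hx. apply (is_filter_lim_locally_unique (V := AbsRing_NormedModule C_AbsRing)) in Hx.
  subst x. intros eps. destruct (H eps (cond_pos eps)) as [del H'].
  apply locally_C. apply locally_Cmod. exists del. exact H'.
Qed.

Lemma cdiff_iff (f : C -> C) (z : C) :
  cdiff f z <-> ex_derive (K := C_AbsRing) (V := C_NormedModule) f z.
Proof.
rewrite ex_derive_C_iff. split.
- intros [phi [Hc Hl]]. exists (phi z). intros eps He.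
  apply locally_Cmod in Hl. destruct Hl as [d1 [Hd1 Hl]].
  destruct (proj1 (continuous_C_eps phi z) Hc eps He) as [d2 [Hd2 H2]].
  exists (Rmin d1 d2). split; [now apply Rmin_pos|]. intros w Hw.
  rewrite Hl by (eapply Rlt_le_trans; [exact Hw|apply Rmin_l]).
  replace (f z + (w - z) * phi w - f z - (w - z) * phi z)
    with ((w - z) * (phi w - phi z)) by ring.
  rewrite Cmod_mult, Rmult_comm. apply Rmult_le_compat_r; [apply Cmod_ge_0|].
  left. apply H2. eapply Rlt_le_trans; [exact Hw|apply Rmin_r].
- intros [l H].
  exists (dquot f z l). split.
  + apply continuous_C_eps. intros eps He.
    destruct (H (eps / 2)%R) as [del [Hd H']]; [lra|].
    exists del. split; [easy|]. intros w Hw. rewrite dquot_eq.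
    destruct (excluded_middle_informative (w = z)) as [->|E].
    * rewrite dquot_eq. replace (l - l) with (RtoC 0) by ring. now rewrite Cmod_0.
    * rewrite dquot_neq by exact E. assert (Hn := Cminus_neq_0 w z E).
      replace ((f w - f z) / (w - z) - l) with ((f w - f z - (w - z) * l) / (w - z))
        by (field; exact Hn).
      rewrite Cmod_div by exact Hn. apply Cmod_gt_0 in Hn.
      apply Rle_lt_trans with (eps / 2)%R; [|lra].
      apply Rle_div_l; [exact Hn|]. now apply H'.
  + apply locally_all. intros w. apply dquot_spec.
Qed.

Lemma cdiff_continuous (f : C -> C) (z : C) :
  cdiff f z -> continuous (T := C_UniformSpace) (U := C_UniformSpace) f z.
Proof.
intros [phi [Hc Hl]].
apply continuous_ext_loc with (g := fun w => f z + (w - z) * phi w).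
- revert Hl; apply filter_imp; intros w E; now rewrite E.
- apply continuous_Cplus; [apply continuous_const|].
  apply continuous_Cmult; [|exact Hc].
  apply (continuous_Cplus (fun w => w) (fun _ => - z)); [apply continuous_id|apply continuous_const].
Qed.

Lemma cdiff_ext_loc (f g : C -> C) (z : C) :
  locally (T := C_UniformSpace) z (fun w => f w = g w) -> cdiff f z -> cdiff g z.
Proof.
intros E [phi [Hc Hl]]. exists phi. split; [easy|].
assert (E0 := locally_singleton _ _ E). simpl in E0.
generalize (filter_and _ _ E Hl). apply filter_imp. intros w [E1 E2]. congruence.
Qed.

Lemma cdiff_const (c z : C) : cdiff (fun _ => c) z.
Proof.
exists (fun _ => RtoC 0). split; [apply continuous_const|]. apply locally_all; intros w; ring.
Qed.

Lemma cdiff_id (z : C) : cdiff (fun w => w) z.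
Proof.
exists (fun _ => RtoC 1). split; [apply continuous_const|]. apply locally_all; intros w; ring.
Qed.

Lemma cdiff_plus (f g : C -> C) (z : C) :
  cdiff f z -> cdiff g z -> cdiff (fun w => f w + g w) z.
Proof.
intros [p [Hp Hf]] [r [Hr Hg]]. exists (fun w => p w + r w).
split; [now apply continuous_Cplus|].
generalize (filter_and _ _ Hf Hg); apply filter_imp; intros w [E1 E2]. rewrite E1, E2. ring.
Qed.

Lemma cdiff_mult (f g : C -> C) (z : C) :
  cdiff f z -> cdiff g z -> cdiff (fun w => f w * g w) z.
Proof.
intros Hf Hg. assert (Cg := cdiff_continuous g z Hg).
destruct Hf as [p [Hp Hf]]. destruct Hg as [r [Hr Hg]].
exists (fun w => p w * g w + f z * r w).
split.
- apply continuous_Cplus; apply continuous_Cmult; try easy; apply continuous_const.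
- generalize (filter_and _ _ Hf Hg); apply filter_imp; intros w [E1 E2]. rewrite E1.
  replace ((f z + (w - z) * p w) * g w) with (f z * g w + (w - z) * p w * g w) by ring.
  rewrite E2 at 1. ring.
Qed.

Lemma continuous_C_neq_0 (f : C -> C) (z : C) :
  continuous (T := C_UniformSpace) (U := C_UniformSpace) f z -> f z <> 0 ->
  locally (T := C_UniformSpace) z (fun w => f w <> 0).
Proof.
intros H H0. apply Cmod_gt_0 in H0.
destruct (proj1 (continuous_C_eps f z) H _ H0) as [del [Hd H']].
apply locally_Cmod. exists del. split; [easy|]. intros w Hw E.
specialize (H' w Hw). rewrite E in H'.
replace (0 - f z) with (- f z) in H' by ring. rewrite Cmod_opp in H'. lra.
Qed.

Lemma cdiff_inv (f : C -> C) (z : C) :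
  cdiff f z -> f z <> 0 -> cdiff (fun w => / f w) z.
Proof.
intros Hf H0. assert (Cf := cdiff_continuous f z Hf).
destruct Hf as [p [Hp Hf]].
exists (fun w => - (/ f z) * p w * / f w).
split.
- apply continuous_Cmult; [|now apply continuous_Cinv].
  apply continuous_Cmult; [apply continuous_const|easy].
- generalize (filter_and (F := locally (T := C_UniformSpace) z) _ _ Hf (continuous_C_neq_0 f z Cf H0)); apply filter_imp; intros w [E1 E2].
  replace (/ f w) with (/ f z + (f z - f w) / (f z * f w)) by (now field).
  rewrite E1 at 1. now field.
Qed.

(** * Holomorphy on a neighbourhood and divided differences *)

Definition hol (f : C -> C) (z : C) : Prop := locally (T := C_UniformSpace) z (cdiff f).

Lemma hol_holomorphic_at (f : C -> C) (z : C) : hol f z <-> holomorphic_at f z.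
Proof. unfold hol, holomorphic_at. split; apply filter_imp; intros w; apply cdiff_iff. Qed.

Lemma hol_cdiff (f : C -> C) (z : C) : hol f z -> cdiff f z.
Proof. exact (locally_singleton (T := C_UniformSpace) z (cdiff f)). Qed.

Lemma hol_continuous (f : C -> C) (z : C) :
  hol f z -> continuous (T := C_UniformSpace) (U := C_UniformSpace) f z.
Proof. intros H; now apply cdiff_continuous, hol_cdiff. Qed.

Lemma hol_ext_loc (f g : C -> C) (z : C) :
  locally (T := C_UniformSpace) z (fun w => f w = g w) -> hol f z -> hol g z.
Proof.
intros E H. apply (locally_locally (T := C_UniformSpace)) in E.
refine (locally_C_imp2 _ _ _ _ E H _). intros w E' H'. now apply cdiff_ext_loc with f.
Qed.

Lemma hol_const (c z : C) : hol (fun _ => c) z.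
Proof. apply locally_all; intros w; apply cdiff_const. Qed.

Lemma hol_id (z : C) : hol (fun w => w) z.
Proof. apply locally_all; intros w; apply cdiff_id. Qed.

Lemma hol_plus (f g : C -> C) (z : C) : hol f z -> hol g z -> hol (fun w => f w + g w) z.
Proof.
intros Hf Hg. refine (locally_C_imp2 _ _ _ _ Hf Hg _); intros w A B.
now apply cdiff_plus.
Qed.

Lemma hol_mult (f g : C -> C) (z : C) : hol f z -> hol g z -> hol (fun w => f w * g w) z.
Proof.
intros Hf Hg. refine (locally_C_imp2 _ _ _ _ Hf Hg _); intros w A B.
now apply cdiff_mult.
Qed.

Lemma hol_inv (f : C -> C) (z : C) : hol f z -> f z <> 0 -> hol (fun w => / f w) z.
Proof.
intros Hf H0. refine (locally_C_imp2 _ _ _ _ Hf (continuous_C_neq_0 f z (hol_continuous f z Hf) H0) _).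
intros w A B. now apply cdiff_inv.
Qed.

(* The extra divided difference replaces the theorem on removable singularities. *)
Definition nice (f : C -> C) (z : C) : Prop :=
  hol f z /\ exists g, hol g z /\
    locally (T := C_UniformSpace) z (fun w => f w = f z + (w - z) * g w).

Lemma nice_hol (f : C -> C) (z : C) : nice f z -> hol f z.
Proof. now intros [H _]. Qed.

Lemma nice_ext_loc (f g : C -> C) (z : C) :
  locally (T := C_UniformSpace) z (fun w => f w = g w) -> nice f z -> nice g z.
Proof.
intros E [H [h [Hh Hl]]]. split; [now apply hol_ext_loc with f|].
exists h. split; [easy|]. assert (E0 := locally_singleton _ _ E). simpl in E0.
generalize (filter_and _ _ E Hl). apply filter_imp. intros w [E1 E2]. congruence.
Qed.

Lemma nice_ext (f g : C -> C) (z : C) : (forall w, f w = g w) -> nice f z -> nice g z.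
Proof. intros E; apply nice_ext_loc; now apply locally_all. Qed.

Lemma nice_const (c z : C) : nice (fun _ => c) z.
Proof.
split; [apply hol_const|]. exists (fun _ => RtoC 0). split; [apply hol_const|].
apply locally_all; intros w; ring.
Qed.

Lemma nice_id (z : C) : nice (fun w => w) z.
Proof.
split; [apply hol_id|]. exists (fun _ => RtoC 1). split; [apply hol_const|].
apply locally_all; intros w; ring.
Qed.

Lemma nice_plus (f g : C -> C) (z : C) : nice f z -> nice g z -> nice (fun w => f w + g w) z.
Proof.
intros [Hf [f1 [H1 E1]]] [Hg [g1 [H2 E2]]]. split; [now apply hol_plus|].
exists (fun w => f1 w + g1 w). split; [now apply hol_plus|].
generalize (filter_and _ _ E1 E2); apply filter_imp; intros w [A B]. rewrite A, B. ring.
Qed.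

Lemma nice_mult (f g : C -> C) (z : C) : nice f z -> nice g z -> nice (fun w => f w * g w) z.
Proof.
intros [Hf [f1 [H1 E1]]] [Hg [g1 [H2 E2]]]. split; [now apply hol_mult|].
exists (fun w => f1 w * g w + f z * g1 w). split.
- apply hol_plus; apply hol_mult; try easy; apply hol_const.
- generalize (filter_and _ _ E1 E2); apply filter_imp; intros w [A B]. rewrite A.
  replace ((f z + (w - z) * f1 w) * g w) with (f z * g w + (w - z) * f1 w * g w) by ring.
  rewrite B at 1. ring.
Qed.

Lemma nice_inv (f : C -> C) (z : C) : nice f z -> f z <> 0 -> nice (fun w => / f w) z.
Proof.
intros [Hf [f1 [H1 E1]]] H0. split; [now apply hol_inv|].
exists (fun w => - (/ f z) * f1 w * / f w). split.
- apply hol_mult; [|now apply hol_inv]. apply hol_mult; [apply hol_const|easy].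
- generalize (filter_and _ _ E1 (continuous_C_neq_0 f z (hol_continuous f z Hf) H0)).
  apply filter_imp; intros w [A B].
  replace (/ f w) with (/ f z + (f z - f w) / (f z * f w)) by (now field).
  rewrite A at 1. now field.
Qed.

Lemma locally_translate (z c : C) (P : C -> Prop) :
  locally (T := C_UniformSpace) (z + c) P -> locally (T := C_UniformSpace) z (fun w => P (w + c)).
Proof.
intros H. apply locally_Cmod in H. destruct H as [del [Hd H]]. apply locally_Cmod.
exists del. split; [easy|]. intros w Hw. apply H. now replace (w + c - (z + c)) with (w - z) by ring.
Qed.

Lemma cdiff_translate (f : C -> C) (z c : C) : cdiff f (z + c) -> cdiff (fun w => f (w + c)) z.
Proof.
intros [p [Hp Hf]]. exists (fun w => p (w + c)). split.
- intros P HP. apply Hp in HP. exact (locally_translate z c _ HP).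
- apply locally_translate in Hf. revert Hf. apply filter_imp. intros w E.
  rewrite E. now replace (w + c - (z + c)) with (w - z) by ring.
Qed.

Lemma hol_translate (f : C -> C) (z c : C) : hol f (z + c) -> hol (fun w => f (w + c)) z.
Proof.
intros H. apply locally_translate in H. unfold hol. revert H. apply filter_imp.
intros w. apply cdiff_translate.
Qed.

Lemma nice_translate (f : C -> C) (z c : C) : nice f (z + c) -> nice (fun w => f (w + c)) z.
Proof.
intros [Hf [g [Hg E]]]. split; [now apply hol_translate|].
exists (fun w => g (w + c)). split; [now apply hol_translate|].
apply locally_translate in E. revert E. apply filter_imp. intros w E.
rewrite E. now replace (w + c - (z + c)) with (w - z) by ring.
Qed.

(* Order four makes two successive divided differences at [z] complex differentiable at [z]. *)
Definition expansion4 (f : C -> C) (z : C) : Prop :=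
  exists (a1 a2 a3 : C) (M : R), locally (T := C_UniformSpace) z (fun w =>
    (Cmod (f w - (f z + (w - z) * a1 + (w - z) ^ 2 * a2 + (w - z) ^ 3 * a3)) <= M * Cmod (w - z) ^ 4)%R).

Lemma locally_Cmod_lt (z : C) (r : R) : (0 < r)%R ->
  locally (T := C_UniformSpace) z (fun w => (Cmod (w - z) < r)%R).
Proof. intros Hr. apply locally_Cmod. exists r. now split. Qed.

Lemma cdiff_quadratic (f : C -> C) (z a : C) (M : R) :
  locally (T := C_UniformSpace) z (fun w =>
    (Cmod (f w - (f z + (w - z) * a)) <= M * Cmod (w - z) ^ 2)%R) ->
  cdiff f z.
Proof.
intros H. apply cdiff_iff, ex_derive_C_iff. exists a. intros eps He.
assert (Hm : (0 < Rabs M + 1)%R) by (pose proof (Rabs_pos M); lra).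
(* For [|h|] below this radius [M |h|^2 <= eps |h|]; the [+ 1] avoids a division by zero. *)
assert (Hq : (0 < eps / (Rabs M + 1))%R) by now apply Rdiv_lt_0_compat.
apply locally_Cmod. refine (locally_C_imp2 _ _ _ _ H (locally_Cmod_lt z _ Hq) _).
intros w A B.
replace (f w - f z - (w - z) * a) with (f w - (f z + (w - z) * a)) by ring.
eapply Rle_trans; [exact A|].
assert (P := Cmod_ge_0 (w - z)). set (x := Cmod (w - z)) in *.
apply Rle_trans with ((Rabs M + 1) * x * x)%R.
- replace (M * x ^ 2)%R with (M * (x * x))%R by ring. rewrite Rmult_assoc.
  apply Rmult_le_compat_r; [nra|]. pose proof (Rle_abs M). lra.
- apply Rmult_le_compat_r; [easy|]. apply Rlt_le in B.
  apply (Rmult_le_compat_l (Rabs M + 1)) in B; [|lra].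
  replace ((Rabs M + 1) * (eps / (Rabs M + 1)))%R with eps in B by (field; lra). lra.
Qed.

Lemma pow_le_pow_le1 (x : R) (m n : nat) : (0 <= x <= 1)%R -> (m <= n)%nat -> (x ^ n <= x ^ m)%R.
Proof.
intros Hx Hmn. replace n with (m + (n - m))%nat by lia. rewrite pow_add.
rewrite <- (Rmult_1_r (x ^ m)) at 2. apply Rmult_le_compat_l; [now apply pow_le|].
rewrite <- (pow1 (n - m)). now apply pow_incr.
Qed.

(** For [|h| <= 1] the terms of order two to four are all at most a multiple of [|h|^2]. *)
Lemma expansion4_cdiff (f : C -> C) (z : C) : expansion4 f z -> cdiff f z.
Proof.
intros (a1 & a2 & a3 & M & H).
apply (cdiff_quadratic f z a1 (Cmod a2 + Cmod a3 + Rabs M)).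
refine (locally_C_imp2 _ _ _ _ H (locally_Cmod_lt z 1 Rlt_0_1) _). intros w A B.
set (h := w - z) in *.
replace (f w - (f z + h * a1)) with
  (h ^ 2 * a2 + h ^ 3 * a3 + (f w - (f z + h * a1 + h ^ 2 * a2 + h ^ 3 * a3))) by ring.
eapply Rle_trans; [apply Cmod_triangle|].
assert (K := Cmod_triangle (h ^ 2 * a2) (h ^ 3 * a3)).
rewrite !Cmod_mult, !Cmod_pow in K.
assert (P := Cmod_ge_0 h).
assert (Q3 := pow_le_pow_le1 (Cmod h) 2 3 ltac:(lra) ltac:(lia)).
assert (Q4 := pow_le_pow_le1 (Cmod h) 2 4 ltac:(lra) ltac:(lia)).
assert (0 <= Cmod h ^ 4)%R by now apply pow_le.
assert (M * Cmod h ^ 4 <= Rabs M * Cmod h ^ 2)%R.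
{ apply Rle_trans with (Rabs M * Cmod h ^ 4)%R.
  - apply Rmult_le_compat_r; [easy|apply Rle_abs].
  - apply Rmult_le_compat_l; [apply Rabs_pos|easy]. }
assert (Cmod h ^ 3 * Cmod a3 <= Cmod h ^ 2 * Cmod a3)%R
  by (apply Rmult_le_compat_r; [apply Cmod_ge_0|easy]).
nra.
Qed.

(** The expansion at [z] gives the divided differences at [z]; those at neighbouring points give
    differentiability around [z]. *)
Definition smooth (f : C -> C) (z : C) : Prop :=
  locally (T := C_UniformSpace) z (expansion4 f).

Lemma smooth_hol (f : C -> C) (z : C) : smooth f z -> hol f z.
Proof.
unfold smooth, hol. apply filter_imp. intros w; apply expansion4_cdiff.
Qed.

(** Away from [z] this is a quotient of differentiable functions, so only the point [z] itself needs
    an argument. *)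
Lemma hol_dquot (f : C -> C) (z l : C) :
  hol f z -> cdiff (dquot f z l) z -> hol (dquot f z l) z.
Proof.
intros Hf Hz. unfold hol in *. revert Hf. apply filter_imp. intros w Hw.
destruct (excluded_middle_informative (w = z)) as [->|E]; [exact Hz|].
apply cdiff_ext_loc with (f := fun v => (f v + - f z) * / (v + - z)).
- apply locally_Cmod. exists (Cmod (w - z)). split; [now apply Cmod_gt_0, Cminus_neq_0|].
  intros v Hv. rewrite dquot_neq; [reflexivity|]. intros ->.
  replace (z - w) with (- (w - z)) in Hv by ring. rewrite Cmod_opp in Hv. lra.
- apply cdiff_mult.
  + apply cdiff_plus; [exact Hw|apply cdiff_const].
  + apply cdiff_inv; [apply cdiff_plus; [apply cdiff_id|apply cdiff_const]|].
    now apply Cminus_neq_0.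
Qed.

Lemma dquot_bound (f : C -> C) (z l P : C) (M : R) (n : nat) (w : C) :
  (Cmod (f w - (f z + (w - z) * P)) <= M * Cmod (w - z) ^ S n)%R -> w <> z ->
  (Cmod (dquot f z l w - P) <= M * Cmod (w - z) ^ n)%R.
Proof.
intros H E. rewrite (dquot_neq f z l w E). assert (Hn := Cminus_neq_0 w z E).
replace ((f w - f z) / (w - z) - P) with ((f w - (f z + (w - z) * P)) / (w - z)) by (now field).
rewrite Cmod_div by easy. apply Cmod_gt_0 in Hn. apply Rle_div_l; [easy|].
simpl in H. lra.
Qed.

Lemma hol_dquot_expansion (f : C -> C) (z a1 a2 : C) (M : R) :
  hol f z ->
  locally (T := C_UniformSpace) z (fun w =>
    (Cmod (f w - (f z + (w - z) * (a1 + (w - z) * a2))) <= M * Cmod (w - z) ^ 3)%R) ->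
  hol (dquot f z a1) z.
Proof.
intros Hf H. apply hol_dquot; [easy|]. apply (cdiff_quadratic _ z a2 M).
revert H. apply filter_imp. intros w Hw. rewrite dquot_eq.
destruct (excluded_middle_informative (w = z)) as [->|E].
- rewrite dquot_eq. replace (a1 - (a1 + (z - z) * a2)) with (RtoC 0) by ring.
  replace (z - z) with (RtoC 0) by ring. rewrite Cmod_0. simpl; lra.
- now apply dquot_bound.
Qed.

(** Each division by [w - z] lowers the order of the error by one, and differentiability at [z]
    needs order two, so an error of order four permits two divisions. That the quotient is itself
    [nice] is needed at a simple pole, where it is inverted and then divided once more. *)
Lemma smooth_nice_dquot (f : C -> C) (z a1 a2 a3 : C) (M : R) : smooth f z ->
  locally (T := C_UniformSpace) z (fun w =>
    (Cmod (f w - (f z + (w - z) * a1 + (w - z) ^ 2 * a2 + (w - z) ^ 3 * a3)) <= M * Cmod (w - z) ^ 4)%R) ->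
  exists g, nice g z /\ g z = a1 /\ forall w, f w = f z + (w - z) * g w.
Proof.
intros Hs H. assert (Hf := smooth_hol f z Hs).
assert (H3 : locally (T := C_UniformSpace) z (fun w =>
  (Cmod (f w - (f z + (w - z) * (a1 + (w - z) * a2))) <= (Cmod a3 + Rabs M) * Cmod (w - z) ^ 3)%R)).
{ refine (locally_C_imp2 _ _ _ _ H (locally_Cmod_lt z 1 Rlt_0_1) _). intros w A B.
  set (h := w - z) in *.
  replace (f w - (f z + h * (a1 + h * a2))) with
    (h ^ 3 * a3 + (f w - (f z + h * a1 + h ^ 2 * a2 + h ^ 3 * a3))) by ring.
  eapply Rle_trans; [apply Cmod_triangle|]. rewrite !Cmod_mult, !Cmod_pow.
  assert (P := Cmod_ge_0 h).
  assert (Q4 := pow_le_pow_le1 (Cmod h) 3 4 ltac:(lra) ltac:(lia)).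
  assert (0 <= Cmod h ^ 4)%R by now apply pow_le.
  assert (M * Cmod h ^ 4 <= Rabs M * Cmod h ^ 3)%R.
  { apply Rle_trans with (Rabs M * Cmod h ^ 4)%R.
    - apply Rmult_le_compat_r; [easy|apply Rle_abs].
    - apply Rmult_le_compat_l; [apply Rabs_pos|easy]. }
  nra. }
assert (Hg := hol_dquot_expansion f z a1 a2 _ Hf H3).
exists (dquot f z a1). split; [|split; [apply dquot_eq|intros w; apply dquot_spec]].
split; [exact Hg|]. exists (dquot (dquot f z a1) z a2). split.
- apply (hol_dquot_expansion _ z a2 a3 M Hg).
  revert H. apply filter_imp. intros w Hw. rewrite dquot_eq.
  destruct (excluded_middle_informative (w = z)) as [->|E].
  + rewrite dquot_eq. replace (a1 - (a1 + (z - z) * (a2 + (z - z) * a3))) with (RtoC 0) by ring.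
    replace (z - z) with (RtoC 0) by ring. rewrite Cmod_0. simpl; lra.
  + apply dquot_bound; [|easy].
    replace (f z + (w - z) * (a1 + (w - z) * (a2 + (w - z) * a3)))
      with (f z + (w - z) * a1 + (w - z) ^ 2 * a2 + (w - z) ^ 3 * a3) by ring. exact Hw.
- apply locally_all. intros w. exact (dquot_spec (dquot f z a1) z a2 w).
Qed.

Lemma smooth_nice (f : C -> C) (z : C) : smooth f z -> nice f z.
Proof.
intros H. split; [now apply smooth_hol|].
destruct (locally_singleton _ _ H) as (a1 & a2 & a3 & M & H').
destruct (smooth_nice_dquot f z a1 a2 a3 M H H') as [g [Hg [_ E]]]. exists g.
split; [now apply nice_hol|now apply locally_all].
Qed.

Lemma expansion4_affine (f : C -> C) (a b z : C) :
  expansion4 f (a * z + b) -> expansion4 (fun w => f (a * w + b)) z.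
Proof.
intros (a1 & a2 & a3 & M & H).
exists (a * a1), (a ^ 2 * a2), (a ^ 3 * a3), (M * Cmod a ^ 4)%R.
apply locally_Cmod in H. destruct H as [del [Hd H]].
(* The [+ 1] covers the case [a = 0]. *)
apply locally_Cmod. exists (del / (Cmod a + 1))%R.
assert (P := Cmod_ge_0 a). split; [apply Rdiv_lt_0_compat; lra|].
intros w Hw.
assert (E : a * w + b - (a * z + b) = a * (w - z)) by ring.
specialize (H (a * w + b)). rewrite E in H.
replace (M * Cmod a ^ 4 * Cmod (w - z) ^ 4)%R with (M * Cmod (a * (w - z)) ^ 4)%R
  by (rewrite Cmod_mult; ring).
replace (f (a * z + b) + (w - z) * (a * a1) + (w - z) ^ 2 * (a ^ 2 * a2) + (w - z) ^ 3 * (a ^ 3 * a3))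
  with (f (a * z + b) + a * (w - z) * a1 + (a * (w - z)) ^ 2 * a2 + (a * (w - z)) ^ 3 * a3) by ring.
apply H. rewrite Cmod_mult.
apply Rle_lt_trans with ((Cmod a + 1) * Cmod (w - z))%R.
- pose proof (Cmod_ge_0 (w - z)). nra.
- apply Rlt_div_r in Hw; lra.
Qed.

Lemma smooth_affine (f : C -> C) (a b z : C) :
  smooth f (a * z + b) -> smooth (fun w => f (a * w + b)) z.
Proof.
intros H. assert (Cc : continuous (T := C_UniformSpace) (U := C_UniformSpace) (fun w => a * w + b) z).
{ apply continuous_Cplus; [|apply continuous_const].
  apply continuous_Cmult; [apply continuous_const|apply continuous_id]. }
apply Cc in H. unfold filtermap in H. unfold smooth. revert H. apply filter_imp. intros w. apply expansion4_affine.
Qed.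

(** * The complex exponential *)

Lemma Cexp_plus (a b : C) : Cexp (a + b) = Cexp a * Cexp b.
Proof.
unfold Cexp. destruct a as [a1 a2], b as [b1 b2]. unfold Cmult; simpl.
rewrite exp_plus, cos_plus, sin_plus. f_equal; ring.
Qed.

Lemma Cexp_0 : Cexp 0 = 1.
Proof. unfold Cexp; simpl. rewrite exp_0, cos_0, sin_0. unfold RtoC. f_equal; ring. Qed.

Lemma Cmod_Cexp (z : C) : Cmod (Cexp z) = exp (Re z).
Proof.
unfold Cmod, Cexp; simpl.
replace (exp (Re z) * cos (Im z) * (exp (Re z) * cos (Im z) * 1) +
  exp (Re z) * sin (Im z) * (exp (Re z) * sin (Im z) * 1))%R
  with ((exp (Re z))² * ((sin (Im z))² + (cos (Im z))²))%R by (unfold Rsqr; ring).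
rewrite sin2_cos2, Rmult_1_r. apply sqrt_Rsqr. left; apply exp_pos.
Qed.

Lemma Cexp_neq_0 (z : C) : Cexp z <> 0.
Proof. apply Cmod_gt_0. rewrite Cmod_Cexp. apply exp_pos. Qed.

Lemma Cexp_opp (z : C) : Cexp (- z) = / Cexp z.
Proof.
assert (H := Cexp_plus z (- z)). replace (z + - z) with (RtoC 0) in H by ring.
rewrite Cexp_0 in H. assert (Hn := Cexp_neq_0 z).
replace (Cexp (- z)) with (/ Cexp z * (Cexp z * Cexp (- z))) by (now field).
rewrite <- H. ring.
Qed.

Lemma Cexp_RtoC (x : R) : Cexp (RtoC x) = RtoC (exp x).
Proof. unfold Cexp, RtoC; simpl. rewrite cos_0, sin_0. f_equal; ring. Qed.

(** * Derivatives and integrals of complex functions of a real variable *)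

Definition cder (f : R -> C) (x : R) (l : C) : Prop :=
  is_derive (fun x => Re (f x)) x (Re l) /\ is_derive (fun x => Im (f x)) x (Im l).

Lemma cder_eq (f : R -> C) (x : R) (l l' : C) : cder f x l -> l = l' -> cder f x l'.
Proof. now intros H <-. Qed.

Lemma cder_ext (f g : R -> C) (x : R) (l : C) : (forall y, f y = g y) -> cder f x l -> cder g x l.
Proof.
intros E [A B]. split.
- revert A; apply is_derive_ext; intros t; now rewrite E.
- revert B; apply is_derive_ext; intros t; now rewrite E.
Qed.

Lemma cder_continuous (f : R -> C) (x : R) (l : C) :
  cder f x l -> continuous (U := C_UniformSpace) f x.
Proof.
intros [A B]. apply continuous_C; apply (ex_derive_continuous (K := R_AbsRing) (V := R_NormedModule)).
- now exists (Re l).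
- now exists (Im l).
Qed.

Lemma cder_const (c : C) (x : R) : cder (fun _ => c) x 0.
Proof. split; apply (is_derive_const (K := R_AbsRing) (V := R_NormedModule)). Qed.

Lemma cder_plus (f g : R -> C) (x : R) (l m : C) :
  cder f x l -> cder g x m -> cder (fun t => f t + g t) x (l + m).
Proof.
intros [A B] [A' B']. split.
- exact (is_derive_plus (V := R_NormedModule) (fun t => Re (f t)) (fun t => Re (g t)) x _ _ A A').
- exact (is_derive_plus (V := R_NormedModule) (fun t => Im (f t)) (fun t => Im (g t)) x _ _ B B').
Qed.

Lemma is_derive_Rmult (f g : R -> R) (x l m : R) :
  is_derive f x l -> is_derive g x m -> is_derive (fun t => f t * g t)%R x (l * g x + f x * m)%R.
Proof. intros A B. apply (is_derive_mult (K := R_AbsRing) f g x l m A B). apply Rmult_comm. Qed.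

Lemma cder_mult (f g : R -> C) (x : R) (l m : C) :
  cder f x l -> cder g x m -> cder (fun t => f t * g t) x (l * g x + f x * m).
Proof.
intros [A B] [A' B']. split; simpl.
- assert (P := is_derive_minus (V := R_NormedModule) _ _ x _ _
    (is_derive_Rmult _ _ _ _ _ A A') (is_derive_Rmult _ _ _ _ _ B B')).
  eapply is_derive_ext_loc; [apply filter_forall; intros t; reflexivity|].
  match type of P with is_derive _ _ ?l => match goal with |- is_derive _ _ ?m =>
    replace m with l; [exact P|] end end. unfold minus, plus, opp; simpl. unfold Re, Im. ring.
- assert (P := is_derive_plus (V := R_NormedModule) _ _ x _ _
    (is_derive_Rmult _ _ _ _ _ A B') (is_derive_Rmult _ _ _ _ _ B A')).
  match type of P with is_derive _ _ ?l => match goal with |- is_derive _ _ ?m =>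
    replace m with l; [exact P|] end end. unfold minus, plus, opp; simpl. unfold Re, Im. ring.
Qed.

Lemma cder_RtoC (f : R -> R) (x l : R) : is_derive f x l -> cder (fun t => RtoC (f t)) x (RtoC l).
Proof. intros H. split; simpl; [exact H|]. apply (is_derive_const (K := R_AbsRing) (V := R_NormedModule)). Qed.

Lemma cder_Cexp (u : R -> C) (x : R) (l : C) :
  cder u x l -> cder (fun t => Cexp (u t)) x (l * Cexp (u x)).
Proof.
intros [A B].
assert (E1 := is_derive_comp (K := R_AbsRing) (V := R_NormedModule) exp _ x _ _ (is_derive_exp _) A).
assert (E2 := is_derive_comp (K := R_AbsRing) (V := R_NormedModule) cos _ x _ _ (is_derive_cos _) B).
assert (E3 := is_derive_comp (K := R_AbsRing) (V := R_NormedModule) sin _ x _ _ (is_derive_sin _) B).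
split; simpl.
- assert (P := is_derive_Rmult _ _ _ _ _ E1 E2).
  match type of P with is_derive _ _ ?l => match goal with |- is_derive _ _ ?m =>
    replace m with l; [exact P|] end end.
  unfold scal; simpl; unfold mult; simpl. unfold Re, Im. ring.
- assert (P := is_derive_Rmult _ _ _ _ _ E1 E3).
  match type of P with is_derive _ _ ?l => match goal with |- is_derive _ _ ?m =>
    replace m with l; [exact P|] end end.
  unfold scal; simpl; unfold mult; simpl. unfold Re, Im. ring.
Qed.

Lemma cder_cpow (s : C) (t : R) : (0 < t)%R -> cder (fun t => cpow t s) t (s * cpow t (s - 1)).
Proof.
intros Ht. unfold cpow.
apply cder_eq with (s * RtoC (/ t) * Cexp (s * RtoC (ln t))).
- apply cder_Cexp. eapply cder_eq.
  + apply cder_mult; [apply cder_const|]. apply cder_RtoC. now apply is_derive_ln.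
  + cbv beta. ring.
- replace ((s - 1) * RtoC (ln t)) with (s * RtoC (ln t) + RtoC (- ln t))
    by (rewrite RtoC_opp; ring).
  rewrite Cexp_plus, Cexp_RtoC, exp_Ropp, exp_ln by easy. ring.
Qed.

Lemma continuous_cpow (s : C) (t : R) : (0 < t)%R ->
  continuous (U := C_UniformSpace) (fun t => cpow t s) t.
Proof. intros H. eapply cder_continuous. now apply cder_cpow. Qed.

Lemma norm_C_R (z : C) : norm (V := C_R_NormedModule) z = Cmod z.
Proof.
destruct z as [x y]. unfold Cmod, norm; simpl. unfold prod_norm; simpl. unfold norm; simpl. unfold abs; simpl.
rewrite !Rmult_1_r. now rewrite <- !Rabs_mult, !Rabs_pos_eq by nra.
Qed.

Lemma is_RInt_cder (f df : R -> C) (a b : R) :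
  (forall x, (Rmin a b <= x <= Rmax a b)%R -> cder f x (df x)) ->
  (forall x, (Rmin a b <= x <= Rmax a b)%R -> continuous (U := C_UniformSpace) df x) ->
  is_RInt (V := C_R_NormedModule) df a b (f b - f a).
Proof.
intros H Hc.
apply (is_RInt_fct_extend_pair (U := R_NormedModule) (V := R_NormedModule) df a b
  (Re (f b) - Re (f a))%R (Im (f b) - Im (f a))%R).
- apply (is_RInt_derive (V := R_CompleteNormedModule) (fun x => Re (f x)) (fun x => Re (df x))).
  + intros x Hx. exact (proj1 (H x Hx)).
  + intros x Hx. now apply continuous_Re, Hc.
- apply (is_RInt_derive (V := R_CompleteNormedModule) (fun x => Im (f x)) (fun x => Im (df x))).
  + intros x Hx. exact (proj2 (H x Hx)).
  + intros x Hx. now apply continuous_Im, Hc.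
Qed.

(** The Taylor polynomial of degree [N - 1]. Starting with the zero polynomial at [N = 0] lets the
    induction for the remainder begin with [|exp z| <= exp |z|]. *)
Fixpoint cexp_trunc (N : nat) (z : C) : C :=
  match N with
  | O => 0
  | S n => cexp_trunc n z + RtoC (/ INR (fact n)) * z ^ n
  end.

Lemma cder_cexp_trunc (N : nat) (z : C) (x : R) :
  cder (fun x => cexp_trunc (S N) (RtoC x * z)) x (z * cexp_trunc N (RtoC x * z)).
Proof.
induction N as [|N IH].
- simpl. eapply cder_eq; [|symmetry; apply Cmult_0_r].
  apply (cder_const (0 + RtoC (/ 1) * 1)).
- change (cder (fun x => cexp_trunc (S N) (RtoC x * z)
      + RtoC (/ INR (fact (S N))) * (RtoC x * z) ^ (S N)) x
    (z * (cexp_trunc N (RtoC x * z) + RtoC (/ INR (fact N)) * (RtoC x * z) ^ N))).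
  eapply cder_eq.
  + apply cder_plus; [exact IH|].
    apply (cder_ext (fun x => RtoC (/ INR (fact (S N)) * x ^ S N) * z ^ S N)).
    * intros y. rewrite Cpow_mult_l, <- RtoC_pow, RtoC_mult. ring.
    * apply cder_mult; [|apply cder_const].
      apply cder_RtoC with (l := (/ INR (fact N) * x ^ N)%R).
      auto_derive; [easy|].
      change (/ INR (S N * fact N) * (1 * (INR (S N) * x ^ N)) = / INR (fact N) * x ^ N)%R.
      rewrite mult_INR. field. split; [apply INR_fact_neq_0|]. now apply not_0_INR.
  + rewrite Cmult_0_r, Cplus_0_r, Cpow_mult_l, <- RtoC_pow, RtoC_mult. simpl (z ^ S N). ring.
Qed.

Lemma cexp_trunc_0 (N : nat) : cexp_trunc (S N) 0 = 1.
Proof.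
induction N as [|N IH].
- simpl. rewrite Rinv_1. ring.
- change (cexp_trunc (S N) 0 + RtoC (/ INR (fact (S N))) * (0 * 0 ^ N) = 1). rewrite IH. ring.
Qed.

(** Along the segment [x z] the remainder of order [N + 1] has derivative [z] times the remainder of
    order [N] and vanishes at [x = 0], so the bound follows by integrating the previous one over
    [[0, 1]]. *)
Lemma Cexp_remainder (N : nat) (z : C) :
  (Cmod (Cexp z - cexp_trunc N z) <= Cmod z ^ N * exp (Cmod z))%R.
Proof.
revert z. induction N as [|N IH]; intros z.
- simpl. replace (Cexp z - 0) with (Cexp z) by ring. rewrite Cmod_Cexp, Rmult_1_l.
  assert (H := Rle_trans _ _ _ (Rle_abs _) (re_le_Cmod z)).
  destruct H as [H|H]; [left; now apply exp_increasing|rewrite H; lra].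
- set (phi := fun x : R => Cexp (RtoC x * z) + - RtoC 1 * cexp_trunc (S N) (RtoC x * z)).
  set (dphi := fun x : R => z * (Cexp (RtoC x * z) - cexp_trunc N (RtoC x * z))).
  assert (D0 : forall x, cder (fun x => Cexp (RtoC x * z)) x (z * Cexp (RtoC x * z))).
  { intros x. apply cder_Cexp. eapply cder_eq.
    - apply cder_mult; [|apply cder_const].
      apply cder_RtoC with (l := 1%R). apply (is_derive_id (K := R_AbsRing)).
    - cbv beta. ring. }
  assert (D : forall x, cder phi x (dphi x)).
  { intros x. unfold phi, dphi. eapply cder_eq.
    - apply cder_plus; [apply D0|]. apply cder_mult; [apply cder_const|apply cder_cexp_trunc].
    - cbv beta. ring. }
  assert (Cd : forall x, continuous (U := C_UniformSpace) dphi x).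
  { intros x. unfold dphi. apply continuous_Cmult; [apply continuous_const|].
    apply continuous_Cplus; [eapply cder_continuous, D0|].
    destruct N as [|N]; [apply continuous_const|].
    apply continuous_ext with (f := fun x : R => - RtoC 1 * cexp_trunc (S N) (RtoC x * z));
      [intros y; simpl; ring|].
    apply continuous_Cmult; [apply continuous_const|]. eapply cder_continuous, cder_cexp_trunc. }
  assert (I := is_RInt_cder phi dphi 0 1 (fun x _ => D x) (fun x _ => Cd x)).
  assert (E : phi 1 - phi 0 = Cexp z - cexp_trunc (S N) z).
  { unfold phi. rewrite !Cmult_1_l, !Cmult_0_l, Cexp_0, cexp_trunc_0. ring. }
  rewrite E in I.
  assert (K := is_RInt_const (V := R_NormedModule) 0 1 (Cmod z ^ S N * exp (Cmod z))%R).
  assert (B := fun H => norm_RInt_le (V := C_R_NormedModule) dphi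
    (fun _ => Cmod z ^ S N * exp (Cmod z))%R 0 1 _ _ Rle_0_1 H I K).
  rewrite norm_C_R in B.
  eapply Rle_trans; [apply B|right; unfold scal; simpl; unfold mult; simpl; ring].
  intros x Hx. rewrite norm_C_R. unfold dphi. rewrite Cmod_mult.
  simpl. rewrite Rmult_assoc. apply Rmult_le_compat_l; [apply Cmod_ge_0|].
  eapply Rle_trans; [apply IH|].
  assert (L : (Cmod (RtoC x * z) <= Cmod z)%R).
  { rewrite Cmod_mult, Cmod_R, Rabs_pos_eq by lra. pose proof (Cmod_ge_0 z). nra. }
  apply Rmult_le_compat.
  + apply pow_le, Cmod_ge_0.
  + left; apply exp_pos.
  + apply pow_incr. split; [apply Cmod_ge_0|exact L].
  + destruct L as [L|L]; [left; now apply exp_increasing|rewrite L; lra].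
Qed.

(** * Improper integrals of complex functions *)

(* Two filters describing the (possibly improper) ends of an interval of positive reals. *)
Record idom (Fa Fb : (R -> Prop) -> Prop) (Dm : R -> Prop) : Prop := {
  idom_pa : ProperFilter Fa;
  idom_pb : ProperFilter Fb;
  idom_a : Fa Dm;
  idom_b : Fb Dm;
  idom_convex : forall x y z, Dm x -> Dm z -> (x <= y <= z)%R -> Dm y;
  idom_le : filter_prod Fa Fb (fun ab => (fst ab <= snd ab)%R);
  idom_pos : forall t, Dm t -> (0 < t)%R }.

Lemma idom_0_infty : idom (at_right 0) (Rbar_locally p_infty) (fun t => (0 < t)%R).
Proof.
constructor.
- apply at_right_proper_filter.
- apply Rbar_locally_filter.
- exists (mkposreal 1 Rlt_0_1). intros y _ Hy. exact Hy.
- now exists 0%R.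
- intros x y z. lra.
- apply Filter_prod with (fun t => (t < 1)%R) (fun t => (1 < t)%R).
  + exists (mkposreal 1 Rlt_0_1). intros y Hy _. apply Rabs_def2 in Hy. simpl in Hy.
    unfold minus, plus, opp in Hy; simpl in Hy. lra.
  + now exists 1%R.
  + simpl; intros x y; lra.
- easy.
Qed.

Lemma idom_0_point (a : R) : (0 < a)%R -> idom (at_right 0) (at_point a) (fun t => (0 < t <= a)%R).
Proof.
intros Ha. assert (Hl : at_right 0 (fun t => (0 < t <= a)%R)).
{ exists (mkposreal a Ha). intros y Hy Hy0. apply Rabs_def2 in Hy. simpl in Hy.
  unfold minus, plus, opp in Hy; simpl in Hy. lra. }
constructor; try easy.
- apply at_right_proper_filter.
- apply at_point_filter.
- intros x y z. lra.
- apply Filter_prod with (fun t => (0 < t <= a)%R) (fun t => t = a); [exact Hl|now unfold at_point|].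
  simpl; intros x y; lra.
Qed.

Lemma idom_point_infty (a : R) : (0 < a)%R ->
  idom (at_point a) (Rbar_locally p_infty) (fun t => (a <= t)%R).
Proof.
intros Ha. constructor.
- apply at_point_filter.
- apply Rbar_locally_filter.
- unfold at_point; simpl; lra.
- exists a. intros; lra.
- intros x y z. lra.
- apply Filter_prod with (fun t => t = a) (fun t => (a < t)%R).
  + now unfold at_point.
  + now exists a.
  + simpl; intros x y; lra.
- intros; lra.
Qed.

Lemma idom_points (a b : R) : (0 < a)%R -> (a <= b)%R ->
  idom (at_point a) (at_point b) (fun t => (a <= t <= b)%R).
Proof.
intros Ha Hb. constructor; try apply at_point_filter; unfold at_point; simpl; try lra.
- intros x y z. lra.
- apply Filter_prod with (fun t => t = a) (fun t => t = b); unfold at_point; try easy.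
  simpl; intros x y; lra.
- intros; lra.
Qed.

Notation is_CInt f Fa Fb l := (is_RInt_gen (V := C_R_NormedModule) f Fa Fb l).
Notation ex_RInt_R f Fa Fb := (ex_RInt_gen (V := R_NormedModule) f Fa Fb).

(** Integrals with different ends differ by two end pieces [y] and [z]; this is the shape of the
    Cauchy criterion below. *)
Lemma norm_minus_plus3 {V : NormedModule R_AbsRing} (x y z : V) :
  (norm (minus x (plus y (plus x z))) <= norm y + norm z)%R.
Proof.
rewrite <- norm_opp.
replace (opp (minus x (plus y (plus x z)))) with (plus y z); [apply norm_triangle|].
rewrite opp_minus, (plus_comm x z), plus_assoc.
unfold minus. rewrite <- plus_assoc.
transitivity (plus (plus y z) zero); [symmetry; apply plus_zero_r|].
apply f_equal. symmetry. apply (plus_opp_r x).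
Qed.

(** [C_R_NormedModule] is a module over the reals, so a complex constant is not one of its scalars;
    the product is formed from real and imaginary parts. *)
Lemma is_CInt_Cmult_raw {Fa Fb : (R -> Prop) -> Prop} {FFa : Filter Fa} {FFb : Filter Fb}
  (f : R -> C) (c l : C) :
  is_CInt f Fa Fb l -> is_CInt (fun t => c * f t) Fa Fb (c * l).
Proof.
intros H P HP.
assert (Cc : continuous (T := C_UniformSpace) (U := C_UniformSpace) (fun y => c * y) l)
  by (apply continuous_Cmult; [apply continuous_const|apply continuous_id]).
assert (HP' : locally (T := C_UniformSpace) l (fun y => P (c * y))) by exact (Cc P HP).
specialize (H _ HP'). revert H. unfold filtermapi. apply filter_imp.
intros [a b] [y [Hy Py]]. exists (c * y). split; [|exact Py]. simpl in *.
assert (A := is_RInt_fct_extend_fst (U := R_NormedModule) (V := R_NormedModule) f a b y Hy).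
assert (B := is_RInt_fct_extend_snd (U := R_NormedModule) (V := R_NormedModule) f a b y Hy).
apply (is_RInt_fct_extend_pair (U := R_NormedModule) (V := R_NormedModule)
  (fun t => c * f t) a b (Re c * Re y - Im c * Im y)%R (Re c * Im y + Im c * Re y)%R).
- exact (is_RInt_minus (V := R_NormedModule) _ _ a b _ _
    (is_RInt_scal (V := R_NormedModule) _ a b (Re c) _ A)
    (is_RInt_scal (V := R_NormedModule) _ a b (Im c) _ B)).
- exact (is_RInt_plus (V := R_NormedModule) _ _ a b _ _
    (is_RInt_scal (V := R_NormedModule) _ a b (Re c) _ B)
    (is_RInt_scal (V := R_NormedModule) _ a b (Im c) _ A)).
Qed.

Section Improper.
Context {Fa Fb : (R -> Prop) -> Prop} {Dm : R -> Prop} (HD : idom Fa Fb Dm).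

Let FFa : ProperFilter Fa := idom_pa _ _ _ HD.
Let FFb : ProperFilter Fb := idom_pb _ _ _ HD.
Local Existing Instance FFa.
Local Existing Instance FFb.

Lemma idom_hull (x y z : R) : Dm x -> Dm z -> (Rmin x z <= y <= Rmax x z)%R -> Dm y.
Proof.
intros Hx Hz H. destruct (Rle_dec x z).
- rewrite Rmin_left, Rmax_right in H by easy. now apply (idom_convex _ _ _ HD x y z).
- rewrite Rmin_right, Rmax_left in H by lra. now apply (idom_convex _ _ _ HD z y x).
Qed.

Lemma idom_prod (P : R * R -> Prop) :
  (forall a b, Dm a -> Dm b -> P (a, b)) -> filter_prod Fa Fb P.
Proof.
intros H. apply Filter_prod with Dm Dm; [exact (idom_a _ _ _ HD)|exact (idom_b _ _ _ HD)|exact H].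
Qed.

Lemma is_CInt_unique (f : R -> C) (l : C) : is_CInt f Fa Fb l -> CInt_gen f Fa Fb = l.
Proof. intros H. exact (is_RInt_gen_unique (V := C_R_CompleteNormedModule) f l H). Qed.

Lemma is_RInt_gen_ext_dom {V : NormedModule R_AbsRing} (f g : R -> V) (l : V) :
  (forall t, Dm t -> f t = g t) -> is_RInt_gen f Fa Fb l -> is_RInt_gen g Fa Fb l.
Proof.
intros E. apply is_RInt_gen_ext. apply idom_prod. simpl. intros a b Ha Hb x Hx.
apply E, (idom_hull a x b); auto; lra.
Qed.

Lemma is_CInt_ext (f g : R -> C) (l : C) :
  (forall t, Dm t -> f t = g t) -> is_CInt f Fa Fb l -> is_CInt g Fa Fb l.
Proof. exact (is_RInt_gen_ext_dom (V := C_R_NormedModule) f g l). Qed.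

Lemma is_CInt_norm (f : R -> C) (g : R -> R) (l : C) (lg : R) :
  (forall t, Dm t -> (Cmod (f t) <= g t)%R) ->
  is_CInt f Fa Fb l -> is_RInt_gen (V := R_NormedModule) g Fa Fb lg -> (Cmod l <= lg)%R.
Proof.
intros H Hf Hg. rewrite <- norm_C_R.
apply (RInt_gen_norm (V := C_R_CompleteNormedModule) (Fa := Fa) (Fb := Fb) f g l lg); try easy.
- apply (idom_le _ _ _ HD).
- apply idom_prod. simpl. intros a b Ha Hb x Hx. rewrite norm_C_R.
  apply H, (idom_convex _ _ _ HD a x b); auto.
Qed.

(** The bound [|g - f| <= g - f] integrates to [|lg - lf| <= lg - lf], so the right-hand side is
    nonnegative. *)
Lemma is_RInt_gen_le_dom (f g : R -> R) (lf lg : R) :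
  (forall t, Dm t -> (f t <= g t)%R) ->
  is_RInt_gen (V := R_NormedModule) f Fa Fb lf ->
  is_RInt_gen (V := R_NormedModule) g Fa Fb lg -> (lf <= lg)%R.
Proof.
intros H Hf Hg.
assert (Hd := is_RInt_gen_minus (V := R_NormedModule) g f lg lf Hg Hf).
assert (P : (norm (minus lg lf) <= minus lg lf)%R).
{ refine (RInt_gen_norm (V := R_CompleteNormedModule) (Fa := Fa) (Fb := Fb) _ _ _ _
    (idom_le _ _ _ HD) _ Hd Hd).
  apply idom_prod. simpl. intros a b Ha Hb x Hx.
  assert (Dm x) by (apply (idom_convex _ _ _ HD a x b); auto).
  specialize (H x H0). unfold norm, minus, plus, opp; simpl. unfold abs; simpl.
  rewrite Rabs_pos_eq; lra. }
assert (Q := norm_ge_0 (V := R_NormedModule) (minus lg lf)).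
assert (0 <= minus lg lf)%R by (eapply Rle_trans; [exact Q|exact P]).
unfold minus, plus, opp in H0; simpl in H0. lra.
Qed.

Lemma filterlimi_RInt {V : CompleteNormedModule R_AbsRing} (f : R -> V) (y : V) :
  (forall a b, Dm a -> Dm b -> ex_RInt f a b) ->
  filterlim (fun ab => RInt f (fst ab) (snd ab)) (filter_prod Fa Fb) (locally y) ->
  is_RInt_gen f Fa Fb y.
Proof.
intros Hex Hl P HP. specialize (Hl P HP). unfold filtermapi. unfold filtermap in Hl.
generalize (filter_and _ _ Hl (idom_prod (fun ab => ex_RInt f (fst ab) (snd ab)) Hex)).
apply filter_imp. intros [a b] [A B]. exists (RInt f a b). split; [|exact A].
now apply RInt_correct.
Qed.

Lemma ex_RInt_dom {V : CompleteNormedModule R_AbsRing} (f : R -> V) (a b : R) :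
  (forall t, Dm t -> continuous f t) -> Dm a -> Dm b -> ex_RInt f a b.
Proof.
intros H Ha Hb. apply ex_RInt_continuous. intros z Hz. apply H, (idom_hull a z b); auto.
Qed.

(** The absolute value on the right allows both orders of [a] and [b], which the end pieces in the
    Cauchy criterion require. *)
Lemma norm_RInt_dom {V : CompleteNormedModule R_AbsRing} (f : R -> V) (g : R -> R) (a b : R) :
  (forall t, Dm t -> continuous f t) -> (forall t, Dm t -> continuous g t) ->
  (forall t, Dm t -> (norm (f t) <= g t)%R) -> Dm a -> Dm b ->
  (norm (RInt f a b) <= Rabs (RInt g a b))%R.
Proof.
intros Hf Hg H Ha Hb.
assert (K : forall a b, Dm a -> Dm b -> (a <= b)%R -> (norm (RInt f a b) <= RInt g a b)%R).
{ clear a b Ha Hb. intros a b Ha Hb Hab. apply (norm_RInt_le f g a b); try easy.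
  - intros x Hx. apply H, (idom_convex _ _ _ HD a x b); auto.
  - apply RInt_correct. now apply ex_RInt_dom.
  - apply (RInt_correct (V := R_CompleteNormedModule)).
    now apply (ex_RInt_dom (V := R_CompleteNormedModule)). }
destruct (Rle_dec a b) as [L|L].
- eapply Rle_trans; [now apply K|apply Rle_abs].
- rewrite <- (opp_RInt_swap f b a) by now apply ex_RInt_dom.
  rewrite <- (opp_RInt_swap (V := R_CompleteNormedModule) g b a)
    by now apply (ex_RInt_dom (V := R_CompleteNormedModule)).
  eapply Rle_trans; [right; exact (norm_opp (V := V) (RInt f b a))|]. change (opp (RInt g b a)) with (- RInt g b a)%R. rewrite Rabs_Ropp.
  eapply Rle_trans; [apply K; auto; lra|apply Rle_abs].
Qed.

(** The comparison test: the end pieces of [f] are bounded by those of [g], which are small because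
    the integral of [g] converges. *)
Lemma ex_RInt_gen_dominated {V : CompleteNormedModule R_AbsRing} (f : R -> V) (g : R -> R) :
  (forall t, Dm t -> continuous f t) -> (forall t, Dm t -> continuous g t) ->
  (forall t, Dm t -> (norm (f t) <= g t)%R) ->
  ex_RInt_R g Fa Fb -> ex_RInt_gen f Fa Fb.
Proof.
intros Hf Hg H [lg Hlg].
assert (exists y : V, filterlim (fun ab => RInt f (fst ab) (snd ab)) (filter_prod Fa Fb) (locally y))
  as [y Hy]; [|exists y; apply filterlimi_RInt; [intros; now apply ex_RInt_dom|easy]].
apply (proj1 (filterlim_locally_cauchy (U := CompleteNormedModule.CompleteSpace _ V)
  (F := filter_prod Fa Fb) (fun ab => RInt f (fst ab) (snd ab)))). intros eps.
(* Integrals of [g] within [eps / 8] of the limit make each of the two end pieces at most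
   [eps / 4]. *)
assert (He4 : (0 < eps / 8)%R) by (pose proof (cond_pos eps); lra).
assert (HB : locally (T := R_UniformSpace) lg (ball lg (mkposreal _ He4))) by apply locally_ball.
apply Hlg in HB. unfold filtermapi in HB. destruct HB as [Q S HQ HS HQS]. simpl in HQS.
exists (fun ab => Q (fst ab) /\ Dm (fst ab) /\ S (snd ab) /\ Dm (snd ab)). split.
{ apply Filter_prod with (fun a => Q a /\ Dm a) (fun b => S b /\ Dm b).
  - apply filter_and; [easy|apply (idom_a _ _ _ HD)].
  - apply filter_and; [easy|apply (idom_b _ _ _ HD)].
  - simpl. tauto. }
intros [a b] [a' b'] (Qa & Da & Sb & Db) (Qa' & Da' & Sb' & Db'). simpl in *.
assert (G : forall a b, Q a -> S b -> (Rabs (RInt g a b - lg) < eps / 8)%R).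
{ intros u v Hu Hv. destruct (HQS u v Hu Hv) as [y [Iy By]].
  rewrite (is_RInt_unique (V := R_CompleteNormedModule) g u v y Iy). exact By. }
assert (CG : forall a b c, Dm a -> Dm b -> Dm c -> (RInt g a b + RInt g b c = RInt g a c)%R).
{ intros u v w Du Dv Dw. apply (RInt_Chasles (V := R_CompleteNormedModule) g);
    now apply (ex_RInt_dom (V := R_CompleteNormedModule)). }
assert (CF : forall a b c, Dm a -> Dm b -> Dm c -> plus (RInt f a b) (RInt f b c) = RInt f a c).
{ intros u v w Du Dv Dw. apply RInt_Chasles; now apply ex_RInt_dom. }
apply (norm_compat1 (V := V)).
rewrite <- (CF a a' b Da Da' Db), <- (CF a' b' b Da' Db' Db).
assert (N1 := norm_RInt_dom f g a a' Hf Hg H Da Da').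
assert (N2 := norm_RInt_dom f g b' b Hf Hg H Db' Db).
assert (E1 := CG a a' b Da Da' Db). assert (E2 := CG a' b' b Da' Db' Db).
assert (G1 := G a b Qa Sb). assert (G2 := G a' b Qa' Sb). assert (G3 := G a' b' Qa' Sb').
apply Rabs_def2 in G1, G2, G3. destruct G1, G2, G3.
assert (B1 : (Rabs (RInt g a a') <= eps / 4)%R) by (apply Rabs_le; lra).
assert (B2 : (Rabs (RInt g b' b) <= eps / 4)%R) by (apply Rabs_le; lra).
eapply Rle_lt_trans; [apply (norm_minus_plus3 (V := V))|].
eapply Rle_lt_trans; [apply Rplus_le_compat; [exact N1|exact N2]|].
pose proof (cond_pos eps). lra.
Qed.

Lemma ex_CInt_dominated (f : R -> C) (g : R -> R) :
  (forall t, Dm t -> continuous (U := C_UniformSpace) f t) -> (forall t, Dm t -> continuous g t) ->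
  (forall t, Dm t -> (Cmod (f t) <= g t)%R) ->
  ex_RInt_R g Fa Fb -> is_CInt f Fa Fb (CInt_gen f Fa Fb).
Proof.
intros Hf Hg H Ig.
apply (RInt_gen_correct (V := C_R_CompleteNormedModule)).
apply (ex_RInt_gen_dominated (V := C_R_CompleteNormedModule) f g); try easy.
intros t Ht. rewrite norm_C_R. now apply H.
Qed.

Lemma is_CInt_Cmult (f : R -> C) (c l : C) :
  is_CInt f Fa Fb l -> is_CInt (fun t => c * f t) Fa Fb (c * l).
Proof. apply is_CInt_Cmult_raw. Qed.

Lemma is_CInt_plus (f g : R -> C) (l m : C) :
  is_CInt f Fa Fb l -> is_CInt g Fa Fb m -> is_CInt (fun t => f t + g t) Fa Fb (l + m).
Proof. exact (is_RInt_gen_plus (V := C_R_NormedModule) f g l m). Qed.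

Lemma is_CInt_Re (f : R -> C) (l : C) :
  is_CInt f Fa Fb l -> is_RInt_gen (V := R_NormedModule) (fun t => Re (f t)) Fa Fb (Re l).
Proof.
intros H P HP.
assert (HP' : locally (T := C_UniformSpace) l (fun y => P (Re y))).
{ destruct HP as [e He]. exists e. intros y [Hy _]. now apply He. }
specialize (H _ HP'). revert H. unfold filtermapi. apply filter_imp.
intros [a b] [y [Hy Py]]. exists (Re y). split; [|exact Py].
exact (is_RInt_fct_extend_fst (U := R_NormedModule) (V := R_NormedModule) f a b y Hy).
Qed.

Lemma is_CInt_cder (f df : R -> C) (la lb : C) :
  (forall t, Dm t -> cder f t (df t)) ->
  (forall t, Dm t -> continuous (U := C_UniformSpace) df t) ->
  filterlim f Fa (locally (T := C_UniformSpace) la) ->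
  filterlim f Fb (locally (T := C_UniformSpace) lb) ->
  is_CInt df Fa Fb (lb - la).
Proof.
intros H Hc La Lb P HP.
assert (Cc : filterlim (fun ab => f (snd ab) - f (fst ab)) (filter_prod Fa Fb)
   (locally (T := C_UniformSpace) (lb - la))).
{ apply (filterlim_comp_2 (G := locally (T := C_UniformSpace) lb) (H := locally (T := C_UniformSpace) (opp la))
     (fun ab => f (snd ab)) (fun ab => opp (f (fst ab))) plus).
  - apply filterlim_comp with Fb; [apply filterlim_snd|exact Lb].
  - apply filterlim_comp with (locally (T := C_UniformSpace) la).
    + apply filterlim_comp with Fa; [apply filterlim_fst|exact La].
    + apply (filterlim_opp (V := C_R_NormedModule)).
  - apply (filterlim_plus (V := C_R_NormedModule)). }
specialize (Cc P HP). unfold filtermap in Cc. unfold filtermapi.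
generalize (filter_and _ _ Cc (idom_prod (fun ab => Dm (fst ab) /\ Dm (snd ab)) (fun a b A B => conj A B))).
apply filter_imp. intros [a b] [Pab [Da Db]]. simpl in *.
exists (f b - f a). split; [|exact Pab]. apply is_RInt_cder.
- intros x Hx. apply H, (idom_hull a x b); auto.
- intros x Hx. apply Hc, (idom_hull a x b); auto.
Qed.

End Improper.

(** * Mellin transforms *)

Lemma cpow_RtoC (t p : R) : cpow t (RtoC p) = RtoC (Rpower t p).
Proof. unfold cpow. rewrite <- RtoC_mult, Cexp_RtoC. reflexivity. Qed.

Lemma Cmod_cpow (t : R) (s : C) : Cmod (cpow t s) = Rpower t (Re s).
Proof. unfold cpow. rewrite Cmod_Cexp. unfold Rpower. f_equal. simpl. unfold Re. ring. Qed.

Lemma cpow_plus (t : R) (s w : C) : cpow t (s + w) = cpow t s * cpow t w.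
Proof. unfold cpow. rewrite <- Cexp_plus. f_equal. ring. Qed.

Lemma cpow_0 (t : R) : cpow t 0 = 1.
Proof. unfold cpow. rewrite Cmult_0_l. apply Cexp_0. Qed.

Lemma cpow_opp (t : R) (s : C) : cpow t (- s) = / cpow t s.
Proof. unfold cpow. rewrite <- Cexp_opp. f_equal. ring. Qed.

Lemma cpow_neq_0 (t : R) (s : C) : cpow t s <> 0.
Proof. apply Cexp_neq_0. Qed.

Lemma cpow_1 (t : R) : (0 < t)%R -> cpow t 1 = RtoC t.
Proof. intros H. rewrite cpow_RtoC, Rpower_1; easy. Qed.

Lemma cpow_mult (x y : R) (s : C) : (0 < x)%R -> (0 < y)%R -> cpow (x * y) s = cpow x s * cpow y s.
Proof.
intros Hx Hy. unfold cpow. rewrite ln_mult by easy. rewrite <- Cexp_plus, RtoC_plus. f_equal. ring.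
Qed.

Lemma filterlim_C_eps {T : Type} (F : (T -> Prop) -> Prop) {FF : Filter F} (f : T -> C) (l : C) :
  (forall eps, (0 < eps)%R -> F (fun t => (Cmod (f t - l) < eps)%R)) ->
  filterlim f F (locally (T := C_UniformSpace) l).
Proof.
intros H P HP. apply locally_Cmod in HP. destruct HP as [eps [He HP]].
unfold filtermap. generalize (H eps He). apply filter_imp. intros t; apply HP.
Qed.

Lemma Rpower_lt_compat_base (x y p : R) : (0 < x < y)%R -> (0 < p)%R -> (Rpower x p < Rpower y p)%R.
Proof.
intros H Hp. unfold Rpower. apply exp_increasing. apply Rmult_lt_compat_l; [easy|].
apply ln_increasing; lra.
Qed.

Lemma filterlim_cpow_0 (s : C) : (0 < Re s)%R ->
  filterlim (fun t => cpow t s) (at_right 0) (locally (T := C_UniformSpace) (RtoC 0)).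
Proof.
intros Hs. apply filterlim_C_eps; [apply at_right_proper_filter|].
intros eps He.
assert (Hd : (0 < Rpower eps (/ Re s))%R) by apply exp_pos.
exists (mkposreal _ Hd). intros t Ht Ht0. apply Rabs_def2 in Ht.
unfold minus, plus, opp in Ht; simpl in Ht.
replace (cpow t s - 0) with (cpow t s) by ring. rewrite Cmod_cpow.
apply Rlt_le_trans with (Rpower (Rpower eps (/ Re s)) (Re s)).
- apply Rpower_lt_compat_base; lra.
- rewrite Rpower_mult, Rinv_l, Rpower_1 by lra. lra.
Qed.

Lemma filterlim_cpow_infty (s : C) : (Re s < 0)%R ->
  filterlim (fun t => cpow t s) (Rbar_locally p_infty) (locally (T := C_UniformSpace) (RtoC 0)).
Proof.
intros Hs. apply filterlim_C_eps; [apply (Rbar_locally_filter p_infty)|].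
intros eps He. exists (Rpower eps (/ Re s)). intros t Ht.
replace (cpow t s - 0) with (cpow t s) by ring. rewrite Cmod_cpow.
assert (H0 : (0 < Rpower eps (/ Re s))%R) by apply exp_pos.
assert (L := Rpower_lt_compat_base _ _ (- Re s) (conj H0 Ht) ltac:(lra)).
rewrite Rpower_mult in L. replace (/ Re s * - Re s)%R with (Ropp 1) in L by (field; lra).
rewrite !Rpower_Ropp, Rpower_1 in L by easy.
apply Rinv_lt_contravar in L.
- now rewrite !Rinv_inv in L.
- apply Rmult_lt_0_compat; apply Rinv_0_lt_compat; [easy|apply exp_pos].
Qed.

Lemma cder_cpow_primitive (s : C) (t : R) : s <> 0 -> (0 < t)%R ->
  cder (fun t => / s * cpow t s) t (cpow t (s - 1)).
Proof.
intros Hs Ht. eapply cder_eq.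
- apply cder_mult; [apply cder_const|]. now apply cder_cpow.
- cbv beta. now field.
Qed.

Lemma filterlim_Cmult_const {T : Type} (F : (T -> Prop) -> Prop) {FF : Filter F} (f : T -> C) (c l : C) :
  filterlim f F (locally (T := C_UniformSpace) l) ->
  filterlim (fun t => c * f t) F (locally (T := C_UniformSpace) (c * l)).
Proof.
intros H. apply filterlim_comp with (1 := H).
apply (continuous_Cmult (fun _ => c) (fun y => y) l); [apply continuous_const|apply continuous_id].
Qed.

Lemma filterlim_at_point (f : R -> C) (a : R) :
  filterlim f (at_point a) (locally (T := C_UniformSpace) (f a)).
Proof. intros P HP. unfold filtermap, at_point. exact (locally_singleton _ _ HP). Qed.

Lemma Re_neq_0 (s : C) : Re s <> 0%R -> s <> 0.
Proof. intros H ->. now apply H. Qed.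

Lemma is_CInt_cpow_0 (s : C) (a : R) : (0 < Re s)%R -> (0 < a)%R ->
  is_CInt (fun t => cpow t (s - 1)) (at_right 0) (at_point a) (/ s * cpow a s).
Proof.
intros Hs Ha. assert (Hs0 : s <> 0) by (apply Re_neq_0; lra).
assert (HD := idom_0_point a Ha).
replace (/ s * cpow a s) with (/ s * cpow a s - / s * 0) by ring.
apply (is_CInt_cder HD (fun t => / s * cpow t s)).
- intros t Ht. apply cder_cpow_primitive; [easy|lra].
- intros t Ht. apply continuous_cpow; lra.
- apply filterlim_Cmult_const; [apply at_right_proper_filter|]. now apply filterlim_cpow_0.
- apply (filterlim_at_point (fun t => / s * cpow t s)).
Qed.

Lemma is_CInt_cpow_infty (s : C) (a : R) : (Re s < 0)%R -> (0 < a)%R ->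
  is_CInt (fun t => cpow t (s - 1)) (at_point a) (Rbar_locally p_infty) (- (/ s * cpow a s)).
Proof.
intros Hs Ha. assert (Hs0 : s <> 0) by (apply Re_neq_0; lra).
assert (HD := idom_point_infty a Ha).
replace (- (/ s * cpow a s)) with (/ s * 0 - / s * cpow a s) by ring.
apply (is_CInt_cder HD (fun t => / s * cpow t s)).
- intros t Ht. apply cder_cpow_primitive; [easy|lra].
- intros t Ht. apply continuous_cpow; lra.
- apply (filterlim_at_point (fun t => / s * cpow t s)).
- apply filterlim_Cmult_const; [apply (Rbar_locally_filter p_infty)|]. now apply filterlim_cpow_infty.
Qed.

Lemma Re_cpow_RtoC_minus_1 (t p : R) : Re (cpow t (RtoC p - 1)) = Rpower t (p - 1).
Proof. rewrite <- RtoC_minus, cpow_RtoC. reflexivity. Qed.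

Lemma ex_RInt_Rpower_0 (p a : R) : (0 < p)%R -> (0 < a)%R ->
  ex_RInt_R (fun t => Rpower t (p - 1)) (at_right 0) (at_point a).
Proof.
intros Hp Ha. eexists. eapply (is_RInt_gen_ext_dom (idom_0_point a Ha)).
- intros t _. apply Re_cpow_RtoC_minus_1.
- apply (is_CInt_Re (idom_0_point a Ha)). now apply is_CInt_cpow_0.
Qed.

Lemma ex_RInt_Rpower_infty (p a : R) : (p < 0)%R -> (0 < a)%R ->
  ex_RInt_R (fun t => Rpower t (p - 1)) (at_point a) (Rbar_locally p_infty).
Proof.
intros Hp Ha. eexists. eapply (is_RInt_gen_ext_dom (idom_point_infty a Ha)).
- intros t _. apply Re_cpow_RtoC_minus_1.
- apply (is_CInt_Re (idom_point_infty a Ha)). now apply is_CInt_cpow_infty.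
Qed.

Definition mellin (g : R -> R) (Fa Fb : (R -> Prop) -> Prop) (s : C) : C :=
  CInt_gen (fun t => RtoC (g t) * cpow t (s - 1)) Fa Fb.

Arguments mellin : simpl never.
Arguments Gamma_int : simpl never.
Arguments inv_Gamma : simpl never.
Arguments cpow : simpl never.

(** Absolute convergence, which depends on [s] only through [p = Re s]. *)
Definition mellin_conv (g : R -> R) (Fa Fb : (R -> Prop) -> Prop) (p : R) : Prop :=
  ex_RInt_R (fun t => Rabs (g t) * Rpower t (p - 1))%R Fa Fb.

Lemma continuous_Rpower (p t : R) : (0 < t)%R -> continuous (fun t => Rpower t p) t.
Proof.
intros Ht. apply continuous_ext with (f := fun t => Re (cpow t (RtoC p))).
- intros x. now rewrite cpow_RtoC.
- apply continuous_Re. now apply continuous_cpow.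
Qed.

Lemma continuous_Rabs_comp (f : R -> R) (t : R) : continuous f t -> continuous (fun t => Rabs (f t)) t.
Proof. intros H. apply (continuous_comp f Rabs); [exact H|apply continuous_Rabs]. Qed.

Lemma exp_pow_INR (x : R) (n : nat) : (exp x ^ n = exp (INR n * x))%R.
Proof.
induction n as [|n IH].
- simpl. now rewrite Rmult_0_l, exp_0.
- simpl pow. rewrite IH, S_INR, <- exp_plus. f_equal. ring.
Qed.

Section Mellin.
Context {Fa Fb : (R -> Prop) -> Prop} {Dm : R -> Prop} (HD : idom Fa Fb Dm).
Variable g : R -> R.
Hypothesis Hg : forall t, Dm t -> continuous g t.

Let FFa : ProperFilter Fa := idom_pa _ _ _ HD.
Let FFb : ProperFilter Fb := idom_pb _ _ _ HD.
Local Existing Instance FFa.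
Local Existing Instance FFb.

Lemma continuous_mellin_kernel (s : C) (t : R) : Dm t ->
  continuous (U := C_UniformSpace) (fun t => RtoC (g t) * cpow t (s - 1)) t.
Proof.
intros Ht. apply continuous_Cmult.
- now apply continuous_RtoC, Hg.
- apply continuous_cpow. now apply (idom_pos _ _ _ HD).
Qed.

Lemma continuous_mellin_abs (p t : R) : Dm t ->
  continuous (fun t => Rabs (g t) * Rpower t (p - 1))%R t.
Proof.
intros Ht. apply continuous_Rmult.
- now apply continuous_Rabs_comp, Hg.
- apply continuous_Rpower. now apply (idom_pos _ _ _ HD).
Qed.

Lemma Cmod_mellin_kernel (s : C) (t : R) :
  Cmod (RtoC (g t) * cpow t (s - 1)) = (Rabs (g t) * Rpower t (Re s - 1))%R.
Proof. rewrite Cmod_mult, Cmod_R, Cmod_cpow. reflexivity. Qed.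

Lemma is_mellin (s : C) : mellin_conv g Fa Fb (Re s) ->
  is_CInt (fun t => RtoC (g t) * cpow t (s - 1)) Fa Fb (mellin g Fa Fb s).
Proof.
intros H. unfold mellin. apply (ex_CInt_dominated HD) with (4 := H).
- intros t Ht. now apply continuous_mellin_kernel.
- intros t Ht. now apply continuous_mellin_abs.
- intros t _. rewrite Cmod_mellin_kernel. lra.
Qed.

Lemma mellin_conv_le (p : R) (h : R -> R) :
  (forall t, Dm t -> continuous h t) ->
  (forall t, Dm t -> (Rabs (g t) * Rpower t (p - 1) <= h t)%R) ->
  ex_RInt_R h Fa Fb -> mellin_conv g Fa Fb p.
Proof.
intros Hh Hle He.
apply (ex_RInt_gen_dominated (V := R_CompleteNormedModule) HD) with (g := h); try easy.
- intros t Ht. now apply continuous_mellin_abs.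
- intros t Ht. unfold norm; simpl. unfold abs; simpl. rewrite Rabs_pos_eq; [now apply Hle|].
  apply Rmult_le_pos; [apply Rabs_pos|left; apply exp_pos].
Qed.

(** One factor [x] is at most [(4 / c) exp (c x / 4)], and up to four of them use at most
    [exp (c x)]. This absorbs the powers of [ln t] that arise from expanding in [s]. *)
Lemma mul4_exp_bound (x c : R) (n : nat) : (0 < c)%R -> (0 <= x)%R -> (n <= 4)%nat ->
  (x ^ n <= (4 / c) ^ n * exp (c * x))%R.
Proof.
intros Hc Hx Hn.
assert (H : (x <= 4 / c * exp (c * x / 4))%R).
{ assert (E := exp_ineq1_le (c * x / 4)).
  apply Rle_trans with (4 / c * (c * x / 4))%R; [right; field; lra|].
  apply Rmult_le_compat_l; [|lra]. left. apply Rdiv_lt_0_compat; lra. }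
apply Rle_trans with ((4 / c * exp (c * x / 4)) ^ n)%R; [apply pow_incr; lra|].
rewrite Rpow_mult_distr. apply Rmult_le_compat_l.
- apply pow_le. left. apply Rdiv_lt_0_compat; lra.
- rewrite exp_pow_INR.
  assert (K : (INR n * (c * x / 4) <= c * x)%R).
  { assert (I := le_INR _ _ Hn). replace (INR 4) with 4%R in I by (simpl; ring).
    assert (0 <= c * x)%R by nra. nra. }
  destruct K as [K|K]; [left; now apply exp_increasing|rewrite K; lra].
Qed.

(** One of the two powers handles [t >= 1], the other [t < 1]; logarithms therefore cost a margin
    [r] on both sides of the abscissa. *)
Lemma exp_Rabs_ln (t r : R) : (0 <= r)%R -> (exp (r * Rabs (ln t)) <= Rpower t r + Rpower t (- r))%R.
Proof.
intros Hr. unfold Rpower. pose proof (exp_pos (r * ln t)). pose proof (exp_pos (- r * ln t)).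
unfold Rabs. destruct (Rcase_abs (ln t)); [|lra].
replace (r * - ln t)%R with (- r * ln t)%R by ring. lra.
Qed.

Lemma mellin_majorant (p r : R) :
  mellin_conv g Fa Fb (p - r) -> mellin_conv g Fa Fb (p + r) ->
  exists l, is_RInt_gen (V := R_NormedModule)
    (fun t => Rabs (g t) * Rpower t (p - 1) * (Rpower t r + Rpower t (- r)))%R Fa Fb l.
Proof.
intros [l1 H1] [l2 H2]. exists (plus l1 l2).
apply (is_RInt_gen_ext_dom HD) with (2 := is_RInt_gen_plus (V := R_NormedModule) _ _ _ _ H1 H2).
intros t _. unfold plus; simpl.
replace (p - r - 1)%R with (p - 1 + - r)%R by ring. replace (p + r - 1)%R with (p - 1 + r)%R by ring.
rewrite !Rpower_plus. ring.
Qed.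

Lemma continuous_majorant (p r t : R) : Dm t ->
  continuous (fun t => Rabs (g t) * Rpower t (p - 1) * (Rpower t r + Rpower t (- r)))%R t.
Proof.
intros Ht. apply continuous_Rmult; [now apply continuous_mellin_abs|].
assert (H0 := idom_pos _ _ _ HD t Ht).
apply continuous_Rplus; now apply continuous_Rpower.
Qed.

(** Up to factorials these integrals are the Taylor coefficients of the Mellin transform at [s]. *)
Lemma is_mellin_log (s : C) (r : R) (n : nat) : (0 < r)%R -> (n <= 4)%nat ->
  mellin_conv g Fa Fb (Re s - r) -> mellin_conv g Fa Fb (Re s + r) ->
  exists l, is_CInt (fun t => RtoC (g t) * cpow t (s - 1) * RtoC (ln t) ^ n) Fa Fb l.
Proof.
intros Hr Hn H1 H2. destruct (mellin_majorant (Re s) r H1 H2) as [l Hl].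
assert (Hl' := is_RInt_gen_scal (V := R_NormedModule) _ ((4 / r) ^ n)%R _ Hl).
eexists. apply (ex_CInt_dominated HD) with (4 := ex_intro _ _ Hl').
- intros t Ht. apply continuous_Cmult; [now apply continuous_mellin_kernel|].
  apply continuous_ext with (f := fun t => RtoC (ln t ^ n)); [intros x; apply RtoC_pow|].
  apply continuous_RtoC. apply (ex_derive_continuous (K := R_AbsRing) (V := R_NormedModule)).
  auto_derive. now apply (idom_pos _ _ _ HD).
- intros t Ht. apply continuous_Rmult; [apply continuous_const|].
  now apply continuous_majorant.
- intros t Ht. rewrite Cmod_mult, Cmod_mellin_kernel, Cmod_pow, Cmod_R.
  unfold scal; simpl; unfold mult; simpl.
  assert (B := mul4_exp_bound (Rabs (ln t)) r n Hr (Rabs_pos _) Hn).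
  assert (B' := exp_Rabs_ln t r (Rlt_le _ _ Hr)).
  match goal with |- (?a * ?b <= ?c * (?a * ?d))%R =>
    replace (c * (a * d))%R with (a * (c * d))%R by ring end.
  apply Rmult_le_compat_l.
  + apply Rmult_le_pos; [apply Rabs_pos|left; apply exp_pos].
  + eapply Rle_trans; [exact B|]. apply Rmult_le_compat_l; [|exact B'].
    apply pow_le. left; apply Rdiv_lt_0_compat; lra.
Qed.

Lemma cexp_trunc_4 (z : C) :
  cexp_trunc 4 z = 1 + z + z ^ 2 * RtoC (/ 2) + z ^ 3 * RtoC (/ 6).
Proof.
simpl. rewrite Rinv_1.
replace (1 + 1)%R with 2%R by ring. replace (2 + 1 + 1 + 1 + 1)%R with 6%R by ring. ring.
Qed.

(** With [h = w - s] the kernel is [t^(s-1) exp (h ln t)], and the exponential is expanded to order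
    four. The remainder is at most [|h|^4 |ln t|^4 exp (|h| |ln t|)]: half of the margin [r] absorbs
    the fourth power of the logarithm and the other half the exponential, whence the restriction
    [|h| < r / 2]. *)
Lemma mellin_expansion4 (s : C) (r : R) : (0 < r)%R ->
  mellin_conv g Fa Fb (Re s - r) -> mellin_conv g Fa Fb (Re s + r) ->
  (forall p, (Re s - r < p < Re s + r)%R -> mellin_conv g Fa Fb p) ->
  expansion4 (mellin g Fa Fb) s.
Proof.
intros Hr H1 H2 H3.
destruct (is_mellin_log s r 1 Hr ltac:(lia) H1 H2) as [l1 L1].
destruct (is_mellin_log s r 2 Hr ltac:(lia) H1 H2) as [l2 L2].
destruct (is_mellin_log s r 3 Hr ltac:(lia) H1 H2) as [l3 L3].
assert (L0 := is_mellin s (H3 (Re s) ltac:(lra))).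
destruct (mellin_majorant (Re s) r H1 H2) as [m Hm].
assert (Hr2 : (0 < r / 2)%R) by lra.
exists l1, (RtoC (/ 2) * l2), (RtoC (/ 6) * l3), (((4 / (r / 2)) ^ 4) * m)%R.
apply locally_Cmod. exists (r / 2)%R. split; [lra|]. intros w Hw.
set (h := w - s) in *.
assert (Hre : (Rabs (Re w - Re s) <= Cmod h)%R).
{ replace (Re w - Re s)%R with (Re h) by reflexivity. apply re_le_Cmod. }
assert (Lw : is_CInt (fun t => RtoC (g t) * cpow t (w - 1)) Fa Fb (mellin g Fa Fb w)).
{ apply is_mellin, H3. assert (A := Rle_lt_trans _ _ _ Hre Hw). apply Rabs_def2 in A. lra. }
assert (M0 := is_CInt_Cmult HD _ (- (1)) _ L0).
assert (M1 := is_CInt_Cmult HD _ (- h) _ L1).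
assert (M2 := is_CInt_Cmult HD _ (- (h ^ 2 * RtoC (/ 2))) _ L2).
assert (M3 := is_CInt_Cmult HD _ (- (h ^ 3 * RtoC (/ 6))) _ L3).
assert (S := is_CInt_plus HD _ _ _ _ (is_CInt_plus HD _ _ _ _ (is_CInt_plus HD _ _ _ _
   (is_CInt_plus HD _ _ _ _ Lw M0) M1) M2) M3).
match type of S with is_RInt_gen _ _ _ ?l =>
  replace (mellin g Fa Fb w - (mellin g Fa Fb s + h * l1 + h ^ 2 * (RtoC (/ 2) * l2) + h ^ 3 * (RtoC (/ 6) * l3)))
    with l by ring end.
assert (Hm' := is_RInt_gen_scal (V := R_NormedModule) _ ((4 / (r / 2)) ^ 4 * Cmod h ^ 4)%R _ Hm).
eapply Rle_trans; [apply (is_CInt_norm HD) with (2 := S) (3 := Hm')|].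
2:{ unfold scal; simpl; unfold mult; simpl. lra. }
intros t Ht. assert (Ht0 := idom_pos _ _ _ HD t Ht).
set (L := ln t).
match goal with |- (Cmod ?z <= _)%R =>
  replace z with (RtoC (g t) * cpow t (s - 1) * (Cexp (h * RtoC L) - cexp_trunc 4 (h * RtoC L))) end.
2:{ rewrite cexp_trunc_4.
    replace (w - 1) with (s - 1 + h) by (unfold h; ring). rewrite cpow_plus.
    unfold cpow at 3. fold L. simpl (_ ^ 1). ring. }
rewrite Cmod_mult, Cmod_mellin_kernel.
match goal with |- (_ <= scal ?c ?x)%R => change (scal c x) with (c * x)%R end. cbv beta.
match goal with |- (?a * ?b <= ?c * (?a * ?d))%R =>
  replace (c * (a * d))%R with (a * (c * d))%R by ring end.
apply Rmult_le_compat_l.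
{ apply Rmult_le_pos; [apply Rabs_pos|left; apply exp_pos]. }
eapply Rle_trans; [apply Cexp_remainder|].
rewrite Cmod_mult, Cmod_R.
assert (P := Cmod_ge_0 h). assert (Q := Rabs_pos L).
assert (B := mul4_exp_bound (Rabs L) (r / 2) 4 Hr2 Q ltac:(lia)).
assert (B' := exp_Rabs_ln t r (Rlt_le _ _ Hr)). fold L in B'.
assert (E : (exp (Cmod h * Rabs L) <= exp (r / 2 * Rabs L))%R).
{ assert (K : (Cmod h * Rabs L <= r / 2 * Rabs L)%R) by nra.
  destruct K as [K|K]; [left; now apply exp_increasing|rewrite K; lra]. }
rewrite Rpow_mult_distr.
replace ((4 / (r / 2)) ^ 4 * Cmod h ^ 4 * (Rpower t r + Rpower t (- r)))%R
  with (Cmod h ^ 4 * ((4 / (r / 2)) ^ 4 * (Rpower t r + Rpower t (- r))))%R by ring.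
rewrite Rmult_assoc. apply Rmult_le_compat_l; [now apply pow_le|].
apply Rle_trans with ((4 / (r / 2)) ^ 4 * exp (r / 2 * Rabs L) * exp (r / 2 * Rabs L))%R.
- apply Rmult_le_compat; try easy.
  + now apply pow_le.
  + left; apply exp_pos.
- rewrite Rmult_assoc, <- exp_plus. replace (r / 2 * Rabs L + r / 2 * Rabs L)%R with (r * Rabs L)%R by field.
  apply Rmult_le_compat_l; [|exact B'].
  apply pow_le. left; apply Rdiv_lt_0_compat; lra.
Qed.

Lemma mellin_smooth (s : C) (r : R) : (0 < r)%R ->
  (forall p, (Re s - r < p < Re s + r)%R -> mellin_conv g Fa Fb p) ->
  smooth (mellin g Fa Fb) s.
Proof.
intros Hr H. apply locally_Cmod. exists (r / 2)%R. split; [lra|]. intros w Hw.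
assert (Hre : (Rabs (Re w - Re s) <= Cmod (w - s))%R) by apply (re_le_Cmod (w - s)).
assert (A := Rle_lt_trans _ _ _ Hre Hw). apply Rabs_def2 in A.
(* For [w] within [r / 2] of [s] the closed strip of half-width [r / 4] around [Re w] stays inside
   the open strip of convergence. *)
apply mellin_expansion4 with (r / 4)%R; [lra| | |].
- apply H; lra.
- apply H; lra.
- intros p Hp; apply H; lra.
Qed.

End Mellin.

Lemma smooth_Cexp (z : C) : smooth Cexp z.
Proof.
apply locally_all. intros w.
exists (Cexp w), (Cexp w * RtoC (/ 2)), (Cexp w * RtoC (/ 6)), (Cmod (Cexp w) * exp 1)%R.
refine (filter_imp _ _ _ (locally_Cmod_lt w 1 Rlt_0_1)). intros v Hv.
set (h := v - w) in *.
replace (Cexp v) with (Cexp w * Cexp h) by (rewrite <- Cexp_plus; f_equal; unfold h; ring).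
replace (Cexp w * Cexp h - (Cexp w + h * Cexp w + h ^ 2 * (Cexp w * RtoC (/ 2)) + h ^ 3 * (Cexp w * RtoC (/ 6))))
  with (Cexp w * (Cexp h - cexp_trunc 4 h)) by (rewrite cexp_trunc_4; ring).
rewrite Cmod_mult, Rmult_assoc. apply Rmult_le_compat_l; [apply Cmod_ge_0|].
eapply Rle_trans; [apply Cexp_remainder|]. rewrite Rmult_comm.
apply Rmult_le_compat_r; [apply pow_le, Cmod_ge_0|]. left; now apply exp_increasing.
Qed.

(** * The gamma function *)

Lemma ln_le_sub1 (x : R) : (0 < x)%R -> (ln x <= x - 1)%R.
Proof. intros H. assert (E := exp_ineq1_le (ln x)). rewrite exp_ln in E by easy. lra. Qed.

(** The maximum of [x^eta exp (- x)] is attained at [x = eta], which gives the constant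
    [eta^eta exp (- eta)]. *)
Lemma exp_neg_le_Rpower (eta : R) : (0 < eta)%R ->
  exists K, (0 < K)%R /\ forall x, (0 < x)%R -> (exp (- x) <= K * Rpower x (- eta))%R.
Proof.
intros He. exists (exp (eta * ln eta - eta)). split; [apply exp_pos|]. intros x Hx.
unfold Rpower. rewrite <- exp_plus.
assert (H := ln_le_sub1 (x / eta) ltac:(now apply Rdiv_lt_0_compat)).
rewrite ln_div in H by easy.
assert (L : (- x <= eta * ln eta - eta + - eta * ln x)%R).
{ apply (Rmult_le_compat_l eta) in H; [|lra].
  replace (eta * (x / eta - 1))%R with (x - eta)%R in H by (field; lra). lra. }
destruct L as [L|L]; [left; now apply exp_increasing|rewrite L; lra].
Qed.

Lemma mellin_conv_0 (g : R -> R) (a K q p : R) : (0 < a)%R ->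
  (forall t, (0 < t <= a)%R -> continuous g t) ->
  (forall t, (0 < t <= a)%R -> (Rabs (g t) <= K * Rpower t (- q))%R) ->
  (q < p)%R -> mellin_conv g (at_right 0) (at_point a) p.
Proof.
intros Ha Hg Hb Hq.
assert (HD := idom_0_point a Ha).
destruct (ex_RInt_Rpower_0 (p - q) a ltac:(lra) Ha) as [l Hl].
assert (Hl' := is_RInt_gen_scal (V := R_NormedModule) _ K _ Hl).
apply (mellin_conv_le HD g Hg) with (3 := ex_intro _ _ Hl').
- intros t Ht. apply (continuous_Rmult (fun _ => K)); [apply continuous_const|].
  apply continuous_Rpower; lra.
- intros t Ht. change (Rabs (g t) * Rpower t (p - 1) <= K * Rpower t (p - q - 1))%R.
  replace (p - q - 1)%R with (- q + (p - 1))%R by ring. rewrite Rpower_plus, <- Rmult_assoc.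
  apply Rmult_le_compat_r; [left; apply exp_pos|now apply Hb].
Qed.

Lemma mellin_conv_infty (g : R -> R) (a K q p : R) : (0 < a)%R ->
  (forall t, (a <= t)%R -> continuous g t) ->
  (forall t, (a <= t)%R -> (Rabs (g t) <= K * Rpower t (- q))%R) ->
  (p < q)%R -> mellin_conv g (at_point a) (Rbar_locally p_infty) p.
Proof.
intros Ha Hg Hb Hq.
assert (HD := idom_point_infty a Ha).
destruct (ex_RInt_Rpower_infty (p - q) a ltac:(lra) Ha) as [l Hl].
assert (Hl' := is_RInt_gen_scal (V := R_NormedModule) _ K _ Hl).
apply (mellin_conv_le HD g Hg) with (3 := ex_intro _ _ Hl').
- intros t Ht. apply (continuous_Rmult (fun _ => K)); [apply continuous_const|].
  apply continuous_Rpower; lra.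
- intros t Ht. change (Rabs (g t) * Rpower t (p - 1) <= K * Rpower t (p - q - 1))%R.
  replace (p - q - 1)%R with (- q + (p - 1))%R by ring. rewrite Rpower_plus, <- Rmult_assoc.
  apply Rmult_le_compat_r; [left; apply exp_pos|now apply Hb].
Qed.

Lemma mellin_conv_points (g : R -> R) (a b p : R) : (0 < a)%R -> (a <= b)%R ->
  (forall t, (a <= t <= b)%R -> continuous g t) ->
  mellin_conv g (at_point a) (at_point b) p.
Proof.
intros Ha Hb Hg. assert (HD := idom_points a b Ha Hb).
unfold mellin_conv. apply (ex_RInt_gen_at_point (V := R_CompleteNormedModule)).
apply (ex_RInt_continuous (V := R_CompleteNormedModule)). intros z Hz.
rewrite Rmin_left, Rmax_right in Hz by easy.
now apply (continuous_mellin_abs HD g Hg).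
Qed.

Lemma mellin_conv_Chasles (g : R -> R) (a p : R) :
  mellin_conv g (at_right 0) (at_point a) p -> mellin_conv g (at_point a) (Rbar_locally p_infty) p ->
  mellin_conv g (at_right 0) (Rbar_locally p_infty) p.
Proof.
apply (ex_RInt_gen_Chasles (V := R_NormedModule)).
Qed.

Lemma mellin_Chasles (g : R -> R) (a : R) (s : C) : (0 < a)%R ->
  (forall t, (0 < t)%R -> continuous g t) ->
  mellin_conv g (at_right 0) (at_point a) (Re s) ->
  mellin_conv g (at_point a) (Rbar_locally p_infty) (Re s) ->
  mellin g (at_right 0) (Rbar_locally p_infty) s =
  mellin g (at_right 0) (at_point a) s + mellin g (at_point a) (Rbar_locally p_infty) s.
Proof.
intros Ha Hg H1 H2. apply (is_CInt_unique idom_0_infty).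
apply (is_RInt_gen_Chasles (V := C_R_NormedModule)) with (b := a).
- apply (is_mellin (idom_0_point a Ha)); [|easy]. intros t Ht; apply Hg; lra.
- apply (is_mellin (idom_point_infty a Ha)); [|easy]. intros t Ht; apply Hg; lra.
Qed.

Definition expneg (u : R) : R := exp (- u).

Lemma continuous_expneg (t : R) : continuous expneg t.
Proof.
apply (ex_derive_continuous (K := R_AbsRing) (V := R_NormedModule)). unfold expneg. now auto_derive.
Qed.

Lemma Rabs_expneg (t : R) : Rabs (expneg t) = exp (- t).
Proof. apply Rabs_pos_eq. left; apply exp_pos. Qed.

Lemma expneg_conv_0 (a p : R) : (0 < a)%R -> (0 < p)%R ->
  mellin_conv expneg (at_right 0) (at_point a) p.
Proof.
intros Ha Hp. apply mellin_conv_0 with (K := 1%R) (q := 0%R); try easy.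
- intros; apply continuous_expneg.
- intros t Ht. rewrite Rabs_expneg, Ropp_0, Rpower_O, Rmult_1_r, <- exp_0 by lra.
  left; apply exp_increasing; lra.
Qed.

Lemma expneg_conv_infty (a p : R) : (0 < a)%R ->
  mellin_conv expneg (at_point a) (Rbar_locally p_infty) p.
Proof.
intros Ha. destruct (exp_neg_le_Rpower (Rabs p + 1)) as [K [HK H]].
{ pose proof (Rabs_pos p); lra. }
apply mellin_conv_infty with (K := K) (q := (Rabs p + 1)%R); try easy.
- intros; apply continuous_expneg.
- intros t Ht. rewrite Rabs_expneg. apply H. lra.
- pose proof (Rle_abs p); lra.
Qed.

Lemma expneg_conv (p : R) : (0 < p)%R ->
  mellin_conv expneg (at_right 0) (Rbar_locally p_infty) p.
Proof.
intros Hp. apply mellin_conv_Chasles with 1%R.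
- apply expneg_conv_0; lra.
- apply expneg_conv_infty; lra.
Qed.

Lemma Gamma_int_mellin (s : C) : Gamma_int s = mellin expneg (at_right 0) (Rbar_locally p_infty) s.
Proof. reflexivity. Qed.

Lemma is_Gamma (s : C) : (0 < Re s)%R ->
  is_CInt (fun t => RtoC (expneg t) * cpow t (s - 1)) (at_right 0) (Rbar_locally p_infty) (Gamma_int s).
Proof.
intros Hs. apply (is_mellin idom_0_infty); [intros; apply continuous_expneg|now apply expneg_conv].
Qed.

Lemma filterlim_C_squeeze {T : Type} (F : (T -> Prop) -> Prop) {FF : Filter F} (f k : T -> C) (K : R) :
  (0 < K)%R -> F (fun t => (Cmod (f t) <= K * Cmod (k t))%R) ->
  filterlim k F (locally (T := C_UniformSpace) (RtoC 0)) ->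
  filterlim f F (locally (T := C_UniformSpace) (RtoC 0)).
Proof.
intros HK H Hk. apply filterlim_C_eps; [easy|]. intros eps He.
assert (L : locally (T := C_UniformSpace) (RtoC 0) (fun y => (Cmod (y - 0) < eps / K)%R))
  by (apply locally_Cmod_lt; now apply Rdiv_lt_0_compat).
apply Hk in L. unfold filtermap in L.
generalize (filter_and _ _ H L). apply filter_imp. intros t [A B].
replace (f t - 0) with (f t) by ring. replace (k t - 0) with (k t) in B by ring.
eapply Rle_lt_trans; [exact A|]. apply (Rmult_lt_compat_l K) in B; [|easy].
replace (K * (eps / K))%R with eps in B by (field; lra). exact B.
Qed.

Lemma cder_expneg (t : R) : cder (fun t => RtoC (expneg t)) t (- RtoC (expneg t)).
Proof.
rewrite <- RtoC_opp. apply cder_RtoC. unfold expneg. auto_derive; [easy|ring].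
Qed.

Lemma filterlim_expneg_cpow_infty (s : C) :
  filterlim (fun t => RtoC (expneg t) * cpow t s) (Rbar_locally p_infty)
    (locally (T := C_UniformSpace) (RtoC 0)).
Proof.
destruct (exp_neg_le_Rpower (Rabs (Re s) + 1)) as [K [HK H]].
{ pose proof (Rabs_pos (Re s)); lra. }
apply filterlim_C_squeeze with (k := fun t => cpow t (s - RtoC (Rabs (Re s) + 1))) (K := K); try easy.
- apply (Rbar_locally_filter p_infty).
- exists 0%R. intros t Ht. rewrite Cmod_mult, Cmod_R, Rabs_expneg, !Cmod_cpow. simpl.
  change (fst s) with (Re s).
  replace (Re s + - (Rabs (Re s) + 1))%R with (- (Rabs (Re s) + 1) + Re s)%R by ring.
  rewrite Rpower_plus, <- Rmult_assoc. apply Rmult_le_compat_r; [left; apply exp_pos|now apply H].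
- apply filterlim_cpow_infty. simpl. change (fst s) with (Re s). pose proof (Rle_abs (Re s)). lra.
Qed.

(** Integration by parts: the derivative of [exp (- t) t^s] integrates to 0. *)
Lemma Gamma_int_succ (s : C) : (0 < Re s)%R -> Gamma_int (s + 1) = s * Gamma_int s.
Proof.
intros Hs.
assert (I1 := is_Gamma s Hs).
assert (I2 : (0 < Re (s + 1))%R) by (simpl; change (fst s) with (Re s); lra).
apply is_Gamma in I2.
assert (HD := idom_0_infty).
assert (J : is_CInt (fun t => - RtoC (expneg t) * cpow t s + RtoC (expneg t) * (s * cpow t (s - 1)))
   (at_right 0) (Rbar_locally p_infty) (RtoC 0 - RtoC 0)).
{ apply (is_CInt_cder HD (fun t => RtoC (expneg t) * cpow t s)).
  - intros t Ht. eapply cder_eq; [apply cder_mult; [apply cder_expneg|now apply cder_cpow]|easy].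
  - intros t Ht.
    apply continuous_Cplus; apply continuous_Cmult.
    + apply continuous_ext with (f := fun t => RtoC (- expneg t)); [intros; apply RtoC_opp|].
      apply continuous_RtoC, continuous_Ropp, continuous_expneg.
    + now apply continuous_cpow.
    + apply continuous_RtoC, continuous_expneg.
    + apply continuous_Cmult; [apply continuous_const|now apply continuous_cpow].
  - apply filterlim_C_squeeze with (k := fun t => cpow t s) (K := 1%R).
    + apply at_right_proper_filter.
    + apply Rlt_0_1.
    + exists (mkposreal 1 Rlt_0_1). intros t _ Ht. rewrite Cmod_mult, Cmod_R, Rabs_expneg.
      apply Rmult_le_compat_r; [apply Cmod_ge_0|]. rewrite <- exp_0. left; apply exp_increasing; lra.
    + now apply filterlim_cpow_0.
  - apply filterlim_expneg_cpow_infty. }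
assert (J' := is_CInt_plus HD _ _ _ _ (is_CInt_Cmult HD _ (- (1)) _ I2) (is_CInt_Cmult HD _ s _ I1)).
assert (E : - (1) * Gamma_int (s + 1) + s * Gamma_int s = RtoC 0 - RtoC 0).
{ rewrite <- (is_CInt_unique HD _ _ J'). apply (is_CInt_unique HD).
  apply (is_CInt_ext HD) with (2 := J). intros t _.
  replace (s + 1 - 1) with s by ring. ring. }
replace (Gamma_int (s + 1)) with (s * Gamma_int s - (- (1) * Gamma_int (s + 1) + s * Gamma_int s)) by ring.
rewrite E. ring.
Qed.

Lemma Gamma_int_1 : Gamma_int 1 = 1.
Proof.
assert (HD := idom_0_infty).
rewrite Gamma_int_mellin. unfold mellin.
apply (is_CInt_unique HD).
assert (J : is_CInt (fun t => - (1) * (- RtoC (expneg t)))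
   (at_right 0) (Rbar_locally p_infty) (RtoC 0 - (- (1) * RtoC (expneg 0)))).
{ apply (is_CInt_cder HD (fun t => - (1) * RtoC (expneg t))).
  - intros t Ht. eapply cder_eq; [apply cder_mult; [apply cder_const|apply cder_expneg]|]. cbv beta. ring.
  - intros t Ht. apply continuous_Cmult; [apply continuous_const|].
    apply continuous_ext with (f := fun t => RtoC (- expneg t)); [intros; apply RtoC_opp|].
    apply continuous_RtoC, continuous_Ropp, continuous_expneg.
  - apply filterlim_Cmult_const; [apply at_right_proper_filter|].
    intros P HP. apply (continuous_RtoC expneg 0 (continuous_expneg 0)) in HP.
    unfold filtermap in *. revert HP. apply filter_le_within.
  - replace (RtoC 0) with (- (1) * RtoC 0) by ring.
    apply filterlim_Cmult_const; [apply (Rbar_locally_filter p_infty)|].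
    eapply filterlim_ext; [|apply (filterlim_expneg_cpow_infty 0)].
    intros t. simpl. rewrite cpow_0. ring. }
unfold expneg at 2 in J. rewrite Ropp_0, exp_0 in J.
replace (RtoC 0 - (- (1) * RtoC 1)) with (RtoC 1) in J by ring.
apply (is_CInt_ext HD) with (2 := J). intros t _.
replace (1 - RtoC 1) with (RtoC 0) by ring. rewrite cpow_0. unfold expneg. ring.
Qed.

Lemma Re_Cplus (a b : C) : Re (a + b) = (Re a + Re b)%R.
Proof. reflexivity. Qed.

Lemma Re_RtoC_mult (a : R) (z : C) : Re (RtoC a * z) = (a * Re z)%R.
Proof. simpl. unfold Re. ring. Qed.

Definition gam (x : R) : R := Re (Gamma_int (RtoC x)).

Lemma is_gam (x : R) : (0 < x)%R ->
  is_RInt_gen (V := R_NormedModule) (fun t => expneg t * Rpower t (x - 1))%R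
    (at_right 0) (Rbar_locally p_infty) (gam x).
Proof.
intros Hx. eapply (is_RInt_gen_ext_dom idom_0_infty).
2:{ apply (is_CInt_Re idom_0_infty). apply is_Gamma. exact Hx. }
intros t _. cbv beta. now rewrite Re_RtoC_mult, Re_cpow_RtoC_minus_1.
Qed.

Lemma gam_succ (x : R) : (0 < x)%R -> gam (x + 1) = (x * gam x)%R.
Proof.
intros Hx. unfold gam. rewrite RtoC_plus, Gamma_int_succ by exact Hx.
simpl. unfold Re, Im. ring.
Qed.

(** On [(0, 1]] the integrand is at least [exp (-1) t^(x - 1)], which already contributes
    [exp (-1) / x]. *)
Lemma gam_pos (x : R) : (0 < x)%R -> (0 < gam x)%R.
Proof.
intros Hx.
assert (HD0 := idom_0_point 1 Rlt_0_1). assert (HD1 := idom_point_infty 1 Rlt_0_1).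
assert (C0 : Re (RtoC x) = x) by reflexivity.
assert (E := mellin_Chasles expneg 1 (RtoC x) Rlt_0_1 (fun t _ => continuous_expneg t)
  (expneg_conv_0 1 x Rlt_0_1 Hx) (expneg_conv_infty 1 x Rlt_0_1)).
assert (A0 := is_mellin HD0 expneg (fun t _ => continuous_expneg t) (RtoC x) (expneg_conv_0 1 x Rlt_0_1 Hx)).
assert (A1 := is_mellin HD1 expneg (fun t _ => continuous_expneg t) (RtoC x) (expneg_conv_infty 1 x Rlt_0_1)).
apply (is_CInt_Re HD0) in A0. apply (is_CInt_Re HD1) in A1.
assert (B0 := is_CInt_Re HD0 _ _ (is_CInt_Cmult HD0 _ (RtoC (exp (- 1))) _
  (is_CInt_cpow_0 (RtoC x) 1 Hx Rlt_0_1))).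
assert (P1 : (0 <= Re (mellin expneg (at_point 1) (Rbar_locally p_infty) (RtoC x)))%R).
{ assert (Z := is_RInt_gen_scal (V := R_NormedModule) _ 0%R _ A1).
  apply (Rle_trans _ (scal 0%R (Re (mellin expneg (at_point 1) (Rbar_locally p_infty) (RtoC x))))).
  - unfold scal; simpl; unfold mult; simpl. lra.
  - apply (is_RInt_gen_le_dom HD1) with (2 := Z) (3 := A1). intros t Ht.
    rewrite Re_RtoC_mult, Re_cpow_RtoC_minus_1.
    unfold scal; simpl; unfold mult; simpl. rewrite Rmult_0_l.
    apply Rmult_le_pos; left; apply exp_pos. }
assert (P0 : (Re (RtoC (exp (- 1)) * (/ RtoC x * cpow 1 (RtoC x))) <=
   Re (mellin expneg (at_right 0) (at_point 1) (RtoC x)))%R).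
{ apply (is_RInt_gen_le_dom HD0) with (2 := B0) (3 := A0). intros t Ht.
  rewrite !Re_RtoC_mult, Re_cpow_RtoC_minus_1.
  apply Rmult_le_compat_r; [left; apply exp_pos|].
  unfold expneg. destruct (proj2 Ht) as [L| ->]; [left; apply exp_increasing; lra|right; f_equal; lra]. }
rewrite cpow_RtoC, <- RtoC_inv, <- !RtoC_mult in P0 by lra.
match type of P0 with (Re (RtoC ?a) <= _)%R => change (Re (RtoC a)) with a in P0 end.
unfold Rpower in P0. rewrite ln_1, Rmult_0_r, exp_0, Rmult_1_r in P0.
assert (0 < exp (- 1) * / x)%R by (apply Rmult_lt_0_compat; [apply exp_pos|now apply Rinv_0_lt_compat]).
unfold gam. rewrite Gamma_int_mellin, E, Re_Cplus. lra.
Qed.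

(** * Euler's integral has no zeros *)

Lemma cos_ge_quadratic (x : R) : (1 - x ^ 2 / 2 <= cos x)%R.
Proof.
replace x with (2 * (x / 2))%R at 2 by field. rewrite cos_2a_sin.
assert (H : (Rabs (sin (x / 2)) <= Rabs (x / 2))%R).
{ assert (P : forall y, (0 <= y)%R -> (Rabs (sin y) <= y)%R).
  { intros y [Hy| <-]; [|rewrite sin_0, Rabs_R0; lra].
    apply Rabs_le. split; [|left; now apply sin_lt_x].
    destruct (Rle_dec 1 y) as [L|L]; [pose proof (SIN_bound y); lra|].
    pose proof PI2_1. assert (0 <= sin y)%R by (apply sin_ge_0; lra). lra. }
  destruct (Rle_dec 0 (x / 2)) as [L|L].
  - rewrite (Rabs_pos_eq (x / 2)) by easy. now apply P.
  - rewrite <- (Ropp_involutive (x / 2)), sin_neg, !Rabs_Ropp.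
    rewrite (Rabs_left1 (x / 2)) by lra. apply P; lra. }
assert (H' := Rsqr_le_abs_1 _ _ H). unfold Rsqr in H'. simpl. lra.
Qed.

(** The squared logarithm is replaced by a combination of [v^k] with [-2 <= k <= 2], whose means
    under a Gamma distribution are quotients of values of [gam]. *)
Lemma ln_sqr_bound (v : R) : (0 < v)%R -> (ln v ^ 2 <= (v - 1) ^ 2 + (/ v - 1) ^ 2)%R.
Proof.
intros Hv. assert (A := ln_le_sub1 v Hv).
assert (B := ln_le_sub1 (/ v) (Rinv_0_lt_compat _ Hv)). rewrite ln_Rinv in B by easy.
assert (P := pow2_ge_0 (v - 1)). assert (Q := pow2_ge_0 (/ v - 1)).
destruct (Rle_dec 0 (ln v)).
- assert (ln v ^ 2 <= (v - 1) ^ 2)%R by (apply pow_incr; lra). lra.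
- assert ((- ln v) ^ 2 <= (/ v - 1) ^ 2)%R by (apply pow_incr; lra).
  replace (ln v ^ 2)%R with ((- ln v) ^ 2)%R by ring. lra.
Qed.

(* For real [x], [Gamma(x + i y) / Gamma(x)] is the mean of [u^(i y)] under the Gamma
   distribution of shape [x], which concentrates near its mean [x]; hence [x^(- i y) Gamma(x + i y)]
   has positive real part for large [x]. *)
Lemma Gamma_int_neq_0_large (x y : R) : (4 <= x)%R -> (5 * y ^ 2 < x)%R -> Gamma_int (x, y) <> 0.
Proof.
intros Hx Hy H0. set (s := (x, y) : C) in *.
assert (HD := idom_0_infty).
assert (Fa := idom_pa _ _ _ HD). assert (Fb := idom_pb _ _ _ HD).
assert (I := is_CInt_Re HD _ _ (is_CInt_Cmult HD _ (cpow x (0, (- y)%R)) _ (is_Gamma s ltac:(simpl; lra)))).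
rewrite H0, Cmult_0_r in I.
assert (G0 := is_gam x ltac:(lra)). assert (G1 := is_gam (x + 1) ltac:(lra)).
assert (G2 := is_gam (x + 1 + 1) ltac:(lra)). assert (G3 := is_gam (x - 1) ltac:(lra)).
assert (G4 := is_gam (x - 2) ltac:(lra)).
set (c := (y ^ 2 / 2)%R) in *.
(* [J] integrates [1 - c ((t/x - 1)^2 + (x/t - 1)^2)] against [exp (- t) t^(x - 1)], expanded in
   powers of [t]. By [cos_ge_quadratic] and [ln_sqr_bound] its integrand lies below that of [I]. *)
assert (J := is_RInt_gen_plus (V := R_NormedModule) _ _ _ _
  (is_RInt_gen_plus (V := R_NormedModule) _ _ _ _
  (is_RInt_gen_plus (V := R_NormedModule) _ _ _ _
  (is_RInt_gen_plus (V := R_NormedModule) _ _ _ _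
    (is_RInt_gen_scal (V := R_NormedModule) _ (1 - 2 * c)%R _ G0)
    (is_RInt_gen_scal (V := R_NormedModule) _ (2 * c / x)%R _ G1))
    (is_RInt_gen_scal (V := R_NormedModule) _ (- c / x ^ 2)%R _ G2))
    (is_RInt_gen_scal (V := R_NormedModule) _ (2 * c * x)%R _ G3))
    (is_RInt_gen_scal (V := R_NormedModule) _ (- c * x ^ 2)%R _ G4)).
match type of J with is_RInt_gen _ _ _ ?l => set (j := l) in J end.
assert (Hj : (j <= Re 0)%R).
{ apply (is_RInt_gen_le_dom HD) with (2 := J) (3 := I). intros t Ht.
  unfold scal, plus; simpl; unfold mult; simpl.
  assert (E : (cpow x (0, (- y)%R) * (RtoC (expneg t) * cpow t (s - 1)) =
      RtoC (expneg t * Rpower t (x - 1)) * Cexp (0, y * (ln t - ln x))%R)).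
  { replace (s - 1) with (RtoC (x - 1) + (0, y)%R).
    2:{ unfold s, RtoC, Cminus, Cplus, Copp; simpl. f_equal; ring. }
    rewrite cpow_plus, cpow_RtoC, RtoC_mult.
    replace (Cexp (0, y * (ln t - ln x))%R) with (cpow x (0, (- y)%R) * cpow t (0, y)%R); [ring|].
    unfold cpow. rewrite <- Cexp_plus. f_equal. unfold Cplus, Cmult; simpl. f_equal; ring. }
  match goal with |- (_ <= ?r)%R =>
    change r with (Re (cpow x (0, (- y)%R) * (RtoC (expneg t) * cpow t (s - 1)))) end.
  rewrite E. unfold Cexp; simpl. rewrite exp_0, Rmult_0_l, Rmult_1_l, Rminus_0_r.
  assert (Q := cos_ge_quadratic (y * (ln t - ln x))).
  assert (V := ln_sqr_bound (t / x) ltac:(apply Rdiv_lt_0_compat; lra)).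
  rewrite ln_div in V by lra.
  set (w := (expneg t * Rpower t (x - 1))%R).
  assert (W : (0 <= w)%R) by (apply Rmult_le_pos; left; apply exp_pos).
  assert (P1 : (expneg t * Rpower t (x + 1 - 1) = w * t)%R).
  { unfold w. replace (x + 1 - 1)%R with (x - 1 + 1)%R by ring.
    rewrite Rpower_plus, Rpower_1 by easy. ring. }
  assert (P2 : (expneg t * Rpower t (x + 1 + 1 - 1) = w * t * t)%R).
  { unfold w. replace (x + 1 + 1 - 1)%R with (x - 1 + 1 + 1)%R by ring.
    rewrite !Rpower_plus, Rpower_1 by easy. ring. }
  assert (P3 : (expneg t * Rpower t (x - 1 - 1) = w * / t)%R).
  { unfold w. replace (x - 1 - 1)%R with (x - 1 + Ropp 1)%R by ring.
    rewrite Rpower_plus, Rpower_Ropp, Rpower_1 by easy. ring. }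
  assert (P4 : (expneg t * Rpower t (x - 2 - 1) = w * / t * / t)%R).
  { unfold w. replace (x - 2 - 1)%R with (x - 1 + Ropp 1 + Ropp 1)%R by ring.
    rewrite !Rpower_plus, Rpower_Ropp, Rpower_1 by easy. ring. }
  rewrite P1, P2, P3, P4.
  apply Rle_trans with (w * (1 - c * ((t / x - 1) ^ 2 + (/ (t / x) - 1) ^ 2)))%R.
  - right. field. lra.
  - apply Rmult_le_compat_l; [easy|]. eapply Rle_trans; [|exact Q].
    replace ((y * (ln t - ln x)) ^ 2 / 2)%R with (c * (ln t - ln x) ^ 2)%R by (unfold c; field).
    assert (0 <= c)%R by (unfold c; nra).
    apply (Rmult_le_compat_l c) in V; [|easy]. lra. }
revert Hj. apply Rlt_not_le. simpl. unfold j. clear j J.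
unfold scal, plus; simpl; unfold mult; simpl.
set (g := gam (x - 2)).
assert (Hg : (0 < g)%R) by (apply gam_pos; lra).
assert (E3 : gam (x - 1) = ((x - 2) * g)%R).
{ replace (x - 1)%R with (x - 2 + 1)%R by ring. apply gam_succ. lra. }
assert (E0 : gam x = ((x - 1) * ((x - 2) * g))%R).
{ replace x with (x - 1 + 1)%R at 1 by ring. rewrite gam_succ, E3 by lra. ring. }
rewrite (gam_succ (x + 1)), (gam_succ x), E3, E0 by lra.
(* In units of [gam (x - 2)] every moment is a polynomial in [x], and [c < x / 10] leaves at least
   [(x - 1)(x - 2) - x^2 / 5], which is positive for [x >= 4]. *)
match goal with |- (0 < ?r)%R =>
  replace r with (g * ((x - 1) * (x - 2) - c * ((x - 1) * (x - 2) / x + (x + 2))))%R by (field; lra) end.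
apply Rmult_lt_0_compat; [easy|].
assert (Hc : (c < x / 10)%R) by (unfold c; lra).
assert (Hc0 : (0 <= c)%R) by (unfold c; nra).
assert (Hb : ((x - 1) * (x - 2) / x + (x + 2) <= 2 * x)%R).
{ replace ((x - 1) * (x - 2) / x)%R with (x - 3 + 2 / x)%R by (field; lra).
  assert (2 / x <= 1)%R by (apply Rle_div_l; lra). lra. }
assert (0 <= (x - 1) * (x - 2) / x)%R by (apply Rdiv_le_0_compat; nra).
assert (c * ((x - 1) * (x - 2) / x + (x + 2)) <= x / 10 * (2 * x))%R by nra.
nra.
Qed.

Lemma Gamma_int_neq_0 (s : C) : (0 < Re s)%R -> Gamma_int s <> 0.
Proof.
intros Hs H0.
assert (Z : forall n, Gamma_int (s + RtoC (INR n)) = 0).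
{ induction n as [|n IH].
  - simpl. now rewrite Cplus_0_r.
  - rewrite S_INR, RtoC_plus, Cplus_assoc, Gamma_int_succ, IH, Cmult_0_r; [easy|].
    simpl. pose proof (pos_INR n). unfold Re in Hs. lra. }
destruct (INR_unbounded (4 + 5 * Im s ^ 2)) as [n Hn].
apply (Gamma_int_neq_0_large (Re s + INR n) (Im s)).
- assert (0 <= Im s ^ 2)%R by nra. lra.
- lra.
- rewrite <- (Z n). f_equal. destruct s as [a b]. unfold Cplus, RtoC; simpl. f_equal; ring.
Qed.

(** * The reciprocal of the gamma function *)

Definition rising (n : nat) (s : C) : C := Cprod (fun k => s + RtoC (INR k)) (seq 0 n).

Lemma Cprod_app {T : Type} (f : T -> C) (l1 l2 : list T) :
  Cprod f (l1 ++ l2) = Cprod f l1 * Cprod f l2.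
Proof.
unfold Cprod. induction l1 as [|x l IH]; simpl; [ring|]. rewrite IH. ring.
Qed.

Lemma rising_S (n : nat) (s : C) : rising (S n) s = rising n s * (s + RtoC (INR n)).
Proof.
unfold rising. rewrite seq_S, Cprod_app. simpl. unfold Cprod at 2. simpl. ring.
Qed.

Lemma rising_shift (n : nat) (s : C) : rising (S n) s = s * rising n (s + 1).
Proof.
induction n as [|n IH].
- rewrite rising_S. unfold rising, Cprod; simpl. ring.
- rewrite rising_S, IH, rising_S, S_INR, RtoC_plus. ring.
Qed.

Lemma nice_rising (n : nat) (z : C) : nice (rising n) z.
Proof.
induction n as [|n IH].
- exact (nice_const 1 z).
- apply nice_ext with (f := fun s => rising n s * (s + RtoC (INR n))).
  + intros w. now rewrite rising_S.
  + apply nice_mult; [exact IH|]. apply nice_plus; [apply nice_id|apply nice_const].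
Qed.

Lemma Re_plus_INR (s : C) (n : nat) : Re (s + RtoC (INR n)) = (Re s + INR n)%R.
Proof. reflexivity. Qed.

(** The shift in the definition of [inv_Gamma] is the least admissible one; each further step
    multiplies numerator and denominator by the same nonzero factor. *)
Lemma inv_Gamma_eq (N : nat) (s : C) : (0 < Re s + INR N)%R ->
  inv_Gamma s = rising N s / Gamma_int (s + RtoC (INR N)).
Proof.
intros HN. unfold inv_Gamma. fold (rising (Z.to_nat (up (- Re s))) s).
set (n := Z.to_nat (up (- Re s))).
destruct (archimed (- Re s)) as [U1 U2].
assert (Hn : (0 < Re s + INR n)%R).
{ assert (IZR (up (- Re s)) <= INR n)%R; [|lra].
  unfold n. rewrite INR_IZR_INZ. apply IZR_le. lia. }
assert (Hle : (n <= N)%nat).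
{ unfold n. assert (up (- Re s) < Z.of_nat N + 1)%Z; [|lia].
  apply lt_IZR. rewrite plus_IZR, <- INR_IZR_INZ. lra. }
clear HN. induction Hle as [|N Hle IH]; [reflexivity|].
rewrite IH, rising_S, S_INR, RtoC_plus, Cplus_assoc.
assert (HN : (0 < Re (s + RtoC (INR N)))%R).
{ rewrite Re_plus_INR. apply le_INR in Hle. lra. }
rewrite (Gamma_int_succ (s + RtoC (INR N)) HN).
assert (G := Gamma_int_neq_0 _ HN).
assert (s + RtoC (INR N) <> 0) by (apply Re_neq_0; lra).
now field.
Qed.

Lemma inv_Gamma_pos (s : C) : (0 < Re s)%R -> inv_Gamma s = / Gamma_int s.
Proof.
intros H. rewrite (inv_Gamma_eq 0) by (simpl; lra). unfold rising, Cprod; simpl.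
rewrite Cplus_0_r. unfold Cdiv. ring.
Qed.

Lemma inv_Gamma_succ (s : C) : inv_Gamma s = s * inv_Gamma (s + 1).
Proof.
destruct (INR_unbounded (1 - Re s)) as [N HN].
rewrite (inv_Gamma_eq (S N) s) by (rewrite S_INR; lra).
rewrite (inv_Gamma_eq N (s + 1)) by (simpl; unfold Re in HN; lra).
rewrite rising_shift, S_INR, RtoC_plus.
replace (s + (RtoC (INR N) + 1)) with (s + 1 + RtoC (INR N)) by ring. unfold Cdiv. ring.
Qed.

Lemma inv_Gamma_rising (n : nat) (s : C) :
  inv_Gamma s = rising n s * inv_Gamma (s + RtoC (INR n)).
Proof.
induction n as [|n IH].
- simpl. rewrite Cplus_0_r. unfold rising, Cprod; simpl. ring.
- rewrite IH, rising_S, (inv_Gamma_succ (s + RtoC (INR n))), S_INR, RtoC_plus.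
  rewrite <- (Cplus_assoc s (RtoC (INR n)) 1). ring.
Qed.

Lemma inv_Gamma_1 : inv_Gamma 1 = 1.
Proof. rewrite inv_Gamma_pos by (simpl; lra). rewrite Gamma_int_1. field. Qed.

Lemma Gamma_int_smooth (z : C) : (0 < Re z)%R -> smooth Gamma_int z.
Proof.
intros Hz. apply (mellin_smooth idom_0_infty expneg (fun t _ => continuous_expneg t) z (Re z) Hz).
intros p Hp. apply expneg_conv. lra.
Qed.

Lemma locally_Re_gt (z : C) (x : R) : (x < Re z)%R ->
  locally (T := C_UniformSpace) z (fun w => (x < Re w)%R).
Proof.
intros H. apply locally_Cmod. exists (Re z - x)%R. split; [lra|]. intros w Hw.
assert (A := Rle_lt_trans _ _ _ (re_le_Cmod (w - z)) Hw). apply Rabs_def2 in A.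
replace (Re (w - z)) with (Re w - Re z)%R in A by reflexivity. lra.
Qed.

(** The shift in the definition of [inv_Gamma] jumps with [Re s]; one large [N] serves on a whole
    neighbourhood of [z]. *)
Lemma inv_Gamma_nice (z : C) : nice inv_Gamma z.
Proof.
destruct (INR_unbounded (- Re z)) as [N HN].
apply nice_ext_loc with (f := fun s => rising N s * / Gamma_int (s + RtoC (INR N))).
- apply (locally_C_imp _ _ _ (locally_Re_gt z (- INR N) ltac:(lra))). intros w Hw.
  symmetry. apply inv_Gamma_eq. lra.
- apply nice_mult; [apply nice_rising|].
  assert (P : (0 < Re (z + RtoC (INR N)))%R) by (rewrite Re_plus_INR; lra).
  apply nice_inv; [|now apply Gamma_int_neq_0].
  apply nice_translate. now apply smooth_nice, Gamma_int_smooth.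
Qed.

Local Close Scope C_scope.

Local Open Scope R_scope.

(** * Power series *)

(** Equations between terms of series are stated in the carrier of a normed module; the change of
    type lets [ring] see them as equations in [R]. *)
Ltac ring_R := match goal with |- ?a = ?b => change (@eq R a b) end; ring.

Lemma Rsum_nil {T : Type} (f : T -> R) : Rsum f nil = 0.
Proof. reflexivity. Qed.

Lemma Rsum_cons {T : Type} (f : T -> R) (x : T) (l : list T) : Rsum f (x :: l) = f x + Rsum f l.
Proof. reflexivity. Qed.

Lemma Rsum_app {T : Type} (f : T -> R) (l1 l2 : list T) : Rsum f (l1 ++ l2) = Rsum f l1 + Rsum f l2.
Proof. induction l1 as [|x l IH]; simpl; rewrite ?Rsum_cons, ?Rsum_nil; lra. Qed.

Lemma Rsum_ext {T : Type} (f g : T -> R) (l : list T) :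
  (forall x, In x l -> f x = g x) -> Rsum f l = Rsum g l.
Proof.
induction l as [|x l IH]; intros H; [reflexivity|].
rewrite !Rsum_cons, H, IH; [easy| |now left]. intros y Hy. apply H. now right.
Qed.

Lemma Rsum_plus {T : Type} (f g : T -> R) (l : list T) :
  Rsum (fun x => f x + g x) l = Rsum f l + Rsum g l.
Proof. induction l as [|x l IH]; rewrite ?Rsum_nil, ?Rsum_cons; lra. Qed.

Lemma Rsum_scal {T : Type} (c : R) (f : T -> R) (l : list T) :
  Rsum (fun x => c * f x) l = c * Rsum f l.
Proof. induction l as [|x l IH]; rewrite ?Rsum_nil, ?Rsum_cons; lra. Qed.

Lemma Rsum_0 {T : Type} (l : list T) : Rsum (fun _ => 0) l = 0.
Proof. induction l as [|x l IH]; rewrite ?Rsum_nil, ?Rsum_cons; lra. Qed.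

Lemma Rsum_map {S T : Type} (f : T -> R) (g : S -> T) (l : list S) :
  Rsum f (map g l) = Rsum (fun x => f (g x)) l.
Proof. unfold Rsum. now rewrite map_map. Qed.

Lemma Rsum_flat_map {S T : Type} (f : T -> R) (g : S -> list T) (l : list S) :
  Rsum f (flat_map g l) = Rsum (fun x => Rsum f (g x)) l.
Proof. induction l as [|x l IH]; simpl; [reflexivity|]. now rewrite Rsum_app, Rsum_cons, IH. Qed.

Lemma Rsum_filter {T : Type} (f : T -> R) (p : T -> bool) (l : list T) :
  Rsum f (filter p l) = Rsum (fun x => if p x then f x else 0) l.
Proof.
induction l as [|x l IH]; simpl; [reflexivity|].
rewrite Rsum_cons, <- IH. destruct (p x); rewrite ?Rsum_cons; lra.
Qed.

Lemma Rsum_swap {S T : Type} (f : S -> T -> R) (l1 : list S) (l2 : list T) :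
  Rsum (fun x => Rsum (f x) l2) l1 = Rsum (fun y => Rsum (fun x => f x y) l1) l2.
Proof.
induction l1 as [|x l IH].
- rewrite Rsum_nil. symmetry. apply Rsum_0.
- rewrite Rsum_cons, IH, <- Rsum_plus. reflexivity.
Qed.

Lemma Rsum_seq_S (f : nat -> R) (a n : nat) : Rsum f (seq a (S n)) = Rsum f (seq a n) + f (a + n)%nat.
Proof. rewrite seq_S, Rsum_app, Rsum_cons, Rsum_nil. lra. Qed.

Lemma Rsum_seq_shift (f : nat -> R) (a n : nat) :
  Rsum f (seq (S a) n) = Rsum (fun i => f (S i)) (seq a n).
Proof. now rewrite <- seq_shift, Rsum_map. Qed.

Lemma Rsum_le {T : Type} (f g : T -> R) (l : list T) :
  (forall x, In x l -> f x <= g x) -> Rsum f l <= Rsum g l.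
Proof.
induction l as [|x l IH]; intros H; [apply Rle_refl|]. rewrite !Rsum_cons.
apply Rplus_le_compat; [apply H; now left|apply IH; intros y Hy; apply H; now right].
Qed.

Lemma Rabs_Rsum {T : Type} (f : T -> R) (l : list T) : Rabs (Rsum f l) <= Rsum (fun x => Rabs (f x)) l.
Proof.
induction l as [|x l IH]; [rewrite Rsum_nil, Rabs_R0; apply Rle_refl|]. rewrite !Rsum_cons.
eapply Rle_trans; [apply Rabs_triang|]. lra.
Qed.

Lemma Rsum_const {T : Type} (c : R) (l : list T) : Rsum (fun _ => c) l = INR (length l) * c.
Proof.
induction l as [|x l IH]; [rewrite Rsum_nil; simpl; lra|].
rewrite Rsum_cons, IH. simpl length. rewrite S_INR. lra.
Qed.

Lemma Rsum_sum_f_R0 (f : nat -> R) (n : nat) : sum_f_R0 f n = Rsum f (seq 0 (S n)).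
Proof.
induction n as [|n IH].
- simpl. rewrite Rsum_cons, Rsum_nil. lra.
- rewrite Rsum_seq_S, <- IH. reflexivity.
Qed.

(* Coefficients of [exp (sum_h x_h t^h)], the sum being over [h0 <= h < h0 + k], as a sum over
   exponent tuples with entries at most [b]; indexing by [Z] makes the coefficients of negative
   index vanish without case distinctions. *)
Section ExpCoefficients.
Variable x : nat -> R.

Definition tuple_weight (h0 k : nat) (l : list nat) : nat :=
  list_sum (map (fun h => (h * nth (h - h0) l 0)%nat) (seq h0 k)).

Definition tuple_term (h0 k : nat) (l : list nat) : R :=
  Rprod (fun h => / INR (fact (nth (h - h0) l 0%nat)) * x h ^ (nth (h - h0) l 0%nat)) (seq h0 k).

Definition exp_coef (b h0 k : nat) (z : Z) : R :=
  Rsum (fun l => if Z.eqb (Z.of_nat (tuple_weight h0 k l)) z then tuple_term h0 k l else 0)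
    (bounded_tuples k b).

Lemma map_seq_shift_nth {T : Type} (F : nat -> nat -> T) (h0 k a : nat) (l : list nat) :
  map (fun h => F h (nth (h - h0) (a :: l) 0%nat)) (seq (S h0) k) =
  map (fun h => F h (nth (h - S h0) l 0%nat)) (seq (S h0) k).
Proof.
apply map_ext_in. intros h Hh. apply in_seq in Hh.
now replace (h - h0)%nat with (S (h - S h0))%nat by lia.
Qed.

Lemma tuple_weight_cons (h0 k a : nat) (l : list nat) :
  tuple_weight h0 (S k) (a :: l) = (h0 * a + tuple_weight (S h0) k l)%nat.
Proof.
unfold tuple_weight. rewrite <- cons_seq, map_cons, Nat.sub_diag.
rewrite (map_seq_shift_nth (fun h n => (h * n)%nat)). reflexivity.
Qed.

Lemma tuple_term_cons (h0 k a : nat) (l : list nat) :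
  tuple_term h0 (S k) (a :: l) = / INR (fact a) * x h0 ^ a * tuple_term (S h0) k l.
Proof.
unfold tuple_term, Rprod. rewrite <- cons_seq, map_cons, Nat.sub_diag.
rewrite (map_seq_shift_nth (fun h n => / INR (fact n) * x h ^ n)). reflexivity.
Qed.

Definition exp_term (h a : nat) : R := / INR (fact a) * x h ^ a.

Lemma exp_coef_S (b h0 k : nat) (z : Z) :
  exp_coef b h0 (S k) z =
  Rsum (fun a => exp_term h0 a * exp_coef b (S h0) k (z - Z.of_nat (h0 * a))%Z) (seq 0 (S b)).
Proof.
unfold exp_coef. cbn [bounded_tuples]. rewrite Rsum_flat_map. apply Rsum_ext. intros a _.
rewrite Rsum_map, <- Rsum_scal. apply Rsum_ext. intros l _.
rewrite tuple_weight_cons, tuple_term_cons. unfold exp_term.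
destruct (Z.eqb_spec (Z.of_nat (h0 * a + tuple_weight (S h0) k l)) z);
  destruct (Z.eqb_spec (Z.of_nat (tuple_weight (S h0) k l)) (z - Z.of_nat (h0 * a))); lia || lra.
Qed.

Lemma exp_coef_0 (b h0 : nat) (z : Z) : exp_coef b h0 0 z = if Z.eqb 0 z then 1 else 0.
Proof. unfold exp_coef. simpl. rewrite Rsum_cons, Rsum_nil. unfold tuple_weight, tuple_term, Rprod; simpl.
destruct (Z.eqb 0 z); lra. Qed.

Lemma exp_coef_neg (b h0 k : nat) (z : Z) : (z < 0)%Z -> exp_coef b h0 k z = 0.
Proof.
intros Hz. unfold exp_coef. transitivity (Rsum (fun _ : list nat => 0) (bounded_tuples k b)); [|apply Rsum_0].
apply Rsum_ext. intros l _.
destruct (Z.eqb_spec (Z.of_nat (tuple_weight h0 k l)) z); [lia|reflexivity].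
Qed.

(** The added index [h0 + k] exceeds the weight [z], so only the exponent 0 is possible there; the
    induction removes indices from the front until the added one comes first. *)
Lemma exp_coef_longer (b h0 k : nat) (z : Z) : (1 <= h0)%nat -> (z < Z.of_nat (h0 + k))%Z ->
  exp_coef b h0 (S k) z = exp_coef b h0 k z.
Proof.
revert h0 z. induction k as [|k IH]; intros h0 z H0 Hz.
- rewrite exp_coef_S, <- cons_seq, Rsum_cons. unfold exp_term at 1. simpl fact. simpl pow.
  rewrite (Rsum_ext _ (fun _ => 0)).
  + rewrite Rsum_0, !exp_coef_0, Nat.mul_0_r, Z.sub_0_r. simpl INR. rewrite Rinv_1. lra.
  + intros a Ha. apply in_seq in Ha. rewrite exp_coef_neg; [lra|]. nia.
- rewrite exp_coef_S, (exp_coef_S b h0 k). apply Rsum_ext. intros a _. f_equal. apply IH; lia.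
Qed.

(** An exponent [b + 1] at an index [h >= 1] already exceeds the weight [z <= b]. *)
Lemma exp_coef_bound_S (b h0 k : nat) (z : Z) : (1 <= h0)%nat -> (z <= Z.of_nat b)%Z ->
  exp_coef (S b) h0 k z = exp_coef b h0 k z.
Proof.
revert h0 z. induction k as [|k IH]; intros h0 z H0 Hz; [now rewrite !exp_coef_0|].
rewrite (exp_coef_S (S b)), (exp_coef_S b), Rsum_seq_S.
rewrite (exp_coef_neg (S b)) by nia. rewrite Rmult_0_r, Rplus_0_r.
apply Rsum_ext. intros a _. f_equal. apply IH; nia.
Qed.

Lemma exp_coef_stable (b b' k k' : nat) (z : Z) : (b <= b')%nat -> (k <= k')%nat ->
  (z <= Z.of_nat b)%Z -> (z <= Z.of_nat k)%Z -> exp_coef b' 1 k' z = exp_coef b 1 k z.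
Proof.
intros Hb Hk H1 H2. transitivity (exp_coef b 1 k' z).
- induction Hb as [|b' Hb IH]; [reflexivity|]. rewrite exp_coef_bound_S by lia. exact IH.
- induction Hk as [|k' Hk IH]; [reflexivity|]. rewrite exp_coef_longer by lia. exact IH.
Qed.

Lemma exp_term_S (h a : nat) : INR (S a) * exp_term h (S a) = x h * exp_term h a.
Proof.
unfold exp_term. change (fact (S a)) with (S a * fact a)%nat. rewrite mult_INR. simpl pow.
field. split; [apply INR_fact_neq_0|now apply not_0_INR].
Qed.

(** Coefficient form of [t F' = (t X') F] for [F = exp X]. The weight is split into the share of the
    first index, treated by [exp_term_S], and the rest, treated by induction. The bound [z <= b]
    makes the truncation of the exponents invisible. *)
Lemma exp_coef_rec (b h0 k : nat) (z : Z) : (1 <= h0)%nat -> (z <= Z.of_nat b)%Z ->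
  IZR z * exp_coef b h0 k z =
  Rsum (fun i => INR i * x i * exp_coef b h0 k (z - Z.of_nat i)%Z) (seq h0 k).
Proof.
revert h0 z. induction k as [|k IH]; intros h0 z H0 Hz.
- rewrite exp_coef_0. unfold seq. rewrite Rsum_nil. destruct (Z.eqb_spec 0 z) as [<-|]; ring.
- rewrite <- cons_seq, Rsum_cons.
  assert (E : IZR z * exp_coef b h0 (S k) z =
    Rsum (fun a => exp_term h0 a * (IZR (z - Z.of_nat (h0 * a)) * exp_coef b (S h0) k (z - Z.of_nat (h0 * a))%Z)) (seq 0 (S b))
    + Rsum (fun a => INR h0 * (INR a * exp_term h0 a) * exp_coef b (S h0) k (z - Z.of_nat (h0 * a))%Z) (seq 0 (S b))).
  { rewrite exp_coef_S, <- Rsum_scal, <- Rsum_plus. apply Rsum_ext. intros a _.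
    rewrite minus_IZR, <- INR_IZR_INZ, mult_INR. ring. }
  rewrite E, Rplus_comm. clear E. f_equal.
  + rewrite <- cons_seq, Rsum_cons. simpl (INR 0). rewrite Rmult_0_l, Rmult_0_r, Rmult_0_l, Rplus_0_l.
    rewrite Rsum_seq_shift. rewrite exp_coef_S, Rsum_seq_S.
    (* The top exponent [a = b] drops out, because it would leave a negative weight. *)
    rewrite (exp_coef_neg b (S h0) k) by nia. rewrite Rmult_0_r, Rplus_0_r, <- Rsum_scal.
    apply Rsum_ext. intros a _. rewrite exp_term_S.
    replace (z - Z.of_nat h0 - Z.of_nat (h0 * a))%Z with (z - Z.of_nat (h0 * S a))%Z by nia. ring.
  + transitivity (Rsum (fun a => Rsum (fun i => exp_term h0 a * (INR i * x i *
        exp_coef b (S h0) k (z - Z.of_nat (h0 * a) - Z.of_nat i)%Z)) (seq (S h0) k)) (seq 0 (S b))).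
    { apply Rsum_ext. intros a _. rewrite Rsum_scal. f_equal. apply IH; nia. }
    rewrite Rsum_swap. apply Rsum_ext. intros i _. rewrite exp_coef_S, <- Rsum_scal.
    apply Rsum_ext. intros a _.
    replace (z - Z.of_nat i - Z.of_nat (h0 * a))%Z with (z - Z.of_nat (h0 * a) - Z.of_nat i)%Z by lia. ring.
Qed.

Definition tuple_coef (m : nat) : R :=
  Rsum (fun l => Rprod (fun h => / INR (fact (entry l h)) * x h ^ entry l h) (seq 1 m))
    (weighted_tuples m).

Lemma tuple_coef_exp_coef (m : nat) : tuple_coef m = exp_coef m 1 m (Z.of_nat m).
Proof.
unfold tuple_coef, weighted_tuples, exp_coef. rewrite Rsum_filter. apply Rsum_ext. intros l _.
change (list_sum (map (fun h => (h * entry l h)%nat) (seq 1 m))) with (tuple_weight 1 m l).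
change (Rprod (fun h => / INR (fact (entry l h)) * x h ^ entry l h) (seq 1 m)) with (tuple_term 1 m l).
destruct (Nat.eqb_spec (tuple_weight 1 m l) m); destruct (Z.eqb_spec (Z.of_nat (tuple_weight 1 m l)) (Z.of_nat m));
  lia || reflexivity.
Qed.

Lemma tuple_coef_0 : tuple_coef 0 = 1.
Proof. rewrite tuple_coef_exp_coef, exp_coef_0. reflexivity. Qed.

(** The equation [u' = v u], with [v] the derivative of [sum_h x_h t^h]. All analytic properties of
    the coefficients are derived from it rather than from the sum over tuples. *)
Lemma tuple_coef_rec (m : nat) :
  PS_derive tuple_coef m = PS_mult (fun i => INR (S i) * x (S i)) tuple_coef m.
Proof.
unfold PS_derive, PS_mult. rewrite Rsum_sum_f_R0, tuple_coef_exp_coef, INR_IZR_INZ.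
rewrite exp_coef_rec by lia. rewrite Rsum_seq_shift. apply Rsum_ext. intros i Hi. apply in_seq in Hi.
f_equal. rewrite tuple_coef_exp_coef.
replace (Z.of_nat (S m) - Z.of_nat (S i))%Z with (Z.of_nat (m - i)) by lia.
apply exp_coef_stable; lia.
Qed.

End ExpCoefficients.

(** * Majorants and the equation [u' = v u] for power series *)

Lemma CV_radius_ge (a : nat -> R) (r M : R) : 0 <= r ->
  (forall n, Rabs (a n) * r ^ n <= M) -> Rbar_le r (CV_radius a).
Proof.
intros Hr H. apply (proj1 (CV_radius_bounded a)). exists M. intros n.
rewrite Rabs_mult, (Rabs_pos_eq (r ^ n)) by now apply pow_le. apply H.
Qed.

Lemma CV_radius_gt (a : nat -> R) (r M t : R) : 0 <= r ->
  (forall n, Rabs (a n) <= M * r ^ n) -> Rabs t * r < 1 -> Rbar_lt (Rabs t) (CV_radius a).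
Proof.
intros Hr H Ht.
(* [r] may be 0, while the argument divides by the ratio; the maximum is positive and still
   satisfies [|t| r' < 1]. *)
set (r' := (Rmax r (/ (2 * (Rabs t + 1))))).
assert (P := Rabs_pos t).
assert (Hi : 0 < / (2 * (Rabs t + 1))) by (apply Rinv_0_lt_compat; lra).
assert (Hr' : 0 < r') by (eapply Rlt_le_trans; [exact Hi|apply Rmax_r]).
assert (Ht' : Rabs t * r' < 1).
{ unfold r', Rmax. destruct (Rle_dec _ _); [|easy].
  apply (Rmult_lt_reg_r (2 * (Rabs t + 1))); [lra|]. rewrite Rmult_assoc, Rinv_l by lra. lra. }
apply Rbar_lt_le_trans with (/ r').
- simpl. apply (Rmult_lt_reg_r r'); [easy|]. rewrite Rinv_l; lra.
- apply CV_radius_ge with M; [left; now apply Rinv_0_lt_compat|]. intros n.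
  assert (M0 : 0 <= M).
  { specialize (H 0%nat). simpl in H. pose proof (Rabs_pos (a 0%nat)). lra. }
  apply Rle_trans with (M * r' ^ n * (/ r') ^ n).
  + apply Rmult_le_compat_r; [apply pow_le; left; now apply Rinv_0_lt_compat|].
    eapply Rle_trans; [apply H|]. apply Rmult_le_compat_l; [easy|].
    apply pow_incr. split; [easy|apply Rmax_l].
  + rewrite Rmult_assoc, <- Rpow_mult_distr, Rinv_r, pow1 by lra. lra.
Qed.

(** The factorisation of [x^(m+1) - y^(m+1)] with [x = K + r] and [y = r]. *)
Lemma geometric_Rsum (K r : R) (m : nat) :
  K * Rsum (fun i => r ^ (m - i) * (K + r) ^ i) (seq 0 (S m)) = (K + r) ^ S m - r ^ S m.
Proof.
induction m as [|m IH].
- simpl. rewrite Rsum_cons, Rsum_nil. simpl. ring.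
- rewrite Rsum_seq_S, Nat.add_0_l, Nat.sub_diag.
  rewrite (Rsum_ext _ (fun i => r * (r ^ (m - i) * (K + r) ^ i))).
  + rewrite Rsum_scal. replace (K * (r * Rsum (fun i => r ^ (m - i) * (K + r) ^ i) (seq 0 (S m)) + r ^ 0 * (K + r) ^ S m))
      with (r * (K * Rsum (fun i => r ^ (m - i) * (K + r) ^ i) (seq 0 (S m))) + K * (K + r) ^ S m)
      by (simpl (r ^ 0); ring).
    rewrite IH. simpl. ring.
  + intros i Hi. apply in_seq in Hi. replace (S m - i)%nat with (S (m - i)) by lia. simpl. ring.
Qed.

(** Strong induction on the recurrence for [(m + 1) u_(m+1)]: by [geometric_Rsum] its right-hand
    side is at most [|u_0| (K + r)^(m+1)], and the factor [m + 1 >= 1] on the left is dropped. *)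
Lemma ode_coef_bound (u v : nat -> R) (K r : R) : 0 <= K -> 0 <= r ->
  (forall n, PS_derive u n = PS_mult v u n) -> (forall n, Rabs (v n) <= K * r ^ n) ->
  forall n, Rabs (u n) <= Rabs (u 0%nat) * (K + r) ^ n.
Proof.
intros HK Hr Hu Hv n. induction n as [n IH] using lt_wf_ind. destruct n as [|m]; [simpl; lra|].
specialize (Hu m). unfold PS_derive, PS_mult in Hu. rewrite Rsum_sum_f_R0 in Hu.
assert (Hn : 1 <= INR (S m)) by (rewrite S_INR; pose proof (pos_INR m); lra).
assert (B : Rabs (INR (S m) * u (S m)) <= Rabs (u 0%nat) * (K + r) ^ S m).
{ rewrite Hu.
  eapply Rle_trans; [apply Rabs_Rsum|].
  apply Rle_trans with (Rsum (fun i => Rabs (u 0%nat) * (K * (r ^ i * (K + r) ^ (m - i)))) (seq 0 (S m))).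
  - apply Rsum_le. intros i Hi. apply in_seq in Hi. rewrite Rabs_mult.
    replace (Rabs (u 0%nat) * (K * (r ^ i * (K + r) ^ (m - i))))
      with (K * r ^ i * (Rabs (u 0%nat) * (K + r) ^ (m - i))) by ring.
    apply Rmult_le_compat; [apply Rabs_pos|apply Rabs_pos|apply Hv|apply IH; lia].
  - rewrite !Rsum_scal. apply Rmult_le_compat_l; [apply Rabs_pos|].
    assert (G := geometric_Rsum K r m).
    replace (Rsum (fun i => r ^ i * (K + r) ^ (m - i)) (seq 0 (S m)))
      with (Rsum (fun i => r ^ (m - i) * (K + r) ^ i) (seq 0 (S m))).
    + rewrite G. pose proof (pow_le r (S m) Hr). lra.
    + rewrite <- !Rsum_sum_f_R0.
      rewrite <- (sum_f_R0_skip (fun i => r ^ i * (K + r) ^ (m - i)) m). apply sum_eq. intros i Hi.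
      now replace (m - (m - i))%nat with i by lia. }
rewrite Rabs_mult, (Rabs_pos_eq (INR (S m))) in B by lra.
pose proof (Rabs_pos (u (S m))). nra.
Qed.

(** The product of [u] and [exp] of minus the primitive of [v] has derivative 0 between 0 and
    [t]. *)
Lemma PSeries_ode (u v : nat -> R) (t : R) :
  (forall n, PS_derive u n = PS_mult v u n) ->
  Rbar_lt (Rabs t) (CV_radius u) -> Rbar_lt (Rabs t) (CV_radius v) ->
  PSeries u t = u 0%nat * exp (PSeries (PS_Int v) t).
Proof.
intros Hu Cu Cv.
set (h := fun t => PSeries u t * exp (- PSeries (PS_Int v) t)).
assert (D : forall y, Rabs y <= Rabs t -> is_derive h y zero).
{ intros y Hy.
  assert (Cuy : Rbar_lt (Rabs y) (CV_radius u)) by (eapply Rbar_le_lt_trans; [|exact Cu]; exact Hy).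
  assert (Cvy : Rbar_lt (Rabs y) (CV_radius v)) by (eapply Rbar_le_lt_trans; [|exact Cv]; exact Hy).
  assert (D1 := is_derive_PSeries u y Cuy).
  assert (D2 : is_derive (PSeries (PS_Int v)) y (PSeries v y)).
  { replace (PSeries v y) with (PSeries (PS_derive (PS_Int v)) y).
    - apply is_derive_PSeries. now rewrite CV_radius_Int.
    - apply PSeries_ext. intros n. unfold PS_derive, PS_Int. field. now apply not_0_INR. }
  assert (E : PSeries (PS_derive u) y = PSeries v y * PSeries u y).
  { rewrite <- PSeries_mult by easy. now apply PSeries_ext. }
  rewrite E in D1. unfold h.
  evar_last.
  - apply (is_derive_mult (K := R_AbsRing) (PSeries u) (fun y => exp (- PSeries (PS_Int v) y))).
    + exact D1.
    + apply (is_derive_comp (K := R_AbsRing) (V := R_NormedModule) exp (fun y => - PSeries (PS_Int v) y)).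
      * apply is_derive_exp.
      * apply (is_derive_opp (V := R_NormedModule)). exact D2.
    + apply Rmult_comm.
  - unfold plus, mult, scal, opp, zero; simpl. unfold mult; simpl. ring. }
assert (H0 : h t = h 0).
{ destruct (Rtotal_order t 0) as [L|[->|L]]; [|reflexivity|].
  - apply (eq_is_derive (V := R_NormedModule) h t 0); [|lra]. intros y Hy. apply D.
    rewrite !Rabs_left1 by lra. lra.
  - symmetry. apply (eq_is_derive (V := R_NormedModule) h 0 t); [|lra]. intros y Hy. apply D.
    rewrite !Rabs_pos_eq by lra. lra. }
unfold h in H0. rewrite !PSeries_0 in H0. simpl (PS_Int v 0%nat) in H0.
change (PS_Int v 0) with 0 in H0. rewrite Ropp_0, exp_0, Rmult_1_r, exp_Ropp in H0.
rewrite <- H0, Rmult_assoc, Rinv_l, Rmult_1_r; [easy|]. pose proof (exp_pos (PSeries (PS_Int v) t)). lra.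
Qed.

Section PSDiv.
Variables a b : nat -> R.

(** Every coefficient of the quotient [b / a] depends on all earlier ones, so the recursion carries
    the table of the first [n] coefficients. *)
Fixpoint ps_div_table (n : nat) : nat -> R :=
  match n with
  | O => fun _ => 0
  | S n => fun i => if Nat.eqb i n
      then (b n - Rsum (fun j => ps_div_table n j * a (n - j)%nat) (seq 0 n)) / a 0%nat
      else ps_div_table n i
  end.

Definition ps_div (n : nat) : R := ps_div_table (S n) n.

Lemma ps_div_table_eq (m i : nat) : (i < m)%nat -> ps_div_table m i = ps_div i.
Proof.
induction m as [|m IH]; intros Hi; [lia|].
destruct (Nat.eq_dec i m) as [->|E]; [reflexivity|].
simpl. rewrite (proj2 (Nat.eqb_neq i m) E). apply IH. lia.
Qed.

Lemma ps_div_eq (n : nat) :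
  ps_div n = (b n - Rsum (fun j => ps_div j * a (n - j)%nat) (seq 0 n)) / a 0%nat.
Proof.
unfold ps_div at 1. simpl. rewrite Nat.eqb_refl. do 2 f_equal.
apply Rsum_ext. intros j Hj. apply in_seq in Hj. now rewrite ps_div_table_eq by lia.
Qed.

Lemma ps_div_mult (n : nat) : a 0%nat <> 0 -> PS_mult ps_div a n = b n.
Proof.
intros Ha. unfold PS_mult. rewrite Rsum_sum_f_R0, Rsum_seq_S, Nat.add_0_l, Nat.sub_diag.
rewrite (ps_div_eq n) at 1. field. exact Ha.
Qed.

End PSDiv.

(** * The Maclaurin series of the product of the digit functions *)

Lemma CV_radius_ge_ex_series (a : nat -> R) (x : R) :
  ex_series (fun n => a n * x ^ n) -> Rbar_le (Rabs x) (CV_radius a).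
Proof.
intros H. destruct (Rbar_le_lt_dec (Rabs x) (CV_radius a)) as [L|L]; [easy|].
exfalso. apply (CV_disk_outside a x L). now apply ex_series_lim_0.
Qed.

Lemma is_series_zero : is_series (V := R_NormedModule) (fun _ => 0) 0.
Proof.
apply filterlim_ext with (f := fun _ => 0); [|apply filterlim_const].
intros n. rewrite sum_n_const. symmetry. apply Rmult_0_r.
Qed.

(** * The digit sum and its logarithmic derivative *)

Definition Dsum (d : list R) (y : R) : R := Rsum (fun delta => exp (- delta * y)) d.

Definition Dsum_coef (d : list R) (j : nat) : R :=
  Rsum (fun delta => (- delta) ^ j / INR (fact j)) d.

Lemma is_series_Dsum (d : list R) (y : R) :
  is_series (fun j => Dsum_coef d j * y ^ j) (Dsum d y).
Proof.
unfold Dsum, Dsum_coef. induction d as [|x d IH].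
- rewrite Rsum_nil. apply is_series_ext with (a := fun _ => 0); [|apply is_series_zero].
  intros n. rewrite Rsum_nil. symmetry. apply Rmult_0_l.
- rewrite Rsum_cons.
  apply is_series_ext with (a := fun j => plus ((- x) ^ j / INR (fact j) * y ^ j)
    (Rsum (fun delta => (- delta) ^ j / INR (fact j)) d * y ^ j)).
  + intros n. rewrite Rsum_cons. unfold plus; simpl. ring_R.
  + apply (is_series_plus (V := R_NormedModule)); [|exact IH].
    assert (E := is_exp_Reals (- x * y)). apply is_pseries_R in E. revert E.
    apply is_series_ext. intros n. rewrite Rpow_mult_distr. unfold Rdiv. ring_R.
Qed.

Lemma CV_radius_Dsum_coef (d : list R) (t : R) : Rbar_lt (Rabs t) (CV_radius (Dsum_coef d)).
Proof.
apply Rbar_lt_le_trans with (Rabs (Rabs t + 1)).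
- simpl. rewrite (Rabs_pos_eq (Rabs t + 1)); pose proof (Rabs_pos t); lra.
- apply CV_radius_ge_ex_series. eexists. apply is_series_Dsum.
Qed.

Lemma PSeries_Dsum (d : list R) (y : R) : PSeries (Dsum_coef d) y = Dsum d y.
Proof. apply is_series_unique, is_series_Dsum. Qed.

Lemma Dsum_pos (d : list R) (y : R) : d <> nil -> 0 < Dsum d y.
Proof.
unfold Dsum. destruct d as [|x d]; [easy|]. intros _. rewrite Rsum_cons.
assert (0 <= Rsum (fun delta => exp (- delta * y)) d).
{ rewrite <- (Rsum_0 d). apply Rsum_le. intros; left; apply exp_pos. }
pose proof (exp_pos (- x * y)). lra.
Qed.

Lemma Dsum_0 (d : list R) : Dsum d 0 = INR (length d).
Proof.
unfold Dsum. rewrite (Rsum_ext _ (fun _ => 1)).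
- rewrite Rsum_const. ring.
- intros x _. now rewrite Rmult_0_r, exp_0.
Qed.

Lemma Dsum_coef_0 (d : list R) : Dsum_coef d 0 = INR (length d).
Proof.
unfold Dsum_coef. rewrite (Rsum_ext _ (fun _ => 1)).
- rewrite Rsum_const. ring.
- intros x _. simpl. field.
Qed.

(** For nonnegative digits an upper bound of all of them, and at least 1. *)
Definition dmax (d : list R) : R := 1 + Rsum (fun x => x) d.

Section Digits.
Variables (beta : R) (d : list R).
Hypothesis Hbeta : 1 < beta.
Hypothesis Hd0 : forall delta, In delta d -> 0 <= delta.
Hypothesis Hin : In 0 d.
Hypothesis Hlen : (2 <= length d)%nat.

Lemma Hq_pos : 0 < INR (length d).
Proof. apply lt_0_INR. lia. Qed.

Lemma d_nonnil : d <> nil.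
Proof. intros E. rewrite E in Hin. easy. Qed.

Lemma dmax_ge (x : R) : In x d -> x <= dmax d - 1.
Proof.
unfold dmax. clear - Hd0. induction d as [|y l IH]; [easy|].
assert (P : 0 <= Rsum (fun x => x) l).
{ rewrite <- (Rsum_0 l). apply Rsum_le. intros z Hz. apply Hd0. now right. }
rewrite Rsum_cons. intros [->|Hx]; [lra|].
assert (0 <= y) by (apply Hd0; now left).
specialize (IH (fun z Hz => Hd0 z (or_intror Hz)) Hx). lra.
Qed.

Lemma dmax_ge_1 : 1 <= dmax d.
Proof. pose proof (dmax_ge 0 Hin). lra. Qed.

Lemma Dsum_coef_bound (j : nat) : Rabs (Dsum_coef d j) <= INR (length d) * dmax d ^ j.
Proof.
unfold Dsum_coef. eapply Rle_trans; [apply Rabs_Rsum|].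
rewrite <- Rsum_const. apply Rsum_le. intros x Hx.
unfold Rdiv. rewrite Rabs_mult, <- RPow_abs, Rabs_Ropp, Rabs_pos_eq by now apply Hd0.
assert (F : 1 <= INR (fact j)) by (change 1 with (INR 1); apply le_INR; pose proof (lt_O_fact j); lia).
assert (F' : Rabs (/ INR (fact j)) <= 1).
{ rewrite Rabs_pos_eq by (left; apply Rinv_0_lt_compat; lra). rewrite <- Rinv_1. apply Rinv_le_contravar; lra. }
rewrite <- (Rmult_1_r (dmax d ^ j)). apply Rmult_le_compat; try easy.
- apply pow_le. now apply Hd0.
- apply Rabs_pos.
- apply pow_incr. split; [now apply Hd0|]. pose proof (dmax_ge x Hx). lra.
Qed.

Lemma Dsum_coef_derive_bound (j : nat) :
  Rabs (PS_derive (Dsum_coef d) j) <= INR (length d) * dmax d ^ S j.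
Proof.
unfold PS_derive, Dsum_coef. rewrite <- Rsum_scal. eapply Rle_trans; [apply Rabs_Rsum|].
rewrite <- Rsum_const. apply Rsum_le. intros x Hx.
replace (INR (S j) * ((- x) ^ S j / INR (fact (S j)))) with ((- x) ^ S j * / INR (fact j)).
2:{ change (fact (S j)) with (S j * fact j)%nat. rewrite mult_INR. field.
    split; [apply INR_fact_neq_0|now apply not_0_INR]. }
rewrite Rabs_mult, <- RPow_abs, Rabs_Ropp, Rabs_pos_eq by now apply Hd0.
assert (F : 1 <= INR (fact j)) by (change 1 with (INR 1); apply le_INR; pose proof (lt_O_fact j); lia).
assert (F' : Rabs (/ INR (fact j)) <= 1).
{ rewrite Rabs_pos_eq by (left; apply Rinv_0_lt_compat; lra). rewrite <- Rinv_1. apply Rinv_le_contravar; lra. }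
rewrite <- (Rmult_1_r (dmax d ^ S j)). apply Rmult_le_compat; try easy.
- apply pow_le. now apply Hd0.
- apply Rabs_pos.
- apply pow_incr. split; [now apply Hd0|]. pose proof (dmax_ge x Hx). lra.
Qed.

(* Coefficients of the logarithmic derivative of [Dsum d]. *)
Definition Dlog_coef : nat -> R := ps_div (Dsum_coef d) (PS_derive (Dsum_coef d)).

Lemma Dlog_coef_mult (n : nat) : PS_derive (Dsum_coef d) n = PS_mult Dlog_coef (Dsum_coef d) n.
Proof.
symmetry. apply ps_div_mult. rewrite Dsum_coef_0. pose proof Hq_pos. lra.
Qed.

(** Strong induction on [ps_div_eq]. With [M = dmax d] the numerator is at most [|d| M^(n+1) (1 +
    sum_(j<n) 2^j) = |d| M^(n+1) 2^n]; the factor 2 in the ratio is what closes this sum. *)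
Lemma Dlog_coef_bound (n : nat) : Rabs (Dlog_coef n) <= dmax d * (2 * dmax d) ^ n.
Proof.
assert (M1 := dmax_ge_1). assert (Q := Hq_pos).
induction n as [n IH] using lt_wf_ind.
unfold Dlog_coef. rewrite ps_div_eq. fold Dlog_coef. rewrite Dsum_coef_0.
unfold Rdiv. rewrite Rabs_mult, (Rabs_pos_eq (/ _)) by (left; now apply Rinv_0_lt_compat).
apply (Rmult_le_reg_r (INR (length d))); [easy|]. rewrite Rmult_assoc, Rinv_l, Rmult_1_r by lra.
eapply Rle_trans; [apply Rabs_triang|]. rewrite Rabs_Ropp.
apply Rle_trans with (INR (length d) * dmax d ^ S n +
  INR (length d) * (dmax d ^ n * (dmax d * Rsum (fun j => 2 ^ j) (seq 0 n)))).
- apply Rplus_le_compat; [apply Dsum_coef_derive_bound|].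
  eapply Rle_trans; [apply Rabs_Rsum|]. rewrite <- !Rsum_scal. apply Rsum_le.
  intros j Hj. apply in_seq in Hj. rewrite Rabs_mult.
  replace (INR (length d) * (dmax d ^ n * (dmax d * 2 ^ j)))
    with (dmax d * (2 * dmax d) ^ j * (INR (length d) * dmax d ^ (n - j))).
  + apply Rmult_le_compat; try apply Rabs_pos; [apply IH; lia|apply Dsum_coef_bound].
  + rewrite Rpow_mult_distr. replace n with (j + (n - j))%nat at 2 by lia. rewrite pow_add. ring.
- assert (G : Rsum (fun j => 2 ^ j) (seq 0 n) = 2 ^ n - 1).
  { clear IH. induction n as [|n IHn]; [unfold Rsum; simpl; ring|].
    rewrite Rsum_seq_S, IHn. simpl. ring. }
  rewrite G, Rpow_mult_distr. right. simpl. ring.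
Qed.

Lemma CV_radius_Dlog (t : R) : Rabs t * (2 * dmax d) < 1 -> Rbar_lt (Rabs t) (CV_radius Dlog_coef).
Proof.
pose proof dmax_ge_1. apply CV_radius_gt with (dmax d); [lra|]. apply Dlog_coef_bound.
Qed.

(** With [D = Dsum d] the identity [D' = (D' / D) D] of power series is an instance of
    [u' = v u]. *)
Lemma Dsum_exp (t : R) : Rabs t * (2 * dmax d) < 1 ->
  Dsum d t = INR (length d) * exp (PSeries (PS_Int Dlog_coef) t).
Proof.
intros Ht. rewrite <- PSeries_Dsum, <- Dsum_coef_0. apply PSeries_ode.
- intros n. apply Dlog_coef_mult.
- apply CV_radius_Dsum_coef.
- now apply CV_radius_Dlog.
Qed.

Lemma locally_0_Rabs (r : R) (P : R -> Prop) : 0 < r -> (forall t, Rabs t < r -> P t) -> locally 0 P.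
Proof.
intros Hr H. exists (mkposreal r Hr). intros y Hy. apply H.
unfold ball in Hy; simpl in Hy. unfold AbsRing_ball, abs, minus, plus, opp in Hy; simpl in Hy.
now replace y with (y + - 0) by ring.
Qed.

Lemma maclaurin_coef_PSeries (f : R -> R) (a : nat -> R) (h : nat) :
  Rbar_lt 0 (CV_radius a) -> locally 0 (fun t => f t = PSeries a t) -> maclaurin_coef f h = a h.
Proof.
intros Ha Hl. unfold maclaurin_coef. rewrite (Derive_n_ext_loc f (PSeries a)) by exact Hl.
rewrite Derive_n_coef by exact Ha. field. apply INR_fact_neq_0.
Qed.

Lemma Dlog_coef_radius_pos : 0 < / (2 * dmax d).
Proof. pose proof dmax_ge_1. apply Rinv_0_lt_compat. lra. Qed.

Lemma Rabs_lt_radius (t : R) : Rabs t < / (2 * dmax d) -> Rabs t * (2 * dmax d) < 1.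
Proof.
intros Ht. pose proof dmax_ge_1. apply (Rmult_lt_compat_r (2 * dmax d)) in Ht; [|lra].
rewrite Rinv_l in Ht; lra.
Qed.

Lemma CV_radius_Dlog_0 : Rbar_lt 0 (CV_radius Dlog_coef).
Proof. rewrite <- Rabs_R0. apply CV_radius_Dlog. rewrite Rabs_R0. lra. Qed.

(** Near 0, [Ld d] is [ln |d|] plus the primitive of the logarithmic derivative. *)
Lemma maclaurin_Ld (h : nat) : maclaurin_coef (Ld d) (S h) = Dlog_coef h / INR (S h).
Proof.
set (a := fun n => match n with O => ln (INR (length d)) | S k => Dlog_coef k / INR (S k) end).
assert (E : forall n, a n = PS_plus (fun n => if Nat.eqb n 0 then ln (INR (length d)) else 0) (PS_Int Dlog_coef) n).
{ intros [|n]; unfold PS_plus, plus; simpl; ring. }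
assert (C0 : forall t, is_pseries (fun n => if Nat.eqb n 0 then ln (INR (length d)) else 0) t (ln (INR (length d)))).
{ intros t. apply is_pseries_R. apply is_series_decr_1.
  match goal with |- is_series _ ?l => replace l with 0 by (unfold plus, opp; simpl; ring) end.
  apply is_series_ext with (a := fun _ => 0); [|apply is_series_zero].
  intros n; simpl. symmetry. apply Rmult_0_l. }
rewrite (maclaurin_coef_PSeries (Ld d) a); [reflexivity| |].
- rewrite (CV_radius_ext _ _ E).
  eapply Rbar_lt_le_trans; [|apply CV_radius_plus].
  apply Rbar_min_case.
  + apply Rbar_lt_le_trans with (Rabs 1); [simpl; rewrite Rabs_R1; lra|].
    apply CV_radius_ge_ex_series. eexists. apply is_pseries_R. apply C0.
  + rewrite CV_radius_Int. apply CV_radius_Dlog_0.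
- apply (locally_0_Rabs _ _ Dlog_coef_radius_pos). intros t Ht. apply Rabs_lt_radius in Ht.
  rewrite (PSeries_ext _ _ _ E), PSeries_plus.
  + rewrite (is_pseries_unique _ _ _ (C0 t)). unfold Ld.
    change (Rsum (fun delta => exp (- delta * t)) d) with (Dsum d t). rewrite Dsum_exp by easy.
    rewrite ln_mult, ln_exp; [easy|apply Hq_pos|apply exp_pos].
  + eexists; apply C0.
  + apply CV_radius_inside. rewrite CV_radius_Int. now apply CV_radius_Dlog.
Qed.

(* Coefficients of the logarithmic derivative of the product of the [|d| / Dsum (t / beta^k)]. *)
Definition prodlog_coef (i : nat) : R := Dlog_coef i / (1 - beta ^ S i).

Lemma beta_pow_gap (i : nat) : beta - 1 <= beta ^ S i - 1.
Proof. assert (H := pow_R1_Rle beta i ltac:(lra)). simpl. nra. Qed.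

Lemma prodlog_coef_bound (i : nat) :
  Rabs (prodlog_coef i) <= dmax d / (beta - 1) * (2 * dmax d) ^ i.
Proof.
unfold prodlog_coef, Rdiv. rewrite Rabs_mult, Rabs_inv.
assert (G := beta_pow_gap i).
rewrite (Rabs_left (1 - beta ^ S i)) by lra.
replace (dmax d * / (beta - 1) * (2 * dmax d) ^ i) with (dmax d * (2 * dmax d) ^ i * / (beta - 1)) by ring.
apply Rmult_le_compat.
- apply Rabs_pos.
- left. apply Rinv_0_lt_compat. lra.
- apply Dlog_coef_bound.
- apply Rinv_le_contravar; lra.
Qed.

Lemma ccoef_rec (m : nat) : PS_derive (ccoef beta d) m = PS_mult prodlog_coef (ccoef beta d) m.
Proof.
change (ccoef beta d) with (tuple_coef (fun h => maclaurin_coef (Ld d) h / (1 - beta ^ h))).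
rewrite tuple_coef_rec. unfold PS_mult. apply sum_eq. intros i Hi. f_equal.
rewrite maclaurin_Ld. unfold prodlog_coef. field.
split; [|now apply not_0_INR]. pose proof (beta_pow_gap i). lra.
Qed.

Lemma ccoef_0 : ccoef beta d 0 = 1.
Proof. exact (tuple_coef_0 (fun h => maclaurin_coef (Ld d) h / (1 - beta ^ h))). Qed.

(** The reciprocal of [K + r] in [ode_coef_bound], with the constants of [prodlog_coef_bound]. *)
Definition crad : R := / (dmax d / (beta - 1) + 2 * dmax d).

Lemma crad_aux : 0 < dmax d / (beta - 1).
Proof. pose proof dmax_ge_1. apply Rdiv_lt_0_compat; lra. Qed.

Lemma crad_pos : 0 < crad.
Proof. pose proof dmax_ge_1. pose proof crad_aux. apply Rinv_0_lt_compat. lra. Qed.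

Lemma crad_lt (t : R) : Rabs t < crad ->
  Rabs t * (dmax d / (beta - 1) + 2 * dmax d) < 1 /\ Rabs t * (2 * dmax d) < 1.
Proof.
intros Ht. pose proof dmax_ge_1. pose proof crad_aux. pose proof (Rabs_pos t).
assert (E : Rabs t * (dmax d / (beta - 1) + 2 * dmax d) < 1).
{ apply (Rmult_lt_compat_r (dmax d / (beta - 1) + 2 * dmax d)) in Ht; [|lra].
  unfold crad in Ht. rewrite Rinv_l in Ht; lra. }
split; [exact E|]. nra.
Qed.

Lemma CV_radius_prodlog (t : R) : Rabs t * (2 * dmax d) < 1 -> Rbar_lt (Rabs t) (CV_radius prodlog_coef).
Proof.
pose proof dmax_ge_1. apply CV_radius_gt with (dmax d / (beta - 1)); [lra|]. apply prodlog_coef_bound.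
Qed.

Lemma CV_radius_ccoef_crad (t : R) : Rabs t < crad -> Rbar_lt (Rabs t) (CV_radius (ccoef beta d)).
Proof.
intros Ht. apply crad_lt in Ht. pose proof dmax_ge_1. pose proof crad_aux.
apply CV_radius_gt with (M := Rabs (ccoef beta d 0)) (r := dmax d / (beta - 1) + 2 * dmax d); [lra| |easy].
apply ode_coef_bound with prodlog_coef; [lra|lra|apply ccoef_rec|apply prodlog_coef_bound].
Qed.

Lemma PSeries_ccoef_exp (t : R) : Rabs t < crad ->
  PSeries (ccoef beta d) t = exp (PSeries (PS_Int prodlog_coef) t).
Proof.
intros Ht. rewrite (PSeries_ode _ prodlog_coef), ccoef_0.
- ring.
- apply ccoef_rec.
- now apply CV_radius_ccoef_crad.
- apply CV_radius_prodlog. now apply crad_lt.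
Qed.

(** * The functional equation of the product and its Maclaurin series *)

Lemma PSeries_scale (a : nat -> R) (t : R) :
  PSeries (fun n => beta ^ n * a n) t = PSeries a (beta * t).
Proof. apply Series_ext. intros n. rewrite Rpow_mult_distr. ring. Qed.

Lemma Rabs_beta_mult (t : R) : Rabs (beta * t) = beta * Rabs t.
Proof. rewrite Rabs_mult, (Rabs_pos_eq beta); lra. Qed.

(** With [l_h = [y^h] L_d] and [x_h = l_h / (1 - beta^h)] one has [beta^h x_h + l_h = x_h]. This is
    the equation between the logarithms, and the reason for the divisor [1 - beta^h]. *)
Lemma functional_eq_near_0 (t : R) : Rabs (beta * t) < crad ->
  PSeries (ccoef beta d) (beta * t) * Dsum d t = INR (length d) * PSeries (ccoef beta d) t.
Proof.
intros Ht. assert (Ht' : Rabs t < crad).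
{ rewrite Rabs_beta_mult in Ht. pose proof (Rabs_pos t). nra. }
rewrite !PSeries_ccoef_exp by easy.
destruct (crad_lt _ Ht) as [_ A1]. destruct (crad_lt _ Ht') as [_ A2].
rewrite Dsum_exp by easy.
replace (exp (PSeries (PS_Int prodlog_coef) (beta * t)) *
  (INR (length d) * exp (PSeries (PS_Int Dlog_coef) t))) with
  (INR (length d) * (exp (PSeries (PS_Int prodlog_coef) (beta * t)) * exp (PSeries (PS_Int Dlog_coef) t)))
  by ring.
rewrite <- exp_plus. do 2 f_equal.
rewrite <- (PSeries_scale (PS_Int prodlog_coef)).
rewrite <- PSeries_plus.
- apply PSeries_ext. intros [|n]; unfold PS_plus, plus; simpl.
  + ring.
  + change (match n with 0%nat => 1 | S _ => INR n + 1 end) with (INR (S n)).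
    unfold prodlog_coef. change (beta * beta ^ n) with (beta ^ S n). field.
    pose proof (beta_pow_gap n). split; [lra|now apply not_0_INR].
- apply ex_pseries_R. apply (ex_series_ext (fun n => PS_Int prodlog_coef n * (beta * t) ^ n)).
  + intros n. rewrite Rpow_mult_distr. ring_R.
  + apply ex_pseries_R. apply CV_radius_inside. rewrite CV_radius_Int. now apply CV_radius_prodlog.
- apply CV_radius_inside. rewrite CV_radius_Int. now apply CV_radius_Dlog.
Qed.

Lemma Rprod_app {T : Type} (f : T -> R) (l1 l2 : list T) : Rprod f (l1 ++ l2) = Rprod f l1 * Rprod f l2.
Proof.
unfold Rprod. induction l1 as [|x l IH]; simpl; [ring|]. rewrite IH. ring.
Qed.

Lemma Rprod_seq_S (f : nat -> R) (a n : nat) : Rprod f (seq a (S n)) = Rprod f (seq a n) * f (a + n)%nat.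
Proof. rewrite seq_S, Rprod_app. unfold Rprod at 2. simpl. ring. Qed.

Definition prod_factor (t : R) (k : nat) : R :=
  INR (length d) / Rsum (fun delta => exp (- delta * / beta ^ k * t)) d.

Lemma prod_factor_Dsum (t : R) (k : nat) : prod_factor t k = INR (length d) / Dsum d (t / beta ^ k).
Proof.
unfold prod_factor, Dsum. f_equal. apply Rsum_ext. intros x _. f_equal. unfold Rdiv. ring.
Qed.

(** The radius [s] on which the functional equation is known is a parameter, since the lemma serves
    first for [crad] and then for [sigma]. *)
Lemma prod_telescope (s t : R) (n : nat) :
  (forall u, Rabs (beta * u) < s ->
    PSeries (ccoef beta d) (beta * u) * Dsum d u = INR (length d) * PSeries (ccoef beta d) u) ->
  Rabs t < s ->
  PSeries (ccoef beta d) t =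
    PSeries (ccoef beta d) (t / beta ^ n) * Rprod (prod_factor t) (seq 1 n).
Proof.
intros H Ht. induction n as [|n IH].
- unfold Rprod; simpl fold_right; rewrite Rmult_1_r. f_equal. simpl. field.
- rewrite IH, Rprod_seq_S, prod_factor_Dsum.
  assert (Hp : 0 < beta ^ n) by (apply pow_lt; lra).
  assert (H1 := pow_R1_Rle beta n ltac:(lra)).
  assert (E : t / beta ^ n = beta * (t / beta ^ S n)) by (simpl; field; lra).
  assert (D0 := Dsum_pos d (t / beta ^ S n) d_nonnil).
  replace (1 + n)%nat with (S n) by lia.
  assert (K : Rabs (beta * (t / beta ^ S n)) < s).
  { rewrite <- E. unfold Rdiv. rewrite Rabs_mult, Rabs_inv, (Rabs_pos_eq (beta ^ n)) by lra.
    apply Rle_lt_trans with (Rabs t * 1); [|lra]. apply Rmult_le_compat_l; [apply Rabs_pos|].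
    rewrite <- Rinv_1. apply Rinv_le_contravar; lra. }
  specialize (H _ K). rewrite E.
  replace (PSeries (ccoef beta d) (beta * (t / beta ^ S n))) with
    (INR (length d) * PSeries (ccoef beta d) (t / beta ^ S n) / Dsum d (t / beta ^ S n))
    by (rewrite <- H; field; lra).
  field. lra.
Qed.

Lemma is_lim_div_pow (t : R) : is_lim_seq (fun n => t / beta ^ n) 0.
Proof.
replace (Finite 0) with (Rbar_mult t 0) by (simpl; f_equal; ring).
apply (is_lim_seq_scal_l (fun n => / beta ^ n)).
apply is_lim_seq_ext with (u := fun n => (/ beta) ^ n).
- intros n. apply pow_inv.
- apply is_lim_seq_geom. rewrite Rabs_pos_eq.
  + rewrite <- Rinv_1. apply Rinv_lt_contravar; lra.
  + left; apply Rinv_0_lt_compat; lra.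
Qed.

Lemma CV_radius_ccoef_pos : Rbar_lt 0 (CV_radius (ccoef beta d)).
Proof. rewrite <- Rabs_R0. apply CV_radius_ccoef_crad. rewrite Rabs_R0. apply crad_pos. Qed.

(** In [prod_telescope] the argument [t / beta^n] tends to 0, where the series has the value
    [c(0) = 1], so the finite products converge to the series at [t]. *)
Lemma is_lim_prod (s t : R) :
  (forall u, Rabs (beta * u) < s ->
    PSeries (ccoef beta d) (beta * u) * Dsum d u = INR (length d) * PSeries (ccoef beta d) u) ->
  Rabs t < s ->
  is_lim_seq (fun n => Rprod (prod_factor t) (seq 1 n)) (PSeries (ccoef beta d) t).
Proof.
intros H Ht.
assert (L : is_lim_seq (fun n => PSeries (ccoef beta d) (t / beta ^ n)) 1).
{ rewrite <- ccoef_0. rewrite <- (PSeries_0 (ccoef beta d)).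
  apply (is_lim_seq_continuous (PSeries (ccoef beta d))).
  - apply (PSeries_continuity (ccoef beta d) 0). rewrite Rabs_R0. apply CV_radius_ccoef_pos.
  - apply is_lim_div_pow. }
assert (L' := is_lim_seq_inv _ _ L ltac:(intros E; injection E; lra)).
apply (is_lim_seq_scal_l _ (PSeries (ccoef beta d) t)) in L'.
simpl in L'. rewrite Rinv_1, Rmult_1_r in L'.
apply is_lim_seq_spec in L.
(* For large [n] the factor that tends to 1 is nonzero and can be divided out. *)
destruct (L (mkposreal (1/2) ltac:(lra))) as [N HN]. simpl in HN.
eapply is_lim_seq_ext_loc; [|exact L'].
exists N. intros n Hn. specialize (HN n Hn). apply Rabs_def2 in HN.
rewrite (prod_telescope s t n H Ht). field. lra.
Qed.

Lemma prod_fun_near_0 (t : R) : Rabs t < crad -> prod_fun beta d t = PSeries (ccoef beta d) t.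
Proof.
intros Ht. unfold prod_fun.
change (fun k => INR (length d) / Rsum (fun delta => exp (- delta * / beta ^ k * t)) d) with (prod_factor t).
now rewrite (is_lim_seq_unique _ _ (is_lim_prod crad t functional_eq_near_0 Ht)).
Qed.

(** This translates the convergence assumption on [sigma] into one on the coefficients [ccoef]. *)
Lemma maclaurin_prod_fun (h : nat) : maclaurin_coef (prod_fun beta d) h = ccoef beta d h.
Proof.
apply maclaurin_coef_PSeries; [apply CV_radius_ccoef_pos|].
apply (locally_0_Rabs crad); [apply crad_pos|apply prod_fun_near_0].
Qed.

Lemma CV_radius_ccoef_sigma (sigma t : R) : is_sigma beta d sigma -> Rabs t < sigma ->
  Rbar_lt (Rabs t) (CV_radius (ccoef beta d)).
Proof.
intros [Hs H] Ht. pose proof (Rabs_pos t).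
(* Convergence at a point bounds the radius of convergence only non-strictly; the midpoint of [|t|]
   and [sigma] gives the strict inequality. *)
apply Rbar_lt_le_trans with (Rabs ((Rabs t + sigma) / 2)).
- simpl. rewrite (Rabs_pos_eq ((Rabs t + sigma) / 2)); lra.
- apply CV_radius_ge_ex_series.
  apply (ex_series_ext (fun h => maclaurin_coef (prod_fun beta d) h * ((Rabs t + sigma) / 2) ^ h)).
  + intros n. now rewrite maclaurin_prod_fun.
  + apply ex_series_Rabs. apply H. rewrite Rabs_pos_eq; lra.
Qed.

(** Power series that agree near 0 have equal coefficients. In this form the functional equation is
    no longer tied to the small radius [crad]. *)
Lemma functional_eq_coef (n : nat) :
  PS_mult (fun n => beta ^ n * ccoef beta d n) (Dsum_coef d) n = PS_scal (INR (length d)) (ccoef beta d) n.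
Proof.
assert (Hc : 0 < crad / beta) by (apply Rdiv_lt_0_compat; [apply crad_pos|lra]).
assert (CR : forall t, Rabs t < crad / beta -> Rbar_lt (Rabs t) (CV_radius (fun n => beta ^ n * ccoef beta d n))).
{ intros t Ht. pose proof (Rabs_pos t).
  assert (K : Rabs ((Rabs t + crad / beta) / 2) < crad / beta) by (rewrite Rabs_pos_eq; lra).
  apply Rbar_lt_le_trans with (Rabs ((Rabs t + crad / beta) / 2)).
  - simpl. rewrite (Rabs_pos_eq ((Rabs t + crad / beta) / 2)); lra.
  - apply CV_radius_ge_ex_series.
    apply (ex_series_ext (fun n => ccoef beta d n * (beta * ((Rabs t + crad / beta) / 2)) ^ n)).
    + intros n0. rewrite Rpow_mult_distr. ring_R.
    + apply ex_pseries_R. apply CV_radius_inside. apply CV_radius_ccoef_crad.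
      rewrite Rabs_beta_mult. apply (Rmult_lt_compat_l beta) in K; [|lra].
      replace (beta * (crad / beta)) with crad in K by (field; lra). exact K. }
assert (P : forall t, Rabs t < crad / beta ->
  PSeries (PS_mult (fun n => beta ^ n * ccoef beta d n) (Dsum_coef d)) t =
  PSeries (PS_scal (INR (length d)) (ccoef beta d)) t).
{ intros t Ht. rewrite PSeries_mult, PSeries_scale, PSeries_Dsum, PSeries_scal.
  - apply functional_eq_near_0. rewrite Rabs_beta_mult. apply (Rmult_lt_compat_l beta) in Ht; [|lra].
    replace (beta * (crad / beta)) with crad in Ht by (field; lra). exact Ht.
  - now apply CR.
  - apply CV_radius_Dsum_coef. }
apply PSeries_ext_recip.
- apply Rbar_lt_le_trans with (Rabs (crad / beta / 2)).
  + simpl. rewrite Rabs_pos_eq; lra.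
  + apply CV_radius_ge_ex_series. apply ex_pseries_R. apply ex_pseries_mult.
    * apply CR. rewrite Rabs_pos_eq; lra.
    * apply CV_radius_Dsum_coef.
- rewrite CV_radius_scal; [apply CV_radius_ccoef_pos|]. pose proof Hq_pos. lra.
- now apply (locally_0_Rabs (crad / beta)).
Qed.

Lemma functional_eq_sigma (sigma t : R) : is_sigma beta d sigma -> Rabs (beta * t) < sigma ->
  PSeries (ccoef beta d) (beta * t) * Dsum d t = INR (length d) * PSeries (ccoef beta d) t.
Proof.
intros Hs Ht. assert (S0 := proj1 Hs). pose proof (Rabs_pos t).
rewrite <- PSeries_scale, <- PSeries_Dsum, <- PSeries_mult.
- rewrite (PSeries_ext _ _ _ functional_eq_coef). apply PSeries_scal.
- rewrite Rabs_beta_mult in Ht.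
  set (m := (beta * Rabs t + sigma) / 2).
  apply Rbar_lt_le_trans with (Rabs (m / beta)).
  + simpl. unfold m. rewrite (Rabs_pos_eq (_ / beta)).
    * apply Rlt_div_r; nra.
    * apply Rdiv_le_0_compat; nra.
  + apply CV_radius_ge_ex_series.
    apply (ex_series_ext (fun n => ccoef beta d n * m ^ n)).
    * intros n. unfold Rdiv. rewrite Rpow_mult_distr, pow_inv. match goal with |- ?a = ?b => change (@eq R a b) end; field.
      apply pow_nonzero. lra.
    * apply ex_pseries_R. apply CV_radius_inside. apply (CV_radius_ccoef_sigma sigma); [easy|].
      unfold m. rewrite Rabs_pos_eq; nra.
- apply CV_radius_Dsum_coef.
Qed.

Lemma is_lim_prod_sigma (sigma t : R) : is_sigma beta d sigma -> Rabs t < sigma ->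
  is_lim_seq (fun n => Rprod (prod_factor t) (seq 1 n)) (PSeries (ccoef beta d) t).
Proof.
intros Hs. apply is_lim_prod. intros u. now apply functional_eq_sigma.
Qed.

End Digits.

(** * The periodic factor *)

Lemma Rsum_Permutation {T : Type} (f : T -> R) (l l' : list T) : Permutation l l' -> Rsum f l = Rsum f l'.
Proof.
intros H. induction H; rewrite ?Rsum_cons; try lra.
Qed.

(** Locally uniform approximation preserves continuity; the approximant may depend on [eps], so no
    sequence has to be fixed. *)
Lemma continuous_uniform_approx (f : R -> R) (t : R) :
  (forall eps, 0 < eps -> exists g : R -> R, continuous g t /\ locally t (fun x => Rabs (f x - g x) <= eps)) ->
  continuous f t.
Proof.
intros H. apply filterlim_locally. intros eps.
destruct (H (eps / 4)) as [g [Cg Lg]]; [pose proof (cond_pos eps); lra|].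
assert (He : 0 < eps / 4) by (pose proof (cond_pos eps); lra).
apply filterlim_locally with (eps := mkposreal _ He) in Cg.
assert (L0 := locally_singleton _ _ Lg). simpl in L0.
generalize (filter_and _ _ Cg Lg). apply filter_imp. intros x [A B].
unfold ball in *; simpl in *. unfold AbsRing_ball, abs, minus, plus, opp in *; simpl in *.
replace (f x + - f t) with ((f x - g x) + (g x + - g t) + - (f t - g t)) by ring.
eapply Rle_lt_trans; [apply Rabs_triang|]. rewrite Rabs_Ropp.
eapply Rle_lt_trans; [apply Rplus_le_compat_r, Rabs_triang|]. lra.
Qed.

Lemma continuous_ln (t : R) : 0 < t -> continuous ln t.
Proof.
intros Ht. apply (ex_derive_continuous (K := R_AbsRing) (V := R_NormedModule)). now auto_derive.
Qed.

Lemma continuous_Dsum (d : list R) (c t : R) : continuous (fun t => Dsum d (c * t)) t.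
Proof.
unfold Dsum. induction d as [|x d IH].
- apply continuous_ext with (f := fun _ => 0); [intros; reflexivity|apply continuous_const].
- apply continuous_ext with (f := fun t => exp (- x * (c * t)) + Rsum (fun delta => exp (- delta * (c * t))) d);
    [intros; reflexivity|].
  apply continuous_Rplus; [|exact IH].
  apply (ex_derive_continuous (K := R_AbsRing) (V := R_NormedModule)). now auto_derive.
Qed.

(** Up to a shift and a factor [x] these are the terms of the differentiated geometric series. *)
Lemma is_lim_seq_n_pow (x : R) : 0 <= x < 1 -> is_lim_seq (fun n => INR n * x ^ n) 0.
Proof.
intros Hx. apply is_lim_seq_incr_1.
assert (C1 : Rbar_lt (Rabs x) (CV_radius (fun _ => 1))).
{ apply CV_radius_gt with (M := 1) (r := 1); [lra| |rewrite Rabs_pos_eq; lra].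
  intros n. rewrite pow1, Rabs_R1. lra. }
assert (E := ex_pseries_derive _ _ C1). apply ex_pseries_R, ex_series_lim_0 in E.
apply (is_lim_seq_scal_r _ x) in E. simpl in E. rewrite Rmult_0_l in E.
revert E. apply is_lim_seq_ext. intros n. unfold PS_derive. change (x ^ S n) with (x * x ^ n).
change (INR (S n) * 1 * x ^ n * x = INR (S n) * (x * x ^ n)). ring.
Qed.

Section Products.
Variables (beta : R) (d : list R).
Hypothesis Hbeta : 1 < beta.
Hypothesis Hnd : NoDup d.
Hypothesis Hd0 : forall delta, In delta d -> 0 <= delta.
Hypothesis Hin : In 0 d.
Hypothesis Hlen : (2 <= length d)%nat.

Notation q := (INR (length d)).
Notation L := (Lexp beta d).

Let Hq : 0 < q := Hq_pos d Hlen.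
Let Hnil : d <> nil := d_nonnil d Hin.

(** Without repetitions 0 occurs only once, so all other digits are positive; this is what makes
    [Ld d] decay at infinity. *)
Lemma digits_split : exists d', Permutation d (0 :: d') /\ forall x, In x d' -> 0 < x.
Proof.
destruct (in_split _ _ Hin) as [l1 [l2 E]]. exists (l1 ++ l2).
assert (P : Permutation d (0 :: l1 ++ l2)) by (rewrite E; symmetry; apply Permutation_middle).
split; [exact P|]. intros x Hx.
assert (Hx' : In x d) by (eapply Permutation_in; [symmetry; exact P|now right]).
destruct (Hd0 x Hx') as [H|<-]; [exact H|]. exfalso.
assert (N : NoDup (0 :: l1 ++ l2)) by (eapply Permutation_NoDup; [exact P|exact Hnd]).
inversion N. contradiction.
Qed.

Lemma Ld_Dsum (y : R) : Ld d y = ln (Dsum d y).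
Proof. reflexivity. Qed.

Lemma exp_Ld (y : R) : exp (Ld d y) = Dsum d y.
Proof. rewrite Ld_Dsum. apply exp_ln. now apply Dsum_pos. Qed.

Lemma Ld_nonneg (y : R) : 0 <= Ld d y.
Proof.
destruct digits_split as [d' [P _]]. rewrite Ld_Dsum. rewrite <- ln_1. apply ln_le; [lra|].
unfold Dsum. rewrite (Rsum_Permutation _ _ _ P), Rsum_cons, Ropp_0, Rmult_0_l, exp_0.
assert (0 <= Rsum (fun delta => exp (- delta * y)) d'); [|lra].
rewrite <- (Rsum_0 d'). apply Rsum_le. intros; left; apply exp_pos.
Qed.

(** [ln D <= D - 1], and [D - 1] is a sum of exponentials with positive rates. *)
Lemma Ld_decay (eta : R) : 0 < eta -> exists K, 0 < K /\ forall y, 0 < y -> Ld d y <= K * Rpower y (- eta).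
Proof.
intros He. destruct (exp_neg_le_Rpower eta He) as [K [HK H]].
destruct digits_split as [d' [P Hd']].
exists (1 + Rsum (fun x => K * Rpower x (- eta)) d').
assert (P0 : 0 <= Rsum (fun x => K * Rpower x (- eta)) d').
{ rewrite <- (Rsum_0 d'). apply Rsum_le. intros x _. apply Rmult_le_pos; [lra|left; apply exp_pos]. }
split; [lra|]. intros y Hy. rewrite Ld_Dsum.
eapply Rle_trans; [apply ln_le_sub1; now apply Dsum_pos|].
unfold Dsum. rewrite (Rsum_Permutation _ _ _ P), Rsum_cons, Ropp_0, Rmult_0_l, exp_0.
assert (A : Rsum (fun delta => exp (- delta * y)) d' <= Rsum (fun x => K * Rpower x (- eta)) d' * Rpower y (- eta)).
{ rewrite Rmult_comm, <- Rsum_scal. apply Rsum_le. intros x Hx. specialize (Hd' x Hx).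
  replace (- x * y) with (- (x * y)) by ring. eapply Rle_trans; [apply H; nra|].
  rewrite <- Rpower_mult_distr by easy. lra. }
assert (B : 0 <= Rpower y (- eta)) by (left; apply exp_pos). nra.
Qed.

Lemma Ld_le_lnq (y : R) : 0 <= y -> Ld d y <= ln q.
Proof.
intros Hy. rewrite Ld_Dsum. apply ln_le; [now apply Dsum_pos|].
rewrite <- Dsum_0. apply Rsum_le. intros x Hx. specialize (Hd0 x Hx).
rewrite Rmult_0_r. assert (K : - x * y <= 0) by nra.
destruct K as [K|K]; [left; now apply exp_increasing|rewrite K; lra].
Qed.

Lemma Ld_near_0 (y : R) : 0 <= y -> ln q - Ld d y <= dmax d * y.
Proof.
intros Hy. assert (H : ln (q * exp (- (dmax d * y))) <= Ld d y).
{ rewrite Ld_Dsum. apply ln_le; [apply Rmult_lt_0_compat; [exact Hq|apply exp_pos]|].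
  unfold Dsum. rewrite <- Rsum_const. apply Rsum_le. intros x Hx.
  assert (K : - (dmax d * y) <= - x * y) by (pose proof (dmax_ge d Hd0 x Hx); nra).
  destruct K as [K|K]; [left; now apply exp_increasing|rewrite K; lra]. }
rewrite ln_mult, ln_exp in H by (easy || apply exp_pos). lra.
Qed.

(** [Usum] is [log F] and [Vsum] is [log Phi]. *)
Definition Usum (t : R) : R := Series (fun k => Ld d (beta ^ k * t)).
Definition Vsum (t : R) : R := Series (fun k => ln q - Ld d (t / beta ^ S k)).

Lemma Rpower_pow_mult (k : nat) (t eta : R) : 0 < t ->
  Rpower (beta ^ k * t) (- eta) = (Rpower beta (- eta)) ^ k * Rpower t (- eta).
Proof.
intros Ht. assert (0 < beta ^ k) by (apply pow_lt; lra).
rewrite <- Rpower_mult_distr by easy. f_equal.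
assert (0 < beta) by lra.
rewrite <- !Rpower_pow by (easy || apply exp_pos). rewrite !Rpower_mult. f_equal. ring.
Qed.

Lemma Rpower_beta_lt_1 (eta : R) : 0 < eta -> 0 < Rpower beta (- eta) < 1.
Proof.
intros He. split; [apply exp_pos|]. unfold Rpower. rewrite <- exp_0. apply exp_increasing.
assert (0 < ln beta) by (rewrite <- ln_1; apply ln_increasing; lra). nra.
Qed.

Lemma Usum_term_bound (eta : R) : 0 < eta -> exists K, 0 < K /\ forall t k, 0 < t ->
  0 <= Ld d (beta ^ k * t) <= K * Rpower t (- eta) * (Rpower beta (- eta)) ^ k.
Proof.
intros He. destruct (Ld_decay eta He) as [K [HK H]]. exists K. split; [easy|].
intros t k Ht. split; [apply Ld_nonneg|].
assert (0 < beta ^ k) by (apply pow_lt; lra).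
eapply Rle_trans; [apply H; nra|]. rewrite Rpower_pow_mult by easy. lra.
Qed.

Lemma ex_series_geom_scal (c x : R) : 0 <= x < 1 -> ex_series (fun k => c * x ^ k).
Proof.
intros Hx. apply (ex_series_scal (V := R_NormedModule) c (fun k => x ^ k)).
exists (/ (1 - x)). apply is_series_geom. rewrite Rabs_pos_eq; lra.
Qed.

Lemma Series_geom_scal (c x : R) : 0 <= x < 1 -> Series (fun k => c * x ^ k) = c / (1 - x).
Proof.
intros Hx. rewrite Series_scal_l, Series_geom; [reflexivity|]. rewrite Rabs_pos_eq; lra.
Qed.

Lemma ex_series_Usum (t : R) : 0 < t -> ex_series (fun k => Ld d (beta ^ k * t)).
Proof.
intros Ht. destruct (Usum_term_bound 1 Rlt_0_1) as [K [HK H]].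
apply (ex_series_le (V := R_CompleteNormedModule)) with (b := fun k => K * Rpower t (Ropp 1) * (Rpower beta (Ropp 1)) ^ k).
- intros n. destruct (H t n Ht). unfold norm; simpl. unfold abs; simpl. rewrite Rabs_pos_eq; easy.
- apply ex_series_geom_scal. pose proof (Rpower_beta_lt_1 1). lra.
Qed.

Lemma Usum_nonneg (t : R) : 0 < t -> 0 <= Usum t.
Proof.
intros Ht. unfold Usum. replace 0 with (Series (fun _ => 0)) by (apply is_series_unique, is_series_zero).
apply Series_le; [|now apply ex_series_Usum]. intros n. split; [lra|apply Ld_nonneg].
Qed.

Lemma Usum_bound (eta : R) : 0 < eta -> exists K, 0 < K /\ forall t, 0 < t -> Usum t <= K * Rpower t (- eta).
Proof.
intros He. destruct (Usum_term_bound eta He) as [K [HK H]].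
assert (B := Rpower_beta_lt_1 eta He).
exists (K / (1 - Rpower beta (- eta))). split; [apply Rdiv_lt_0_compat; lra|].
intros t Ht. unfold Usum.
apply Rle_trans with (Series (fun k => K * Rpower t (- eta) * (Rpower beta (- eta)) ^ k)).
- apply Series_le; [intros n; now apply H|]. apply ex_series_geom_scal; lra.
- rewrite Series_geom_scal by lra. right. field. lra.
Qed.

Lemma Usum_step (t : R) : 0 < t -> Usum t = Ld d t + Usum (beta * t).
Proof.
intros Ht. unfold Usum. rewrite Series_incr_1 by now apply ex_series_Usum. f_equal.
- f_equal. simpl. ring.
- apply Series_ext. intros n. f_equal. simpl. ring.
Qed.

Lemma Usum_split (n : nat) (t : R) : 0 < t ->
  Usum t = Rsum (fun k => Ld d (beta ^ k * t)) (seq 0 n) + Usum (beta ^ n * t).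
Proof.
intros Ht. induction n as [|n IH].
- unfold seq. rewrite Rsum_nil. simpl. rewrite Rmult_1_l. ring.
- rewrite Rsum_seq_S, IH. simpl (0 + n)%nat.
  assert (0 < beta ^ n) by (apply pow_lt; lra).
  rewrite (Usum_step (beta ^ n * t)) by nra. simpl. rewrite Rmult_assoc. ring.
Qed.

Lemma Vsum_term_bound (t : R) (k : nat) : 0 <= t ->
  0 <= ln q - Ld d (t / beta ^ S k) <= dmax d * t / beta * (/ beta) ^ k.
Proof.
intros Ht. assert (0 < beta ^ S k) by (apply pow_lt; lra).
assert (H0 : 0 <= t / beta ^ S k) by now apply Rdiv_le_0_compat.
split; [pose proof (Ld_le_lnq _ H0); lra|].
eapply Rle_trans; [now apply Ld_near_0|]. right. rewrite pow_inv. simpl. field.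
split; [|lra]. apply pow_nonzero. lra.
Qed.

Lemma inv_beta_lt_1 : 0 <= / beta < 1.
Proof.
split; [left; apply Rinv_0_lt_compat; lra|]. rewrite <- Rinv_1. apply Rinv_lt_contravar; lra.
Qed.

Lemma ex_series_Vsum (t : R) : 0 <= t -> ex_series (fun k => ln q - Ld d (t / beta ^ S k)).
Proof.
intros Ht.
apply (ex_series_le (V := R_CompleteNormedModule)) with (b := fun k => dmax d * t / beta * (/ beta) ^ k).
- intros n. destruct (Vsum_term_bound t n Ht). unfold norm; simpl. unfold abs; simpl. rewrite Rabs_pos_eq; easy.
- apply ex_series_geom_scal, inv_beta_lt_1.
Qed.

Lemma Vsum_bounds (t : R) : 0 <= t -> 0 <= Vsum t <= dmax d / (beta - 1) * t.
Proof.
intros Ht. unfold Vsum. split.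
- replace 0 with (Series (fun _ => 0)) by (apply is_series_unique, is_series_zero).
  apply Series_le; [|now apply ex_series_Vsum]. intros n.
  split; [lra|now apply Vsum_term_bound].
- apply Rle_trans with (Series (fun k => dmax d * t / beta * (/ beta) ^ k)).
  + apply Series_le; [intros n; now apply Vsum_term_bound|]. apply ex_series_geom_scal, inv_beta_lt_1.
  + rewrite Series_geom_scal by apply inv_beta_lt_1. right. field. lra.
Qed.

Lemma Vsum_step (t : R) : 0 <= t -> Vsum (beta * t) = ln q - Ld d t + Vsum t.
Proof.
intros Ht. unfold Vsum. rewrite Series_incr_1 by (apply ex_series_Vsum; nra). f_equal.
- do 2 f_equal. simpl. field. lra.
- apply Series_ext. intros n. do 2 f_equal. simpl. field. split; [|lra]. apply pow_nonzero; lra.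
Qed.

Lemma Vsum_split (n : nat) (t : R) : 0 <= t ->
  Vsum t = Rsum (fun k => ln q - Ld d (t / beta ^ k)) (seq 1 n) + Vsum (t / beta ^ n).
Proof.
intros Ht. induction n as [|n IH].
- unfold seq. rewrite Rsum_nil. simpl. unfold Rdiv. rewrite Rinv_1, Rmult_1_r. ring.
- rewrite Rsum_seq_S, IH. simpl (1 + n)%nat.
  assert (P : 0 < beta ^ S n) by (apply pow_lt; lra).
  replace (t / beta ^ n) with (beta * (t / beta ^ S n)).
  + rewrite Vsum_step by now apply Rdiv_le_0_compat. ring.
  + simpl. field. split; [|lra]. apply pow_nonzero; lra.
Qed.

Lemma continuous_Ld_scal (c t : R) : continuous (fun t => Ld d (c * t)) t.
Proof.
apply (continuous_comp (fun t => Dsum d (c * t)) ln); [apply continuous_Dsum|].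
apply continuous_ln. now apply Dsum_pos.
Qed.

Lemma continuous_Rsum {T : Type} (f : T -> R -> R) (l : list T) (t : R) :
  (forall x, continuous (f x) t) -> continuous (fun t => Rsum (fun x => f x t) l) t.
Proof.
intros H. induction l as [|x l IH].
- apply continuous_ext with (f := fun _ => 0); [intros; reflexivity|apply continuous_const].
- apply continuous_ext with (f := fun t => f x t + Rsum (fun x => f x t) l); [intros; reflexivity|].
  apply continuous_Rplus; [apply H|exact IH].
Qed.

Lemma locally_gt (t x : R) : x < t -> locally t (fun y => x < y).
Proof.
intros H. exists (mkposreal (t - x) ltac:(lra)). intros y Hy. apply Rabs_def2 in Hy. simpl in Hy.
unfold minus, plus, opp in Hy; simpl in Hy. lra.
Qed.

Lemma locally_lt (t x : R) : t < x -> locally t (fun y => y < x).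
Proof.
intros H. exists (mkposreal (x - t) ltac:(lra)). intros y Hy. apply Rabs_def2 in Hy. simpl in Hy.
unfold minus, plus, opp in Hy; simpl in Hy. lra.
Qed.

Lemma geom_small (c x eps : R) : 0 <= x < 1 -> 0 < eps -> exists n, c * x ^ n <= eps.
Proof.
intros Hx He.
assert (Lm := is_lim_seq_geom x ltac:(rewrite Rabs_pos_eq; lra)).
apply (is_lim_seq_scal_l _ c) in Lm. simpl in Lm. rewrite Rmult_0_r in Lm.
apply is_lim_seq_spec in Lm. destruct (Lm (mkposreal eps He)) as [N HN].
exists N. specialize (HN N (Nat.le_refl N)). simpl in HN. rewrite Rminus_0_r in HN.
apply Rabs_def2 in HN. lra.
Qed.

(** The tail of the sum after [n] terms is [Usum (beta^n y)], which is small uniformly for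
    [y > t / 2]. *)
Lemma continuous_Usum (t : R) : 0 < t -> continuous Usum t.
Proof.
intros Ht. apply continuous_uniform_approx. intros eps He.
destruct (Usum_bound 1 Rlt_0_1) as [K [HK H]].
destruct (geom_small (K * Rpower (t / 2) (Ropp 1)) (Rpower beta (Ropp 1)) eps) as [n Hn]; [|easy|].
{ pose proof (Rpower_beta_lt_1 1). lra. }
exists (fun t => Rsum (fun k => Ld d (beta ^ k * t)) (seq 0 n)). split.
- apply continuous_Rsum. intros k. apply continuous_Ld_scal.
- generalize (locally_gt t (t / 2) ltac:(lra)). apply filter_imp. intros y Hy.
  assert (P : 0 < beta ^ n) by (apply pow_lt; lra).
  rewrite (Usum_split n y) by lra.
  match goal with |- Rabs (?a + ?b - ?a) <= _ => replace (a + b - a) with b by ring end.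
  rewrite Rabs_pos_eq by (apply Usum_nonneg; nra).
  eapply Rle_trans; [apply H; nra|]. eapply Rle_trans; [|exact Hn].
  rewrite Rpower_pow_mult by lra.
  rewrite Rmult_assoc, (Rmult_comm (Rpower (t / 2) _)), <- !Rmult_assoc.
  apply Rmult_le_compat_l.
  + apply Rmult_le_pos; [lra|]. apply pow_le. left; apply exp_pos.
  + rewrite !Rpower_Ropp, !Rpower_1 by lra. apply Rinv_le_contravar; lra.
Qed.

Lemma continuous_Vsum (t : R) : 0 < t -> continuous Vsum t.
Proof.
intros Ht. apply continuous_uniform_approx. intros eps He.
destruct (geom_small (dmax d / (beta - 1) * (t + 1)) (/ beta) eps inv_beta_lt_1 He) as [n Hn].
assert (D1 := dmax_ge_1 d Hd0 Hin).
assert (HM : 0 < dmax d / (beta - 1)) by (apply Rdiv_lt_0_compat; lra).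
exists (fun t => Rsum (fun k => ln q - Ld d (t / beta ^ k)) (seq 1 n)). split.
- apply continuous_Rsum. intros k.
  apply (continuous_Rplus (fun _ => ln q) (fun t => - Ld d (t / beta ^ k))); [apply continuous_const|].
  apply continuous_Ropp. apply continuous_ext with (f := fun t => Ld d (/ beta ^ k * t)).
  + intros x. f_equal. unfold Rdiv. ring.
  + apply continuous_Ld_scal.
- assert (L1 := locally_gt t (t / 2) ltac:(lra)). assert (L2 := locally_lt t (t + 1) ltac:(lra)).
  generalize (filter_and _ _ L1 L2).
  apply filter_imp. intros y [Hy1 Hy2].
  assert (P : 0 < beta ^ n) by (apply pow_lt; lra).
  assert (P' : 0 <= y / beta ^ n) by (apply Rdiv_le_0_compat; lra).
  rewrite (Vsum_split n y) by lra.
  match goal with |- Rabs (?a + ?b - ?a) <= _ => replace (a + b - a) with b by ring end.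
  rewrite Rabs_pos_eq by now apply Vsum_bounds.
  eapply Rle_trans; [now apply Vsum_bounds|]. eapply Rle_trans; [|exact Hn].
  rewrite Rmult_assoc. apply Rmult_le_compat_l; [lra|]. rewrite pow_inv. unfold Rdiv.
  apply Rmult_le_compat_r; [left; now apply Rinv_0_lt_compat|lra].
Qed.

End Products.

(** Abel summation; the boundary term [(N + c) v_(N+1)] tends to 0 because [n v_n] and [v_n] do. *)
Lemma is_series_weighted_differences (v : nat -> R) (c s : R) :
  is_series v s -> is_lim_seq (fun n => INR n * v n) 0 ->
  is_series (fun n => (INR n + c) * (v n - v (S n))) (s + (c - 1) * v 0%nat).
Proof.
intros Hs Hl.
assert (Hv : is_lim_seq v 0) by (apply ex_series_lim_0; now exists s).
assert (E : forall N, sum_n (fun n => (INR n + c) * (v n - v (S n))) N =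
   sum_n v N + (c - 1) * v 0%nat - (INR N + c) * v (S N)).
{ induction N as [|N IH].
  - rewrite !sum_O. simpl INR. ring_R.
  - rewrite !sum_Sn, IH. unfold plus; cbn -[INR]. rewrite S_INR. ring. }
change (is_lim_seq (sum_n (fun n => (INR n + c) * (v n - v (S n)))) (Finite (s + (c - 1) * v 0%nat))).
apply is_lim_seq_ext with (u := fun N => sum_n v N + (c - 1) * v 0%nat - (INR N + c) * v (S N)).
- intros N. now rewrite E.
- replace (Finite (s + (c - 1) * v 0%nat)) with (Finite (s + (c - 1) * v 0%nat - 0)) by (f_equal; ring).
  apply is_lim_seq_minus'.
  + apply is_lim_seq_plus'; [exact Hs|apply is_lim_seq_const].
  + apply is_lim_seq_ext with (u := fun N => INR (S N) * v (S N) + (c - 1) * v (S N)).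
    * intros N. rewrite S_INR. ring.
    * replace (Finite 0) with (Finite (0 + (c - 1) * 0)) by (f_equal; ring).
      apply is_lim_seq_plus'; [exact (proj1 (is_lim_seq_incr_1 _ _) Hl)|].
      apply (is_lim_seq_scal_l (fun N => v (S N)) (c - 1) 0). now apply is_lim_seq_incr_1 in Hv.
Qed.

Section Periodic.
Variables (beta : R) (d : list R).
Hypothesis Hbeta : 1 < beta.
Hypothesis Hnd : NoDup d.
Hypothesis Hd0 : forall delta, In delta d -> 0 <= delta.
Hypothesis Hin : In 0 d.
Hypothesis Hlen : (2 <= length d)%nat.

Notation q := (INR (length d)).
Notation L := (Lexp beta d).
Notation Us := (Usum beta d).
Notation Vs := (Vsum beta d).

Lemma ln_beta_pos : 0 < ln beta.
Proof. rewrite <- ln_1. apply ln_increasing; lra. Qed.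

Lemma Rpower_beta_INR (n : nat) (w : R) : Rpower beta (INR n + w) = beta ^ n * Rpower beta w.
Proof. rewrite Rpower_plus, Rpower_pow by lra. reflexivity. Qed.

Lemma Rpower_beta_neg (n : nat) (w : R) : Rpower beta (- INR n + w) = Rpower beta w / beta ^ n.
Proof. rewrite Rpower_plus, Rpower_Ropp, Rpower_pow by lra. unfold Rdiv. ring. Qed.

Lemma is_lim_n_geom_bound (v : nat -> R) (c x : R) : 0 <= x < 1 ->
  (forall n, 0 <= v n <= c * x ^ n) -> is_lim_seq (fun n => INR n * v n) 0.
Proof.
intros Hx H. apply is_lim_seq_le_le with (u := fun _ => 0) (w := fun n => c * (INR n * x ^ n)).
- intros n. specialize (H n). pose proof (pos_INR n). nra.
- apply is_lim_seq_const.
- replace (Finite 0) with (Rbar_mult c 0) by (simpl; f_equal; ring).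
  apply is_lim_seq_scal_l. now apply is_lim_seq_n_pow.
Qed.

(** The sum over [k >= 0] is Abel-summed with the values of [Ld d], which decay at infinity, and the
    sum over [k < 0] with their distance from [ln |d|], which decays at 0. The boundary
    contributions add up to [(w - 1/2) ln |d|], and the last term of [P] turns this into
    [w ln |d|]. *)
Lemma Pfun_eq (w : R) :
  Pfun beta d w = Us (Rpower beta w) - Vs (Rpower beta w) + w * ln q.
Proof.
set (t := Rpower beta w). assert (Ht : 0 < t) by apply exp_pos.
set (a := fun n => Ld d (beta ^ n * t)).
set (v := fun n => ln q - Ld d (t / beta ^ n)).
assert (Sa : is_series a (Us t)).
{ apply Series_correct. now apply ex_series_Usum. }
assert (Sv : is_series (fun n => v (S n)) (Vs t)).
{ apply Series_correct. apply ex_series_Vsum; trivial; lra. }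
assert (La : is_lim_seq (fun n => INR n * a n) 0).
{ destruct (Usum_term_bound beta d Hbeta Hnd Hd0 Hin 1 Rlt_0_1) as [K [HK H]].
  apply is_lim_n_geom_bound with (c := K * Rpower t (Ropp 1)) (x := Rpower beta (Ropp 1)).
  - pose proof (Rpower_beta_lt_1 beta Hbeta 1). lra.
  - intros n. now apply H. }
assert (Lv : is_lim_seq (fun n => INR n * v n) 0).
{ apply is_lim_n_geom_bound with (c := Rmax (v 0%nat) (dmax d * t)) (x := / beta).
  - now apply inv_beta_lt_1.
  - intros [|n].
    + rewrite pow_O, Rmult_1_r. split; [|apply Rmax_l]. unfold v. simpl. unfold Rdiv.
      rewrite Rinv_1, Rmult_1_r. pose proof (Ld_le_lnq d Hd0 Hin t). lra.
    + destruct (Vsum_term_bound beta d Hbeta Hd0 Hin Hlen t n ltac:(lra)) as [H1 H2].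
      split; [exact H1|]. eapply Rle_trans; [exact H2|].
      replace (dmax d * t / beta * (/ beta) ^ n) with (dmax d * t * (/ beta) ^ S n) by (simpl; field; lra).
      apply Rmult_le_compat_r; [apply pow_le; left; apply Rinv_0_lt_compat; lra|apply Rmax_r]. }
assert (Sv0 : is_series v (Vs t + v 0%nat)).
{ apply is_series_decr_1.
  match goal with |- is_series _ ?l => replace l with (Vs t)
    by (unfold plus, opp; simpl; ring_R) end.
  exact Sv. }
assert (S1 := is_series_weighted_differences a (w + / 2) _ Sa La).
(* For [k = - (n + 1)] the weight [k + w + 1/2] equals [- (n + (1/2 - w))]. *)
assert (S2 := is_series_weighted_differences v (/ 2 - w) _ Sv0 Lv).
assert (T1 : is_series (fun n => (IZR (Z.of_nat n) + w + / 2) *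
   (Ld d (Rpower beta (IZR (Z.of_nat n) + w)) - Ld d (Rpower beta (IZR (Z.of_nat n) + 1 + w))))
   (Us t + (w + / 2 - 1) * a 0%nat)).
{ revert S1. apply is_series_ext. intros n. rewrite <- !INR_IZR_INZ.
  replace (INR n + 1 + w) with (INR (S n) + w) by (rewrite S_INR; ring).
  rewrite !Rpower_beta_INR. unfold a, t. ring_R. }
assert (T2 : is_series (fun n => (IZR (- Z.of_nat (S n)) + w + / 2) *
   (Ld d (Rpower beta (IZR (- Z.of_nat (S n)) + w)) - Ld d (Rpower beta (IZR (- Z.of_nat (S n)) + 1 + w))))
   (opp (Vs t + v 0%nat + (/ 2 - w - 1) * v 0%nat))).
{ apply is_series_opp in S2. revert S2. apply is_series_ext. intros n. rewrite opp_IZR, <- !INR_IZR_INZ.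
  replace (- INR (S n) + 1 + w) with (- INR n + w) by (rewrite S_INR; ring).
  rewrite !Rpower_beta_neg. unfold v, t, opp; cbn -[INR pow]. rewrite S_INR.
  match goal with |- ?a = ?b => change (@eq R a b) end. field. }
unfold Pfun, Zseries. rewrite (is_series_unique _ _ T1), (is_series_unique _ _ T2).
unfold opp; simpl. unfold a, v, t. simpl. unfold Rdiv. rewrite Rinv_1, Rmult_1_r, Rmult_1_l. field.
Qed.

Definition exp_periodic (t : R) : R := exp (Pfun beta d (ln t / ln beta)).

Lemma Rpower_ln_beta (t : R) : 0 < t -> Rpower beta (ln t / ln beta) = t.
Proof.
intros Ht. unfold Rpower. replace (ln t / ln beta * ln beta) with (ln t) by (field; pose proof ln_beta_pos; lra).
now apply exp_ln.
Qed.

Lemma exp_periodic_eq (t : R) : 0 < t -> exp_periodic t = exp (Us t) * exp (- Vs t) * Rpower t L.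
Proof.
intros Ht. unfold exp_periodic. rewrite Pfun_eq, Rpower_ln_beta by easy.
unfold Rpower, Lexp. rewrite <- !exp_plus. f_equal. field. pose proof ln_beta_pos. lra.
Qed.

Lemma exp_periodic_Rpower (u : R) : exp_periodic (Rpower beta u) = exp (Pfun beta d u).
Proof.
unfold exp_periodic. do 2 f_equal. unfold Rpower. rewrite ln_exp. field. pose proof ln_beta_pos. lra.
Qed.

Lemma ln_q_Lexp : ln q = L * ln beta.
Proof. unfold Lexp. field. pose proof ln_beta_pos. lra. Qed.

Lemma Rpower_beta_Lexp : Rpower beta L = q.
Proof. unfold Rpower. rewrite <- ln_q_Lexp. apply exp_ln. now apply Hq_pos. Qed.

(** Passing from [t] to [beta t] divides [F] by [D(t)], multiplies [1 / Phi] by [D(t) / |d|] and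
    multiplies [t^L] by [|d|]. *)
Lemma exp_periodic_periodic (t : R) : 0 < t -> exp_periodic (beta * t) = exp_periodic t.
Proof.
intros Ht. rewrite !exp_periodic_eq by nra.
rewrite (Usum_step beta d Hbeta Hnd Hd0 Hin t) by easy.
rewrite Vsum_step by (trivial; lra).
rewrite <- Rpower_mult_distr by lra. rewrite Rpower_beta_Lexp.
replace (- (ln q - Ld d t + Vs t)) with (- ln q + Ld d t + - Vs t) by ring.
rewrite !exp_plus, exp_Ropp, exp_ln by now apply Hq_pos.
field. pose proof (Hq_pos d Hlen). lra.
Qed.

Lemma continuous_exp_comp (f : R -> R) (t : R) : continuous f t -> continuous (fun t => exp (f t)) t.
Proof.
intros H. apply (continuous_comp f exp); [exact H|].
apply (ex_derive_continuous (K := R_AbsRing) (V := R_NormedModule)). now auto_derive.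
Qed.

Lemma locally_pos_eq (f g : R -> R) (t : R) : 0 < t -> (forall t, 0 < t -> f t = g t) ->
  locally t (fun y => f y = g y).
Proof.
intros Ht H. generalize (locally_gt t 0 Ht). apply filter_imp. intros y. apply H.
Qed.

Lemma continuous_exp_periodic (t : R) : 0 < t -> continuous exp_periodic t.
Proof.
intros Ht. apply continuous_ext_loc with (g := fun t => exp (Us t) * exp (- Vs t) * Rpower t L).
- apply locally_pos_eq; [easy|]. intros y Hy. symmetry. now apply exp_periodic_eq.
- apply continuous_Rmult; [apply continuous_Rmult|now apply continuous_Rpower].
  + apply continuous_exp_comp. now apply continuous_Usum.
  + apply continuous_exp_comp, continuous_Ropp. now apply continuous_Vsum.
Qed.

Lemma exp_periodic_pos (t : R) : 0 < exp_periodic t.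
Proof. apply exp_pos. Qed.

(** The maximum over the period [[1, beta]] bounds the function everywhere: [A] moves points
    [t >= 1] down into the period, [B] moves smaller points up. *)
Lemma exp_periodic_bounded : exists K, 0 < K /\ forall t, 0 < t -> exp_periodic t <= K.
Proof.
destruct (continuity_ab_maj exp_periodic 1 beta ltac:(lra)) as [m [Hm Hm']].
{ intros c Hc. apply continuity_pt_filterlim. apply continuous_exp_periodic. lra. }
exists (exp_periodic m). split; [apply exp_periodic_pos|].
assert (A : forall n t, 1 <= t <= beta ^ n -> exp_periodic t <= exp_periodic m).
{ induction n as [|n IH]; intros t Ht.
  - simpl in Ht. apply Hm. lra.
  - destruct (Rle_dec t beta) as [H|H]; [apply Hm; lra|].
    replace t with (beta * (t / beta)) by (field; lra).
    assert (B1 : 1 <= t / beta) by (apply Rle_div_r; lra).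
    rewrite exp_periodic_periodic by lra. apply IH. split; [exact B1|].
    apply Rle_div_l; [lra|]. simpl in Ht. lra. }
assert (B : forall n t, 1 <= beta ^ n * t -> 0 < t -> exp_periodic t <= exp_periodic m).
{ induction n as [|n IH]; intros t Ht Ht0.
  - simpl in Ht. destruct (Pow_x_infinity beta ltac:(rewrite Rabs_pos_eq; lra) t) as [N HN].
    specialize (HN N (Nat.le_refl N)). rewrite Rabs_pos_eq in HN by (apply pow_le; lra).
    apply (A N). lra.
  - rewrite <- exp_periodic_periodic by easy. apply IH; [simpl in Ht; lra|nra]. }
intros t Ht. destruct (Pow_x_infinity beta ltac:(rewrite Rabs_pos_eq; lra) (/ t)) as [N HN].
specialize (HN N (Nat.le_refl N)). rewrite Rabs_pos_eq in HN by (apply pow_le; lra).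
apply (B N); [|easy]. apply Rge_le in HN. apply (Rmult_le_compat_r t) in HN; [|lra].
rewrite Rinv_l in HN by lra. exact HN.
Qed.

(** * The product [F] and its finite partial products *)

Definition digit_prod (t : R) : R := exp (Us t).

Lemma digit_prod_eq (t : R) : 0 < t -> digit_prod t = Rpower t (- L) * exp_periodic t * exp (Vs t).
Proof.
intros Ht. rewrite exp_periodic_eq by easy. unfold digit_prod. rewrite exp_Ropp, Rpower_Ropp.
field. split; apply Rgt_not_eq, exp_pos.
Qed.

Lemma continuous_digit_prod (t : R) : 0 < t -> continuous digit_prod t.
Proof. intros Ht. apply continuous_exp_comp. now apply continuous_Usum. Qed.

Lemma digit_prod_ge_1 (t : R) : 0 < t -> 1 <= digit_prod t.
Proof.
intros Ht. unfold digit_prod. pose proof (Usum_nonneg beta d Hbeta Hnd Hd0 Hin t Ht).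
pose proof (exp_ineq1_le (Us t)). lra.
Qed.

Lemma digit_prod_bound_0 (a : R) : 0 < a -> exists K, 0 < K /\ forall t, 0 < t <= a -> digit_prod t <= K * Rpower t (- L).
Proof.
intros Ha. destruct exp_periodic_bounded as [K [HK H]].
exists (K * exp (dmax d / (beta - 1) * a)). split; [apply Rmult_lt_0_compat; [easy|apply exp_pos]|].
intros t Ht. rewrite digit_prod_eq by lra.
assert (P := exp_pos (- L * ln t)). fold (Rpower t (- L)) in P.
rewrite Rmult_assoc, Rmult_comm. apply Rmult_le_compat_r; [lra|].
apply Rmult_le_compat; [left; apply exp_periodic_pos|left; apply exp_pos|apply H; lra|].
assert (V : Vs t <= dmax d / (beta - 1) * a).
{ destruct (Vsum_bounds beta d Hbeta Hd0 Hin Hlen t ltac:(lra)) as [_ V]. eapply Rle_trans; [exact V|].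
  apply Rmult_le_compat_l; [|lra]. left. apply Rdiv_lt_0_compat; [|lra].
  pose proof (dmax_ge_1 d Hd0 Hin). lra. }
destruct V as [V|V]; [left; now apply exp_increasing|rewrite V; lra].
Qed.

Lemma Usum_decreasing (a t : R) : 0 < a -> a <= t -> Us t <= Us a.
Proof.
intros Ha Ht. unfold Usum. apply Series_le; [|now apply ex_series_Usum].
intros k. split; [now apply Ld_nonneg|]. rewrite !Ld_Dsum.
apply ln_le; [apply Dsum_pos; now apply d_nonnil|]. apply Rsum_le. intros x Hx.
assert (0 < beta ^ k) by (apply pow_lt; lra). specialize (Hd0 x Hx).
assert (V : - x * (beta ^ k * t) <= - x * (beta ^ k * a)).
{ assert (beta ^ k * a <= beta ^ k * t) by nra. nra. }
destruct V as [V|V]; [left; now apply exp_increasing|rewrite V; lra].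
Qed.

Lemma digit_prod_decreasing (a t : R) : 0 < a -> a <= t -> digit_prod t <= digit_prod a.
Proof.
intros Ha Ht. unfold digit_prod. destruct (Usum_decreasing a t Ha Ht) as [V|V];
  [left; now apply exp_increasing|rewrite V; lra].
Qed.

(** [e^u - 1 <= u e^u] with [u = log F]. As [eta] is arbitrary, [F - 1] decays at infinity faster
    than every power. *)
Lemma digit_prod_sub1_bound (eta : R) : 0 < eta ->
  exists K, 0 < K /\ forall t, 0 < t -> 0 <= digit_prod t - 1 <= K * digit_prod t * Rpower t (- eta).
Proof.
intros He. destruct (Usum_bound beta d Hbeta Hnd Hd0 Hin eta He) as [K [HK H]].
exists K. split; [easy|]. intros t Ht. pose proof (digit_prod_ge_1 t Ht). split; [lra|].
assert (B : digit_prod t - 1 <= digit_prod t * Us t).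
{ unfold digit_prod. assert (E := exp_ineq1_le (- Us t)). assert (P := exp_pos (Us t)).
  apply (Rmult_le_compat_l (exp (Us t))) in E; [|lra]. rewrite <- exp_plus, Rplus_opp_r, exp_0 in E. lra. }
eapply Rle_trans; [exact B|]. specialize (H t Ht).
replace (K * digit_prod t * Rpower t (- eta)) with (digit_prod t * (K * Rpower t (- eta))) by ring.
apply Rmult_le_compat_l; lra.
Qed.

Definition digit_prod_upto (n : nat) (t : R) : R := exp (Rsum (fun k => Ld d (beta ^ k * t)) (seq 0 n)).

Lemma digit_prod_upto_0 (t : R) : digit_prod_upto 0 t = 1.
Proof. unfold digit_prod_upto. simpl seq. rewrite Rsum_nil. apply exp_0. Qed.

Lemma digit_prod_upto_S (n : nat) (t : R) : digit_prod_upto (S n) t = digit_prod_upto n t * Dsum d (beta ^ n * t).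
Proof. unfold digit_prod_upto. rewrite Rsum_seq_S, exp_plus, exp_Ld by easy. reflexivity. Qed.

(** The error is at most a geometric sequence in [n] times a fixed function of [t], so limits may be
    taken under an integral by a plain estimate. *)
Lemma digit_prod_upto_bound (eta : R) : 0 < eta ->
  exists K x, 0 < K /\ 0 <= x < 1 /\ forall n t, 0 < t ->
    0 <= digit_prod t - digit_prod_upto n t <= K * x ^ n * (digit_prod t * Rpower t (- eta)).
Proof.
intros He. destruct (Usum_bound beta d Hbeta Hnd Hd0 Hin eta He) as [K [HK H]].
assert (X := Rpower_beta_lt_1 beta Hbeta eta He).
exists K, (Rpower beta (- eta)). repeat split; try lra.
- assert (P : 0 < beta ^ n) by (apply pow_lt; lra).
  unfold digit_prod, digit_prod_upto. rewrite (Usum_split beta d Hbeta Hnd Hd0 Hin n t) by easy.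
  assert (U0 := Usum_nonneg beta d Hbeta Hnd Hd0 Hin (beta ^ n * t) ltac:(nra)).
  set (s := Rsum _ _). rewrite exp_plus. pose proof (exp_pos s).
  assert (1 <= exp (Us (beta ^ n * t))) by (pose proof (exp_ineq1_le (Us (beta ^ n * t))); lra). nra.
- assert (P : 0 < beta ^ n) by (apply pow_lt; lra).
  assert (U1 := H (beta ^ n * t) ltac:(nra)).
  rewrite Rpower_pow_mult in U1 by easy.
  replace (K * Rpower beta (- eta) ^ n * (digit_prod t * Rpower t (- eta)))
    with (digit_prod t * (K * (Rpower beta (- eta) ^ n * Rpower t (- eta)))) by ring.
  apply Rle_trans with (digit_prod t * Us (beta ^ n * t)).
  + unfold digit_prod, digit_prod_upto. rewrite (Usum_split beta d Hbeta Hnd Hd0 Hin n t) by easy.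
    set (s := Rsum _ _). set (u := Us (beta ^ n * t)).
    assert (E := exp_ineq1_le (- u)). assert (Pu := exp_pos (s + u)).
    apply (Rmult_le_compat_l (exp (s + u))) in E; [|lra]. rewrite <- exp_plus in E.
    replace (s + u + - u) with s in E by ring. lra.
  + apply Rmult_le_compat_l; [left; apply exp_pos|exact U1].
Qed.

(** On [[0, sigma)] both sides are limits of the same finite products. *)
Lemma exp_Vsum_PSeries (sigma t : R) : is_sigma beta d sigma -> 0 <= t < sigma ->
  exp (Vs t) = PSeries (ccoef beta d) t.
Proof.
intros Hs Ht.
assert (L1 := is_lim_prod_sigma beta d Hbeta Hd0 Hin Hlen sigma t Hs ltac:(rewrite Rabs_pos_eq; lra)).
assert (E : forall n, Rprod (prod_factor beta d t) (seq 1 n) =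
   exp (Rsum (fun k => ln q - Ld d (t / beta ^ k)) (seq 1 n))).
{ induction n as [|n IH].
  - simpl seq. rewrite Rsum_nil, exp_0. reflexivity.
  - rewrite Rprod_seq_S, Rsum_seq_S, exp_plus, IH, prod_factor_Dsum. f_equal.
    unfold Rminus. rewrite exp_plus, exp_Ropp, exp_Ld, exp_ln; trivial. now apply Hq_pos. }
assert (L2 : is_lim_seq (fun n => exp (Rsum (fun k => ln q - Ld d (t / beta ^ k)) (seq 1 n))) (exp (Vs t))).
{ apply (is_lim_seq_continuous exp).
  - apply derivable_continuous_pt, derivable_pt_exp.
  - assert (Sc := Series_correct _ (ex_series_Vsum beta d Hbeta Hd0 Hin Hlen t (proj1 Ht))).
    apply is_lim_seq_incr_1.
    assert (Sc' : is_lim_seq (sum_n (fun k => ln q - Ld d (t / beta ^ S k))) (Vs t)) by exact Sc.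
    revert Sc'. apply is_lim_seq_ext. intros n. rewrite sum_n_Reals, Rsum_sum_f_R0, Rsum_seq_shift. reflexivity. }
apply (is_lim_seq_ext _ _ _ E) in L1.
assert (U := is_lim_seq_unique _ _ L1). rewrite (is_lim_seq_unique _ _ L2) in U. now injection U.
Qed.

End Periodic.

Local Open Scope C_scope.

(** * Counting representations *)

Lemma Csum_cons {T : Type} (f : T -> C) (x : T) (l : list T) : Csum f (x :: l) = f x + Csum f l.
Proof. reflexivity. Qed.

Lemma Csum_nil {T : Type} (f : T -> C) : Csum f nil = 0.
Proof. reflexivity. Qed.

Lemma Csum_app {T : Type} (f : T -> C) (l1 l2 : list T) : Csum f (l1 ++ l2) = Csum f l1 + Csum f l2.
Proof.
induction l1 as [|x l IH]; simpl app; rewrite ?Csum_cons, ?Csum_nil; [ring|]. rewrite IH. ring.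
Qed.

Lemma Csum_ext {T : Type} (f g : T -> C) (l : list T) :
  (forall x, In x l -> f x = g x) -> Csum f l = Csum g l.
Proof.
induction l as [|x l IH]; intros H; [reflexivity|].
rewrite !Csum_cons, H, IH; [easy| |now left]. intros y Hy. apply H. now right.
Qed.

Lemma Csum_plus {T : Type} (f g : T -> C) (l : list T) :
  Csum (fun x => f x + g x) l = Csum f l + Csum g l.
Proof. induction l as [|x l IH]; rewrite ?Csum_nil, ?Csum_cons; [ring|]. rewrite IH. ring. Qed.

Lemma Csum_scal {T : Type} (c : C) (f : T -> C) (l : list T) :
  Csum (fun x => c * f x) l = c * Csum f l.
Proof. induction l as [|x l IH]; rewrite ?Csum_nil, ?Csum_cons; [ring|]. rewrite IH. ring. Qed.

Lemma Cmod_Csum {T : Type} (f : T -> C) (l : list T) : (Cmod (Csum f l) <= Rsum (fun x => Cmod (f x)) l)%R.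
Proof.
induction l as [|x l IH]; [rewrite Csum_nil, Cmod_0; apply Rle_refl|].
rewrite Csum_cons, Rsum_cons. eapply Rle_trans; [apply Cmod_triangle|]. lra.
Qed.

Lemma Csum_0 {T : Type} (l : list T) : Csum (fun _ => RtoC 0) l = 0.
Proof. induction l as [|x l IH]; rewrite ?Csum_nil, ?Csum_cons; [easy|]. rewrite IH. ring. Qed.

Lemma Csum_RtoC {T : Type} (f : T -> R) (l : list T) : Csum (fun x => RtoC (f x)) l = RtoC (Rsum f l).
Proof.
induction l as [|x l IH]; [reflexivity|]. rewrite Csum_cons, Rsum_cons, IH, RtoC_plus. reflexivity.
Qed.

Lemma Csum_filter_partition {T : Type} (f : T -> C) (p : T -> bool) (l : list T) :
  Csum f l = Csum f (filter p l) + Csum f (filter (fun x => negb (p x)) l).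
Proof.
induction l as [|x l IH]; simpl; [rewrite Csum_nil; ring|].
rewrite Csum_cons, IH. destruct (p x); simpl; rewrite Csum_cons; ring.
Qed.

Lemma Rsum_filter_le {T : Type} (f : T -> R) (p : T -> bool) (l : list T) :
  (forall x, (0 <= f x)%R) -> (Rsum f (filter p l) <= Rsum f l)%R.
Proof.
intros H. rewrite Rsum_filter. apply Rsum_le. intros x _. destruct (p x); [lra|apply H].
Qed.

Section Counting.

Definition countR (l : list R) (x : R) : nat := count_occ Req_dec_T l x.

Definition memR (F : list R) (x : R) : bool := if in_dec Req_dec_T x F then true else false.

Lemma Csum_single (phi : R -> C) (F : list R) (x : R) : NoDup F ->
  Csum (fun y => RtoC (if Req_dec_T x y then 1 else 0) * phi y) F = if memR F x then phi x else 0.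
Proof.
induction F as [|y F IH]; intros HN; [reflexivity|].
rewrite Csum_cons. inversion_clear HN as [|? ? Hy HF]. rewrite (IH HF).
unfold memR. destruct (Req_dec_T x y) as [->|E].
- destruct (in_dec Req_dec_T y F) as [I|I]; [contradiction|].
  destruct (in_dec Req_dec_T y (y :: F)) as [J|J]; [ring|]. exfalso; apply J; now left.
- destruct (in_dec Req_dec_T x F) as [I|I]; destruct (in_dec Req_dec_T x (y :: F)) as [J|J]; try ring.
  + exfalso; apply J; now right.
  + destruct J as [J|J]; [symmetry in J; contradiction|contradiction].
Qed.

Lemma Csum_countR (phi : R -> C) (F l : list R) : NoDup F ->
  Csum (fun y => RtoC (INR (countR l y)) * phi y) F = Csum phi (filter (memR F) l).
Proof.
intros HN. induction l as [|x l IH].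
- transitivity (Csum (fun _ : R => RtoC 0) F); [|apply Csum_0].
  apply Csum_ext. intros y _. apply Cmult_0_l.
- transitivity (Csum (fun y => RtoC (if Req_dec_T x y then 1 else 0) * phi y + RtoC (INR (countR l y)) * phi y) F).
  + apply Csum_ext. intros y _. unfold countR. simpl.
    destruct (Req_dec_T x y); [rewrite S_INR, RtoC_plus; ring|ring].
  + rewrite Csum_plus, IH, Csum_single by easy. simpl filter.
    destruct (memR F x); [rewrite Csum_cons; ring|ring].
Qed.

Lemma filter_all {T : Type} (p : T -> bool) (l : list T) :
  (forall x, In x l -> p x = true) -> filter p l = l.
Proof.
induction l as [|x l IH]; intros H; [reflexivity|]. simpl. rewrite (H x (or_introl eq_refl)).
f_equal. apply IH. intros y Hy. apply H. now right.
Qed.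

Variables (ls es : nat -> list R) (A : R -> Prop) (r : R -> nat).
Hypothesis ls_S : forall n, ls (S n) = ls n ++ es n.
Hypothesis ls_A : forall n x, In x (ls n) -> A x.
Hypothesis ls_r : forall x, A x -> exists N, forall n, (N <= n)%nat -> countR (ls n) x = r x.

Lemma ls_prefix (n m : nat) : (n <= m)%nat -> exists l, ls m = ls n ++ l.
Proof.
intros H. induction H as [|m H [l IH]]; [exists nil; now rewrite app_nil_r|].
exists (l ++ es m). now rewrite ls_S, IH, app_assoc.
Qed.

Lemma ls_r_list (F : list R) : List.Forall A F ->
  exists N, forall n, (N <= n)%nat -> forall x, In x F -> countR (ls n) x = r x.
Proof.
induction 1 as [|x F Hx HF [N IH]]; [now exists 0%nat|].
destruct (ls_r x Hx) as [N' HN']. exists (max N N'). intros n Hn y [<-|Hy].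
- apply HN'. lia.
- apply IH; [lia|easy].
Qed.

(** If [F] contains all entries of [ls n], the sum over [F] is the sum over a longer list [ls m]
    without its entries outside [F]. Those entries come after the prefix [ls n], so a tail of the
    convergent absolute sums bounds them. *)
Lemma has_sum_prefix_lists (phi : R -> C) (M : R) (S0 : C) :
  (forall n, (Rsum (fun x => Cmod (phi x)) (ls n) <= M)%R) ->
  (forall eps, (0 < eps)%R -> exists N, forall n, (N <= n)%nat -> (Cmod (Csum phi (ls n) - S0) < eps)%R) ->
  has_sum A (fun x => RtoC (INR (r x)) * phi x) S0.
Proof.
intros HM HS eps. set (T := fun n => Rsum (fun x => Cmod (phi x)) (ls n)).
assert (He2 : (0 < eps / 2)%R) by (pose proof (cond_pos eps); lra).
assert (Tinc : forall n, (T n <= T (S n))%R).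
{ intros n. unfold T. rewrite ls_S, Rsum_app.
  assert (0 <= Rsum (fun x => Cmod (phi x)) (es n))%R; [|lra].
  rewrite <- (Rsum_0 (es n)). apply Rsum_le. intros; apply Cmod_ge_0. }
assert (TL : ex_finite_lim_seq T) by (apply ex_finite_lim_seq_incr with M; [exact Tinc|exact HM]).
destruct TL as [tl TL]. assert (TL' := TL). apply is_lim_seq_spec in TL.
destruct (TL (mkposreal _ He2)) as [N0 HN0]. simpl in HN0.
assert (Tle : forall n, (T n <= tl)%R) by (apply is_lim_seq_incr_compare; assumption).
destruct (HS _ He2) as [N1 HN1].
set (n := max N0 N1).
exists (nodup Req_dec_T (ls n)). split; [apply NoDup_nodup|]. split.
{ apply Forall_forall. intros x Hx. apply nodup_In in Hx. now apply ls_A with n. }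
intros F HF HA Hincl.
destruct (ls_r_list F HA) as [N2 HN2].
(* From [m] on every element of [F] is listed with its final multiplicity. *)
set (m := max n N2).
assert (E : Csum (fun x => RtoC (INR (r x)) * phi x) F = Csum phi (filter (memR F) (ls m))).
{ rewrite <- Csum_countR by easy. apply Csum_ext. intros x Hx. now rewrite (HN2 m ltac:(lia) x Hx). }
rewrite E. clear E.
destruct (ls_prefix n m ltac:(lia)) as [rest Er].
assert (P := Csum_filter_partition phi (memR F) (ls m)).
assert (Q : filter (fun x => negb (memR F x)) (ls m) = filter (fun x => negb (memR F x)) rest).
{ rewrite Er, filter_app.
  replace (filter (fun x => negb (memR F x)) (ls n)) with (@nil R); [reflexivity|].
  symmetry. rewrite <- (filter_all (fun x => memR F x) (ls n)) at 1.
  - clear. induction (ls n) as [|x l IH]; simpl; [easy|].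
    destruct (memR F x) eqn:Ex; simpl; [rewrite Ex; simpl|]; exact IH.
  - intros x Hx. unfold memR. destruct (in_dec Req_dec_T x F); [easy|].
    exfalso. apply n0. apply Hincl. now apply nodup_In. }
rewrite Q in P.
assert (B : (Cmod (Csum phi (filter (fun x => negb (memR F x)) rest)) < eps / 2)%R).
{ eapply Rle_lt_trans; [apply Cmod_Csum|].
  eapply Rle_lt_trans; [apply Rsum_filter_le; intros; apply Cmod_ge_0|].
  assert (D : (Rsum (fun x => Cmod (phi x)) rest = T m - T n)%R) by (unfold T; rewrite Er, Rsum_app; ring).
  rewrite D. assert (K := HN0 n ltac:(lia)). apply Rabs_def2 in K. specialize (Tle m). lra. }
assert (B' := HN1 m ltac:(lia)).
replace (Csum phi (filter (memR F) (ls m)) - S0) with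
  ((Csum phi (ls m) - S0) + - Csum phi (filter (fun x => negb (memR F x)) rest)) by (rewrite P; ring).
eapply Rle_lt_trans; [apply Cmod_triangle|]. rewrite Cmod_opp. lra.
Qed.

End Counting.

Lemma is_card_unique {T : Type} (P : T -> Prop) (n m : nat) : is_card P n -> is_card P m -> n = m.
Proof.
intros [l [N [E H]]] [l' [N' [E' H']]]. rewrite <- E, <- E'. apply Permutation_length.
apply NoDup_Permutation; [easy|easy|]. intros x. now rewrite H, H'.
Qed.

Lemma card_eq {T : Type} (P : T -> Prop) (n : nat) : is_card P n -> card P = n.
Proof.
intros H. apply (is_card_unique P); [|exact H]. unfold card.
apply epsilon_spec. now exists n.
Qed.

(** * Finite digit expansions and their values *)

Section Representations.
Variables (beta : R) (d d' : list R).
Hypothesis Hbeta : (1 < beta)%R.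
Hypothesis Hperm : Permutation d (0%R :: d').
Hypothesis Hd' : forall x, In x d' -> (0 < x)%R.
Hypothesis Hnd : NoDup d.

(* Positive values of expansions, with multiplicity, grouped by their leading nonzero digit so that
   [values n] is a prefix of [values (S n)]. *)
Fixpoint values (n : nat) : list R :=
  match n with
  | O => nil
  | S n => values n ++ flat_map (fun x => map (fun v => (v + x * beta ^ n)%R) (0%R :: values n)) d'
  end.

Definition new_values (n : nat) : list R :=
  flat_map (fun x => map (fun v => (v + x * beta ^ n)%R) (0%R :: values n)) d'.

Lemma values_S (n : nat) : values (S n) = values n ++ new_values n.
Proof. reflexivity. Qed.

Lemma pow_beta_pos (n : nat) : (0 < beta ^ n)%R.
Proof. apply pow_lt. lra. Qed.

Lemma values_pos (n : nat) (v : R) : In v (values n) -> (0 < v)%R.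
Proof.
revert v. induction n as [|n IH]; intros v; [easy|]. rewrite values_S, in_app_iff.
intros [H|H]; [now apply IH|]. unfold new_values in H. apply in_flat_map in H.
destruct H as [x [Hx H]]. apply in_map_iff in H. destruct H as [u [<- Hu]].
assert (P := pow_beta_pos n). assert (Px := Hd' x Hx).
assert (0 <= u)%R by (destruct Hu as [<-|Hu]; [lra|left; now apply IH]). nra.
Qed.

Lemma Dsum_split (y : R) : Dsum d y = (1 + Rsum (fun x => exp (- x * y)) d')%R.
Proof.
unfold Dsum. rewrite (Rsum_Permutation _ _ _ Hperm), Rsum_cons, Ropp_0, Rmult_0_l, exp_0. reflexivity.
Qed.

(** The next factor is 1 plus a sum over the positive digits: the 1 keeps the old values, the rest
    produces [new_values]. *)
Lemma Rsum_values (n : nat) (t : R) : In 0%R d ->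
  (Rsum (fun v => exp (- (v * t))) (values n) = digit_prod_upto beta d n t - 1)%R.
Proof.
intros Hin. induction n as [|n IH]; [simpl; rewrite digit_prod_upto_0; unfold Rsum; simpl; ring|].
rewrite values_S, Rsum_app, digit_prod_upto_S, Dsum_split, IH by easy.
assert (E : (Rsum (fun v => exp (- (v * t))) (new_values n) =
  digit_prod_upto beta d n t * Rsum (fun x => exp (- x * (beta ^ n * t))) d')%R).
{ unfold new_values. rewrite Rsum_flat_map, <- Rsum_scal. apply Rsum_ext. intros x _.
  rewrite Rsum_map, Rsum_cons.
  transitivity (exp (- x * (beta ^ n * t)) + exp (- x * (beta ^ n * t)) * Rsum (fun v => exp (- (v * t))) (values n))%R.
  - rewrite <- Rsum_scal. f_equal; [f_equal; ring|].
    apply Rsum_ext. intros v _. rewrite <- exp_plus. f_equal. ring.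
  - rewrite IH. ring. }
rewrite E. ring.
Qed.

Definition upd (s : nat -> R) (n : nat) (x : R) : nat -> R := fun k => if Nat.eqb k n then x else s k.

(** The recursion of [values], carried out on the digit sequences themselves: the two lists
    correspond entry by entry, so repetitions in [values] count distinct sequences. *)
Fixpoint digit_seqs (n : nat) : list (nat -> R) :=
  match n with
  | O => (fun _ => 0%R) :: nil
  | S n => digit_seqs n ++ flat_map (fun x => map (fun s => upd s n x) (digit_seqs n)) d'
  end.

Definition seq_value (n : nat) (s : nat -> R) : R := Rsum (fun k => (s k * beta ^ k)%R) (seq 0 n).

Lemma In_digits (x : R) : In x d <-> x = 0%R \/ In x d'.
Proof.
split; intros H.
- apply (Permutation_in _ Hperm) in H. destruct H as [H|H]; [left; now symmetry|now right].
- apply (Permutation_in (l := 0%R :: d') (l' := d)); [now symmetry|]. destruct H as [->|H]; [now left|now right].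
Qed.

Lemma upd_same (s : nat -> R) (n : nat) (x : R) : upd s n x n = x.
Proof. unfold upd. now rewrite Nat.eqb_refl. Qed.

Lemma upd_other (s : nat -> R) (n k : nat) (x : R) : k <> n -> upd s n x k = s k.
Proof. intros H. unfold upd. now rewrite (proj2 (Nat.eqb_neq k n) H). Qed.

Lemma In_digit_seqs (n : nat) (s : nat -> R) :
  In s (digit_seqs n) <-> (forall k, In (s k) d) /\ (forall k, (n <= k)%nat -> s k = 0%R).
Proof.
revert s. induction n as [|n IH]; intros s.
- simpl. split.
  + intros [<-|[]]. split; [intros; apply In_digits; now left|easy].
  + intros [_ H]. left. apply functional_extensionality. intros k. symmetry. apply H. lia.
- simpl digit_seqs. rewrite in_app_iff, IH, in_flat_map. split.
  + intros [[H1 H2]|[x [Hx H]]].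
    * split; [easy|]. intros k Hk. apply H2. lia.
    * apply in_map_iff in H. destruct H as [u [<- Hu]]. apply IH in Hu. destruct Hu as [H1 H2].
      split; intros k.
      { destruct (Nat.eq_dec k n) as [->|E]; [rewrite upd_same; apply In_digits; now right|].
        rewrite upd_other by easy. apply H1. }
      { intros Hk. rewrite upd_other by lia. apply H2. lia. }
  + intros [H1 H2]. destruct (Req_dec_T (s n) 0) as [E|E].
    * left. split; [easy|]. intros k Hk. destruct (Nat.eq_dec k n) as [->|Ek]; [exact E|apply H2; lia].
    * right. exists (s n). split.
      { destruct (proj1 (In_digits (s n)) (H1 n)); [contradiction|easy]. }
      apply in_map_iff. exists (upd s n 0%R). split.
      { apply functional_extensionality. intros k. destruct (Nat.eq_dec k n) as [->|Ek].
        - now rewrite upd_same.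
        - now rewrite !upd_other by easy. }
      apply IH. split; intros k.
      { destruct (Nat.eq_dec k n) as [->|Ek]; [rewrite upd_same; apply In_digits; now left|].
        rewrite upd_other by easy. apply H1. }
      { intros Hk. destruct (Nat.eq_dec k n) as [->|Ek]; [apply upd_same|].
        rewrite upd_other by easy. apply H2. lia. }
Qed.

Lemma NoDup_app_intro {T : Type} (l1 l2 : list T) :
  NoDup l1 -> NoDup l2 -> (forall x, In x l1 -> ~ In x l2) -> NoDup (l1 ++ l2).
Proof.
intros H1 H2 H. induction H1 as [|x l Hx Hl IH]; [exact H2|]. simpl. constructor.
- rewrite in_app_iff. intros [A|A]; [contradiction|]. apply (H x); [now left|easy].
- apply IH. intros y Hy. apply H. now right.
Qed.

Lemma NoDup_digit_seqs (n : nat) : NoDup (digit_seqs n).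
Proof.
assert (N' : NoDup d').
{ assert (N : NoDup (0%R :: d')) by (eapply Permutation_NoDup; [exact Hperm|exact Hnd]). now inversion N. }
induction n as [|n IH]; [repeat constructor; easy|]. simpl.
assert (Z : forall s, In s (digit_seqs n) -> s n = 0%R) by (intros s Hs; apply In_digit_seqs in Hs; now apply Hs).
apply NoDup_app_intro; [exact IH| |].
- assert (K : forall l, NoDup l -> NoDup (flat_map (fun x => map (fun s => upd s n x) (digit_seqs n)) l)).
  { induction 1 as [|x l Hx Hl IHl]; [constructor|]. simpl. apply NoDup_app_intro; [|exact IHl|].
    - clear - IH Z. induction IH as [|s l Hs Hl IHs]; [constructor|]. simpl. constructor.
      + rewrite in_map_iff. intros [u [E Hu]]. apply Hs. replace s with u; [exact Hu|].
        apply functional_extensionality. intros k. destruct (Nat.eq_dec k n) as [->|Ek].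
        * rewrite (Z s), (Z u); [easy|now right|now left].
        * rewrite <- (upd_other u n k x Ek), E. now apply upd_other.
      + apply IHs. intros u Hu. apply Z. now right.
    - intros s H1 H2. apply in_map_iff in H1. destruct H1 as [u [<- _]].
      apply in_flat_map in H2. destruct H2 as [y [Hy H2]]. apply in_map_iff in H2.
      destruct H2 as [u' [E _]]. apply (f_equal (fun f => f n)) in E. rewrite !upd_same in E.
      subst y. contradiction. }
  now apply K.
- intros s H1 H2. apply Z in H1. apply in_flat_map in H2. destruct H2 as [x [Hx H2]].
  apply in_map_iff in H2. destruct H2 as [u [<- _]]. rewrite upd_same in H1.
  specialize (Hd' x Hx). lra.
Qed.

Lemma map_seq_value (n : nat) : map (seq_value n) (digit_seqs n) = 0%R :: values n.
Proof.
induction n as [|n IH]; [reflexivity|].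
simpl digit_seqs. rewrite values_S, map_app, app_comm_cons. f_equal.
- rewrite <- IH. apply map_ext_in. intros s Hs. apply In_digit_seqs in Hs.
  unfold seq_value. rewrite Rsum_seq_S. simpl (0 + n)%nat. rewrite (proj2 Hs n) by lia. ring.
- unfold new_values. rewrite <- IH.
  clear IH Hperm Hd'. induction d' as [|x l IHl]; [reflexivity|]. simpl. rewrite map_app, IHl. f_equal.
  rewrite !map_map. apply map_ext. intros s. unfold seq_value. rewrite Rsum_seq_S. simpl (0 + n)%nat.
  rewrite upd_same. f_equal. apply Rsum_ext. intros k Hk. apply in_seq in Hk. now rewrite upd_other by lia.
Qed.

Lemma countR_map_filter (f : (nat -> R) -> R) (l : list (nat -> R)) (x : R) :
  countR (map f l) x = length (filter (fun s => if Req_dec_T (f s) x then true else false) l).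
Proof.
unfold countR. induction l as [|s l IH]; simpl; [reflexivity|].
destruct (Req_dec_T (f s) x); simpl; now rewrite IH.
Qed.

Lemma is_series_eventually_0 (u : nat -> R) (n : nat) :
  (forall k, (n <= k)%nat -> u k = 0%R) -> is_series u (Rsum u (seq 0 n)).
Proof.
intros H. destruct n as [|n].
- apply is_series_ext with (a := fun _ => 0%R); [intros k; symmetry; apply H; lia|apply is_series_zero].
- rewrite <- Rsum_sum_f_R0. change (is_lim_seq (sum_n u) (Finite (sum_f_R0 u n))).
  apply (is_lim_seq_ext_loc (fun _ => sum_f_R0 u n)); [|apply is_lim_seq_const].
  exists n. intros m Hm. rewrite sum_n_Reals. induction Hm as [|m Hm IH]; [reflexivity|].
  simpl. rewrite <- IH, H by lia. symmetry. apply Rplus_0_r.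
Qed.

Lemma is_series_term_le (u : nat -> R) (l : R) (k : nat) :
  (forall n, (0 <= u n)%R) -> is_series u l -> (u k <= l)%R.
Proof.
intros Hu Hs.
assert (A : (sum_n u k <= l)%R).
{ apply (is_lim_seq_incr_compare (sum_n u) l Hs). intros n. rewrite sum_Sn. unfold plus; simpl.
  specialize (Hu (S n)). lra. }
eapply Rle_trans; [|exact A]. rewrite sum_n_Reals. destruct k as [|k]; simpl; [lra|].
assert (0 <= sum_f_R0 u k)%R by (apply cond_pos_sum; exact Hu). lra.
Qed.

Lemma digit_lower_bound : exists m, (0 < m)%R /\ forall x, In x d' -> (m <= x)%R.
Proof.
clear Hperm. induction d' as [|x l IH]; [exists 1%R; split; [lra|easy]|].
destruct IH as [m [Hm H]]; [intros y Hy; apply Hd'; now right|].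
exists (Rmin m x). split; [apply Rmin_pos; [easy|apply Hd'; now left]|].
intros y [<-|Hy]; [apply Rmin_r|]. eapply Rle_trans; [apply Rmin_l|now apply H].
Qed.

(** A nonzero digit at a position [k >= n] alone contributes at least [m beta^n], where [m] bounds
    the nonzero digits from below. Once this exceeds [x], every representation of [x] has only zeros
    from position [n] on and so occurs in [digit_seqs n]. *)
Lemma rep_count_countR (x : R) : (0 < x)%R ->
  exists N, forall n, (N <= n)%nat -> countR (values n) x = rep_count (fun k => (beta ^ k)%R) d x.
Proof.
intros Hx. destruct digit_lower_bound as [m [Hm Hlow]].
(* This choice of [N] gives [m beta^n >= x + m > x]. *)
destruct (Pow_x_infinity beta ltac:(rewrite Rabs_pos_eq; lra) (x / m + 1)) as [N HN].
exists N. intros n Hn. specialize (HN n Hn). rewrite Rabs_pos_eq in HN by (left; apply pow_beta_pos).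
assert (Hbig : (x < m * beta ^ n)%R).
{ apply Rge_le, (Rmult_le_compat_l m) in HN; [|lra].
  replace (m * (x / m + 1))%R with (x + m)%R in HN by (field; lra). lra. }
symmetry. apply card_eq.
exists (filter (fun s => if Req_dec_T (seq_value n s) x then true else false) (digit_seqs n)).
split; [apply NoDup_filter, NoDup_digit_seqs|]. split.
(* The value 0 at the head of the list is not counted, because [x > 0]. *)
{ rewrite <- countR_map_filter, map_seq_value. unfold countR. simpl.
  destruct (Req_dec_T 0 x); [lra|reflexivity]. }
intros s. rewrite filter_In, In_digit_seqs. split.
- intros [[H1 H2] H3]. destruct (Req_dec_T (seq_value n s) x) as [E|E]; [|easy].
  split; [exact H1|]. rewrite <- E. unfold seq_value. apply (is_series_eventually_0 (fun k => s k * beta ^ k)%R).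
  intros k Hk. rewrite H2 by easy. apply Rmult_0_l.
- intros [H1 H2].
  assert (Hnn : forall k, (0 <= s k)%R).
  { intros k. destruct (proj1 (In_digits (s k)) (H1 k)) as [->|H]; [lra|left; now apply Hd']. }
  assert (H3 : forall k, (n <= k)%nat -> s k = 0%R).
  { intros k Hk. destruct (proj1 (In_digits (s k)) (H1 k)) as [->|H]; [easy|]. exfalso.
    assert (T := is_series_term_le (fun k => s k * beta ^ k)%R x k
      (fun j => Rmult_le_pos _ _ (Hnn j) (Rlt_le _ _ (pow_beta_pos j))) H2). simpl in T.
    assert (P : (beta ^ n <= beta ^ k)%R) by (apply Rle_pow; [lra|easy]).
    assert (Q := pow_beta_pos n). specialize (Hlow _ H). nra. }
  split; [now split|]. destruct (Req_dec_T (seq_value n s) x) as [E|E]; [easy|]. exfalso. apply E.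
  assert (F := is_series_eventually_0 (fun k => s k * beta ^ k)%R n
    (fun k Hk => eq_trans (f_equal (fun z => (z * beta ^ k)%R) (H3 k Hk)) (Rmult_0_l _))).
  rewrite <- (is_series_unique _ _ H2). symmetry. now apply is_series_unique.
Qed.

Lemma rep_count_values (n : nat) (x : R) : In x (values n) ->
  (0 < rep_count (fun k => (beta ^ k)%R) d x)%nat.
Proof.
intros H. destruct (rep_count_countR x (values_pos n x H)) as [N HN].
rewrite <- (HN (max n N)) by lia. apply count_occ_In.
assert (Hm : (n <= max n N)%nat) by lia.
induction Hm as [|m Hm IH]; [exact H|]. rewrite values_S, in_app_iff. now left.
Qed.

Lemma has_sum_values (phi : R -> C) (M : R) (S0 : C) :
  (forall n, (Rsum (fun x => Cmod (phi x)) (values n) <= M)%R) ->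
  (forall eps, (0 < eps)%R -> exists N, forall n, (N <= n)%nat -> (Cmod (Csum phi (values n) - S0) < eps)%R) ->
  has_sum (fun x => (0 < x)%R /\ (0 < rep_count (fun k => (beta ^ k)%R) d x)%nat)
    (fun x => RtoC (INR (rep_count (fun k => (beta ^ k)%R) d x)) * phi x) S0.
Proof.
apply has_sum_prefix_lists with (es := new_values).
- apply values_S.
- intros n x Hx. split; [now apply values_pos with n|now apply rep_count_values with n].
- intros x [Hx _]. now apply rep_count_countR.
Qed.

End Representations.

(** * The zeta function as a Mellin transform *)

Lemma is_CInt_scale (Fa Fb Fa' Fb' : (R -> Prop) -> Prop) {FFa : Filter Fa} {FFb : Filter Fb}
  (f : R -> C) (k : R) (l : C) :
  filterlim (fun t => (k * t)%R) Fa Fa' -> filterlim (fun t => (k * t)%R) Fb Fb' ->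
  is_CInt f Fa' Fb' l -> is_CInt (fun t => RtoC k * f (k * t)%R) Fa Fb l.
Proof.
intros La Lb H P HP. specialize (H P HP). unfold filtermapi in *.
destruct H as [Q S0 HQ HS H].
apply Filter_prod with (fun a => Q (k * a)%R) (fun b => S0 (k * b)%R); [now apply La|now apply Lb|].
intros a b Ha Hb. destruct (H _ _ Ha Hb) as [y [Hy Py]]. simpl in *. exists y. split; [|exact Py].
apply is_RInt_ext with (f := fun t => scal (V := C_R_NormedModule) k (f (k * t + 0)%R)).
- intros t _. rewrite Rplus_0_r. unfold scal; simpl. unfold prod_scal, scal; simpl. unfold mult; simpl.
  unfold Cmult, RtoC; simpl. f_equal; ring_R.
- apply (is_RInt_comp_lin (V := C_R_NormedModule)). now rewrite !Rplus_0_r.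
Qed.

Lemma filterlim_scale_right_0 (k : R) : (0 < k)%R -> filterlim (fun t => (k * t)%R) (at_right 0) (at_right 0).
Proof.
intros Hk P [e He]. assert (Hd : (0 < e / k)%R) by (apply Rdiv_lt_0_compat; [apply cond_pos|easy]).
exists (mkposreal _ Hd). intros t Ht Ht0. apply He; [|nra].
apply Rabs_def2 in Ht. simpl in Ht. unfold minus, plus, opp in Ht; simpl in Ht.
unfold ball; simpl. unfold AbsRing_ball, abs, minus, plus, opp; simpl. rewrite Rabs_pos_eq by nra.
destruct Ht as [Ht _]. apply (Rmult_lt_compat_l k) in Ht; [|easy].
replace (k * (e / k))%R with (pos e) in Ht by (field; lra). lra.
Qed.

Lemma filterlim_scale_infty (k : R) : (0 < k)%R ->
  filterlim (fun t => (k * t)%R) (Rbar_locally p_infty) (Rbar_locally p_infty).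
Proof.
intros Hk P [M HM]. exists (M / k)%R. intros t Ht. apply HM.
apply (Rmult_lt_compat_l k) in Ht; [|easy]. replace (k * (M / k))%R with M in Ht by (field; lra). exact Ht.
Qed.

Lemma filterlim_scale_point (k a : R) : filterlim (fun t => (k * t)%R) (at_point a) (at_point (k * a)%R).
Proof. intros P HP. exact HP. Qed.

Lemma cpow_opp_scale (k t : R) (s z : C) : (0 < k)%R -> (0 < t)%R ->
  cpow k (- s) * (RtoC k * (z * cpow (k * t) (s - 1))) = z * cpow t (s - 1).
Proof.
intros Hk Ht. rewrite cpow_mult by easy.
assert (E : cpow k (- s) * (RtoC k * cpow k (s - 1)) = 1).
{ rewrite <- (cpow_1 k Hk) at 1. rewrite <- !cpow_plus. replace (- s + (1 + (s - 1))) with (RtoC 0) by ring.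
  apply cpow_0. }
replace (cpow k (- s) * (RtoC k * (z * (cpow k (s - 1) * cpow t (s - 1)))))
  with ((cpow k (- s) * (RtoC k * cpow k (s - 1))) * (z * cpow t (s - 1))) by ring.
rewrite E. ring.
Qed.

Lemma is_mellin_exp_infty (k a : R) (s : C) : (0 < k)%R -> (0 < a)%R ->
  is_CInt (fun t => RtoC (exp (- (k * t))) * cpow t (s - 1)) (at_point a) (Rbar_locally p_infty)
    (cpow k (- s) * inc_Gamma s (k * a)).
Proof.
intros Hk Ha. assert (HD := idom_point_infty a Ha).
assert (Hka : (0 < k * a)%R) by nra.
assert (I := is_mellin (idom_point_infty (k * a) Hka) expneg (fun t _ => continuous_expneg t) s
  (expneg_conv_infty (k * a) (Re s) Hka)).
apply (is_CInt_scale (at_point a) (Rbar_locally p_infty) _ _ _ k) in I.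
- apply (is_CInt_Cmult HD _ (cpow k (- s))) in I.
  apply (is_CInt_ext HD) with (2 := I). intros t Ht. apply cpow_opp_scale; lra.
- apply filterlim_scale_point.
- now apply filterlim_scale_infty.
Qed.

Lemma is_mellin_exp (k : R) (s : C) : (0 < k)%R -> (0 < Re s)%R ->
  is_CInt (fun t => RtoC (exp (- (k * t))) * cpow t (s - 1)) (at_right 0) (Rbar_locally p_infty)
    (cpow k (- s) * Gamma_int s).
Proof.
intros Hk Hs. assert (HD := idom_0_infty).
assert (I := is_Gamma s Hs).
apply (is_CInt_scale (at_right 0) (Rbar_locally p_infty) _ _ _ k) in I.
- apply (is_CInt_Cmult HD _ (cpow k (- s))) in I.
  apply (is_CInt_ext HD) with (2 := I). intros t Ht. now apply cpow_opp_scale.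
- now apply filterlim_scale_right_0.
- now apply filterlim_scale_infty.
Qed.

Section IntegralSums.
Context {Fa Fb : (R -> Prop) -> Prop} {Dm : R -> Prop} (HD : idom Fa Fb Dm).

Let FFa : ProperFilter Fa := idom_pa _ _ _ HD.
Let FFb : ProperFilter Fb := idom_pb _ _ _ HD.
Local Existing Instance FFa.
Local Existing Instance FFb.

Lemma is_CInt_zero : is_CInt (fun _ => RtoC 0) Fa Fb (RtoC 0).
Proof.
assert (Z : is_CInt (fun _ => RtoC 0) Fa Fb (RtoC 0 - RtoC 0)).
{ apply (is_CInt_cder HD (fun _ => RtoC 0)).
  - intros t _. apply cder_const.
  - intros t _. apply continuous_const.
  - apply filterlim_const.
  - apply filterlim_const. }
replace (RtoC 0 - RtoC 0) with (RtoC 0) in Z by ring. exact Z.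
Qed.

Lemma is_CInt_Csum {T : Type} (f : T -> R -> C) (l : T -> C) (xs : list T) :
  (forall x, In x xs -> is_CInt (f x) Fa Fb (l x)) ->
  is_CInt (fun t => Csum (fun x => f x t) xs) Fa Fb (Csum l xs).
Proof.
induction xs as [|x xs IH]; intros H; [exact is_CInt_zero|].
apply (is_CInt_plus HD (f x)); [apply H; now left|]. apply IH. intros y Hy. apply H. now right.
Qed.

Lemma is_RInt_gen_Rsum {T : Type} (f : T -> R -> R) (l : T -> R) (xs : list T) :
  (forall x, In x xs -> is_RInt_gen (V := R_NormedModule) (f x) Fa Fb (l x)) ->
  is_RInt_gen (V := R_NormedModule) (fun t => Rsum (fun x => f x t) xs) Fa Fb (Rsum l xs).
Proof.
induction xs as [|x xs IH]; intros H.
- exact (is_CInt_Re HD _ _ is_CInt_zero).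
- apply (is_RInt_gen_plus (V := R_NormedModule) (f x)); [apply H; now left|].
  apply IH. intros y Hy. apply H. now right.
Qed.

End IntegralSums.

(** * Termwise integration of the partial expansions *)

Section DirichletIntegrals.
Variables (beta : R) (d d' : list R).
Hypothesis Hbeta : (1 < beta)%R.
Hypothesis Hnd : NoDup d.
Hypothesis Hd0 : forall delta, In delta d -> (0 <= delta)%R.
Hypothesis Hin : In 0%R d.
Hypothesis Hlen : (2 <= length d)%nat.
Hypothesis Hperm : Permutation d (0%R :: d').
Hypothesis Hd' : forall x, In x d' -> (0 < x)%R.

Notation L := (Lexp beta d).
Notation vals := (values beta d').
Notation F1 := (fun t => (digit_prod beta d t - 1)%R).

Context {Fa Fb : (R -> Prop) -> Prop} {Dm : R -> Prop} (HD : idom Fa Fb Dm).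

Let FFa : ProperFilter Fa := idom_pa _ _ _ HD.
Let FFb : ProperFilter Fb := idom_pb _ _ _ HD.
Local Existing Instance FFa.
Local Existing Instance FFb.

Lemma continuous_F1 (t : R) : (0 < t)%R -> continuous F1 t.
Proof.
intros Ht. apply continuous_Rplus; [now apply continuous_digit_prod|apply continuous_const].
Qed.

Lemma digit_prod_upto_between (n : nat) (t : R) : (0 < t)%R -> (0 <= digit_prod_upto beta d n t - 1 <= digit_prod beta d t - 1)%R.
Proof.
intros Ht. split.
- rewrite <- (Rsum_values beta d d') by easy.
  rewrite <- (Rsum_0 (vals n)). apply Rsum_le. intros; left; apply exp_pos.
- destruct (digit_prod_upto_bound beta d Hbeta Hnd Hd0 Hin 1 Rlt_0_1) as (K & x & _ & _ & H).
  specialize (H n t Ht). lra.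
Qed.

Lemma is_CInt_values (s : C) (l : R -> C) (n : nat) :
  (forall v, (0 < v)%R -> is_CInt (fun t => RtoC (exp (- (v * t))) * cpow t (s - 1)) Fa Fb (l v)) ->
  is_CInt (fun t => RtoC (digit_prod_upto beta d n t - 1) * cpow t (s - 1)) Fa Fb (Csum l (vals n)).
Proof.
intros H.
assert (I := is_CInt_Csum HD _ l (vals n) (fun v Hv => H v (values_pos beta d' Hbeta Hd' n v Hv))).
apply (is_CInt_ext HD) with (2 := I). intros t _.
rewrite <- (Rsum_values beta d d') by easy. rewrite <- Csum_RtoC.
rewrite (Cmult_comm _ (cpow t (s - 1))), <- Csum_scal. apply Csum_ext. intros v _. ring.
Qed.

(** The estimate [digit_prod_upto_bound] is integrated against [t^(Re s - 1)]. The parameter [eta]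
    moves the abscissa of the majorant: towards infinity it must be large, because [F] tends to 1
    there; near 0 it must be small, because [F] grows like [t^(-L)]. *)
Lemma Csum_values_lim (s : C) (l : R -> C) (eta : R) : (0 < eta)%R ->
  (forall v, (0 < v)%R -> is_CInt (fun t => RtoC (exp (- (v * t))) * cpow t (s - 1)) Fa Fb (l v)) ->
  mellin_conv F1 Fa Fb (Re s) -> mellin_conv (digit_prod beta d) Fa Fb (Re s - eta) ->
  forall eps, (0 < eps)%R -> exists N, forall n, (N <= n)%nat ->
    (Cmod (Csum l (vals n) - mellin F1 Fa Fb s) < eps)%R.
Proof.
intros He Hl H1 [m Hm] eps Heps.
assert (J := is_mellin HD F1 (fun t Ht => continuous_F1 t (idom_pos _ _ _ HD t Ht)) s H1).
destruct (digit_prod_upto_bound beta d Hbeta Hnd Hd0 Hin eta He) as (K & x & HK & Hx & HF).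
assert (B : forall n, (Cmod (Csum l (vals n) - mellin F1 Fa Fb s) <= K * x ^ n * m)%R).
{ intros n. assert (I := is_CInt_values s l n Hl).
  assert (D := is_CInt_plus HD _ _ _ _ I (is_CInt_Cmult HD _ (- (1)) _ J)).
  replace (Csum l (vals n) - mellin F1 Fa Fb s) with (Csum l (vals n) + - (1) * mellin F1 Fa Fb s) by ring.
  assert (Hm' := is_RInt_gen_scal (V := R_NormedModule) _ (K * x ^ n)%R _ Hm).
  apply (is_CInt_norm HD) with (2 := D) (3 := Hm'). intros t Ht.
  assert (Ht0 := idom_pos _ _ _ HD t Ht).
  replace (RtoC (digit_prod_upto beta d n t - 1) * cpow t (s - 1) + - (1) * (RtoC (digit_prod beta d t - 1) * cpow t (s - 1)))
    with (RtoC (- (digit_prod beta d t - digit_prod_upto beta d n t)) * cpow t (s - 1)).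
  2:{ rewrite RtoC_opp, !RtoC_minus. ring. }
  rewrite Cmod_mult, Cmod_R, Cmod_cpow, Rabs_Ropp. change (Re (s - 1)) with (Re s - 1)%R. specialize (HF n t Ht0).
  rewrite Rabs_pos_eq by easy.
  match goal with |- (_ <= scal ?c ?x)%R => change (scal c x) with (c * x)%R end.
  rewrite Rabs_pos_eq by (pose proof (digit_prod_ge_1 beta d Hbeta Hnd Hd0 Hin t Ht0); lra).
  replace (Re s - eta - 1)%R with (- eta + (Re s - 1))%R by ring. rewrite Rpower_plus.
  replace (K * x ^ n * (digit_prod beta d t * (Rpower t (- eta) * Rpower t (Re s - 1))))%R
    with (K * x ^ n * (digit_prod beta d t * Rpower t (- eta)) * Rpower t (Re s - 1))%R by ring.
  apply Rmult_le_compat_r; [left; apply exp_pos|easy]. }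
destruct (geom_small (K * Rabs m) x (eps / 2) Hx ltac:(lra)) as [N HN].
exists N. intros n Hn. eapply Rle_lt_trans; [apply B|].
apply Rle_lt_trans with (eps / 2)%R; [|lra]. eapply Rle_trans; [|exact HN].
assert (X : (x ^ n <= x ^ N)%R) by (apply pow_le_pow_le1; [lra|easy]).
assert (X0 : (0 <= x ^ n)%R) by now apply pow_le.
assert (M1 := Rle_abs m). assert (M0 := Rabs_pos m).
apply Rle_trans with (K * x ^ n * Rabs m)%R.
- apply Rmult_le_compat_l; [nra|easy].
- replace (K * Rabs m * x ^ N)%R with (K * x ^ N * Rabs m)%R by ring.
  apply Rmult_le_compat_r; [easy|]. apply Rmult_le_compat_l; lra.
Qed.

(** By positivity the integrals of the absolute values over a finite list add up to at most the
    integral of [F - 1] at the abscissa [Re s]. *)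
Lemma Rsum_values_bounded (s : C) (l : R -> C) :
  (forall v, (0 < v)%R -> is_CInt (fun t => RtoC (exp (- (v * t))) * cpow t (s - 1)) Fa Fb (l v)) ->
  (forall v, (0 < v)%R -> mellin_conv (fun t => exp (- (v * t))) Fa Fb (Re s)) ->
  mellin_conv F1 Fa Fb (Re s) ->
  exists M, forall n, (Rsum (fun v => Cmod (l v)) (vals n) <= M)%R.
Proof.
intros Hl Hc [M HM]. exists M. intros n.
set (rho := fun v => RInt_gen (V := R_CompleteNormedModule)
  (fun t => Rabs (exp (- (v * t))) * Rpower t (Re s - 1))%R Fa Fb).
assert (Hr : forall v, (0 < v)%R -> is_RInt_gen (V := R_NormedModule)
  (fun t => Rabs (exp (- (v * t))) * Rpower t (Re s - 1))%R Fa Fb (rho v)).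
{ intros v Hv. apply (RInt_gen_correct (V := R_CompleteNormedModule)). now apply Hc. }
apply Rle_trans with (Rsum rho (vals n)).
- apply Rsum_le. intros v Hv. apply (values_pos beta d' Hbeta Hd') in Hv.
  apply (is_CInt_norm HD) with (2 := Hl v Hv) (3 := Hr v Hv). intros t _.
  rewrite (Cmod_mellin_kernel (fun t => exp (- (v * t)))). lra.
- assert (I := is_RInt_gen_Rsum HD _ rho (vals n) (fun v Hv => Hr v (values_pos beta d' Hbeta Hd' n v Hv))).
  apply (is_RInt_gen_le_dom HD) with (2 := I) (3 := HM). intros t Ht.
  assert (Ht0 := idom_pos _ _ _ HD t Ht).
  apply Rle_trans with ((digit_prod_upto beta d n t - 1) * Rpower t (Re s - 1))%R.
  + right. rewrite <- (Rsum_values beta d d') by easy.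
    rewrite Rmult_comm, <- Rsum_scal. apply Rsum_ext. intros v _.
    rewrite Rabs_pos_eq by (left; apply exp_pos). ring.
  + apply Rmult_le_compat_r; [left; apply exp_pos|]. assert (B := digit_prod_upto_between n t Ht0).
    rewrite Rabs_pos_eq; lra.
Qed.

End DirichletIntegrals.

Section Zeta.
Variables (beta : R) (d d' : list R).
Hypothesis Hbeta : (1 < beta)%R.
Hypothesis Hnd : NoDup d.
Hypothesis Hd0 : forall delta, In delta d -> (0 <= delta)%R.
Hypothesis Hin : In 0%R d.
Hypothesis Hlen : (2 <= length d)%nat.
Hypothesis Hperm : Permutation d (0%R :: d').
Hypothesis Hd' : forall x, In x d' -> (0 < x)%R.
Variable a : R.
Hypothesis Ha : (0 < a)%R.

Notation L := (Lexp beta d).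
Notation vals := (values beta d').
Notation F1 := (fun t => (digit_prod beta d t - 1)%R).
Notation rep := (rep_count (fun k => (beta ^ k)%R) d).

Lemma Lexp_pos : (0 < L)%R.
Proof.
unfold Lexp. apply Rdiv_lt_0_compat; [|now apply ln_beta_pos].
rewrite <- ln_1. apply ln_increasing; [lra|]. change 1%R with (INR 1). apply lt_INR. lia.
Qed.

Lemma F1_conv_infty (p : R) : mellin_conv F1 (at_point a) (Rbar_locally p_infty) p.
Proof.
destruct (digit_prod_sub1_bound beta d Hbeta Hnd Hd0 Hin (Rabs p + 1)) as [K [HK H]].
{ pose proof (Rabs_pos p); lra. }
apply mellin_conv_infty with (K := (K * digit_prod beta d a)%R) (q := (Rabs p + 1)%R); try easy.
- intros t Ht. apply continuous_F1; trivial; lra.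
- intros t Ht. destruct (H t ltac:(lra)) as [H0 H1]. rewrite Rabs_pos_eq by easy.
  eapply Rle_trans; [exact H1|]. apply Rmult_le_compat_r; [left; apply exp_pos|].
  apply Rmult_le_compat_l; [lra|]. now apply digit_prod_decreasing.
- pose proof (Rle_abs p); lra.
Qed.

Lemma digit_prod_conv_infty (p : R) : (p < 0)%R -> mellin_conv (digit_prod beta d) (at_point a) (Rbar_locally p_infty) p.
Proof.
intros Hp.
apply mellin_conv_infty with (K := digit_prod beta d a) (q := 0%R); try easy.
- intros t Ht. apply continuous_digit_prod; trivial; lra.
- intros t Ht. pose proof (digit_prod_ge_1 beta d Hbeta Hnd Hd0 Hin t ltac:(lra)).
  rewrite Rabs_pos_eq, Ropp_0, Rpower_O, Rmult_1_r by lra. now apply digit_prod_decreasing.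
Qed.

Lemma digit_prod_conv_0 (p : R) : (L < p)%R -> mellin_conv (digit_prod beta d) (at_right 0) (at_point a) p.
Proof.
intros Hp. destruct (digit_prod_bound_0 beta d Hbeta Hnd Hd0 Hin Hlen a Ha) as [K [HK H]].
apply mellin_conv_0 with (K := K) (q := L); try easy.
- intros t Ht. apply continuous_digit_prod; trivial; lra.
- intros t Ht. pose proof (digit_prod_ge_1 beta d Hbeta Hnd Hd0 Hin t ltac:(lra)).
  rewrite Rabs_pos_eq by lra. now apply H.
Qed.

Lemma F1_conv_0 (p : R) : (L < p)%R -> mellin_conv F1 (at_right 0) (at_point a) p.
Proof.
intros Hp. destruct (digit_prod_bound_0 beta d Hbeta Hnd Hd0 Hin Hlen a Ha) as [K [HK H]].
apply mellin_conv_0 with (K := K) (q := L); try easy.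
- intros t Ht. apply continuous_F1; trivial; lra.
- intros t Ht. pose proof (digit_prod_ge_1 beta d Hbeta Hnd Hd0 Hin t ltac:(lra)).
  rewrite Rabs_pos_eq by lra. specialize (H t Ht). lra.
Qed.

Definition upper_integral (s : C) : C := mellin F1 (at_point a) (Rbar_locally p_infty) s.

Lemma upper_integral_smooth (s : C) : smooth upper_integral s.
Proof.
apply (mellin_smooth (idom_point_infty a Ha)) with (r := 1%R).
- intros t Ht. apply continuous_F1; trivial; lra.
- lra.
- intros p _. apply F1_conv_infty.
Qed.

Lemma continuous_exp_scal (v t : R) : continuous (fun t => exp (- (v * t))) t.
Proof. apply (ex_derive_continuous (K := R_AbsRing) (V := R_NormedModule)). now auto_derive. Qed.

Lemma exp_scal_conv_infty (v p : R) : (0 < v)%R ->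
  mellin_conv (fun t => exp (- (v * t))) (at_point a) (Rbar_locally p_infty) p.
Proof.
intros Hv. destruct (exp_neg_le_Rpower (Rabs p + 1)) as [K [HK H]].
{ pose proof (Rabs_pos p); lra. }
apply mellin_conv_infty with (K := (K * Rpower v (- (Rabs p + 1)))%R) (q := (Rabs p + 1)%R); try easy.
- intros; apply continuous_exp_scal.
- intros t Ht. rewrite Rabs_pos_eq by (left; apply exp_pos).
  rewrite Rmult_assoc, Rpower_mult_distr by lra. apply H. nra.
- pose proof (Rle_abs p); lra.
Qed.

Lemma exp_scal_conv_0 (v p : R) : (0 < v)%R -> (0 < p)%R ->
  mellin_conv (fun t => exp (- (v * t))) (at_right 0) (at_point a) p.
Proof.
intros Hv Hp. apply mellin_conv_0 with (K := 1%R) (q := 0%R); try easy.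
- intros; apply continuous_exp_scal.
- intros t Ht. rewrite Rabs_pos_eq by (left; apply exp_pos).
  rewrite Ropp_0, Rpower_O, Rmult_1_r, <- exp_0 by lra. left; apply exp_increasing. nra.
Qed.

Lemma has_sum_inc_Gamma (s : C) :
  has_sum (fun x => (0 < x)%R /\ (0 < rep x)%nat)
    (fun x => RtoC (INR (rep x)) / cpow x s * inc_Gamma s (x * a)) (upper_integral s).
Proof.
assert (HD := idom_point_infty a Ha).
set (l := fun v => cpow v (- s) * inc_Gamma s (v * a)).
assert (Hl : forall v, (0 < v)%R ->
  is_CInt (fun t => RtoC (exp (- (v * t))) * cpow t (s - 1)) (at_point a) (Rbar_locally p_infty) (l v)).
{ intros v Hv. now apply is_mellin_exp_infty. }
destruct (Rsum_values_bounded beta d d' Hbeta Hnd Hd0 Hin Hperm Hd' HD s l Hl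
  (fun v Hv => exp_scal_conv_infty v (Re s) Hv) (F1_conv_infty (Re s))) as [M HM].
assert (A : has_sum (fun x => (0 < x)%R /\ (0 < rep x)%nat) (fun x => RtoC (INR (rep x)) * l x) (upper_integral s)).
{ apply (has_sum_values beta d d' Hbeta Hperm Hd' Hnd l M); [exact HM|].
  (* With this [eta] the abscissa [Re s - eta] is negative, which makes [F] integrable towards
     infinity. *)
  assert (He : (0 < Rabs (Re s) + 1)%R) by (pose proof (Rabs_pos (Re s)); lra).
  apply (Csum_values_lim beta d d' Hbeta Hnd Hd0 Hin Hperm Hd' HD s l _ He Hl); [apply F1_conv_infty|].
  apply digit_prod_conv_infty. pose proof (Rle_abs (Re s)). lra. }
replace (fun x => RtoC (INR (rep x)) / cpow x s * inc_Gamma s (x * a))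
  with (fun x => RtoC (INR (rep x)) * l x); [exact A|].
apply functional_extensionality. intros x. unfold l. rewrite cpow_opp. unfold Cdiv. ring.
Qed.

(** No [eta] makes [F(t) t^(Re s - eta - 1)] integrable on all of [(0, oo)]: the behaviour at 0 asks
    for an abscissa above [L], that at infinity for one below 0. So every single term is split at
    [a] as well, and the two limits are taken separately. *)
Lemma is_zeta_integral (s : C) : (L < Re s)%R ->
  is_zeta (fun k => (beta ^ k)%R) d s
    (inv_Gamma s * (mellin F1 (at_right 0) (at_point a) s + upper_integral s)).
Proof.
intros Hs. assert (L0 := Lexp_pos). assert (Hs0 : (0 < Re s)%R) by lra.
assert (HD0 := idom_0_point a Ha). assert (HD1 := idom_point_infty a Ha). assert (HD := idom_0_infty).
set (l := fun v => cpow v (- s) * Gamma_int s).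
set (l1 := fun v => cpow v (- s) * inc_Gamma s (v * a)).
set (l0 := fun v => mellin (fun t => exp (- (v * t))) (at_right 0) (at_point a) s).
assert (Hl : forall v, (0 < v)%R ->
  is_CInt (fun t => RtoC (exp (- (v * t))) * cpow t (s - 1)) (at_right 0) (Rbar_locally p_infty) (l v)).
{ intros v Hv. now apply is_mellin_exp. }
assert (Hl1 : forall v, (0 < v)%R ->
  is_CInt (fun t => RtoC (exp (- (v * t))) * cpow t (s - 1)) (at_point a) (Rbar_locally p_infty) (l1 v)).
{ intros v Hv. now apply is_mellin_exp_infty. }
assert (Hl0 : forall v, (0 < v)%R ->
  is_CInt (fun t => RtoC (exp (- (v * t))) * cpow t (s - 1)) (at_right 0) (at_point a) (l0 v)).
{ intros v Hv. apply (is_mellin HD0); [intros; apply continuous_exp_scal|now apply exp_scal_conv_0]. }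
assert (El : forall v, (0 < v)%R -> l v = l0 v + l1 v).
{ intros v Hv. rewrite <- (is_CInt_unique HD _ _ (Hl v Hv)). apply (is_CInt_unique HD).
  apply (is_RInt_gen_Chasles (V := C_R_NormedModule)) with (b := a); [now apply Hl0|now apply Hl1]. }
assert (G := Gamma_int_neq_0 s Hs0). assert (G' := G). apply Cmod_gt_0 in G'.
destruct (Rsum_values_bounded beta d d' Hbeta Hnd Hd0 Hin Hperm Hd' HD s l Hl) as [M HM].
{ intros v Hv. apply mellin_conv_Chasles with a; [now apply exp_scal_conv_0|now apply exp_scal_conv_infty]. }
{ apply mellin_conv_Chasles with a; [now apply F1_conv_0|apply F1_conv_infty]. }
unfold is_zeta.
apply (has_sum_values beta d d' Hbeta Hperm Hd' Hnd (fun x => cpow x (- s)) (M / Cmod (Gamma_int s))).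
- intros n. apply Rle_div_r; [easy|]. rewrite Rmult_comm, <- Rsum_scal.
  eapply Rle_trans; [|apply (HM n)]. apply Rsum_le. intros v _. unfold l. rewrite Cmod_mult. lra.
- intros eps Heps.
  assert (He1 : (0 < Rabs (Re s) + 1)%R) by (pose proof (Rabs_pos (Re s)); lra).
  assert (Heps' : (0 < eps * Cmod (Gamma_int s) / 2)%R) by (apply Rdiv_lt_0_compat; nra).
  assert (Hneg : (Re s - (Rabs (Re s) + 1) < 0)%R) by (pose proof (Rle_abs (Re s)); lra).
  destruct (Csum_values_lim beta d d' Hbeta Hnd Hd0 Hin Hperm Hd' HD1 s l1 _ He1 Hl1
    (F1_conv_infty (Re s)) (digit_prod_conv_infty _ Hneg) _ Heps') as [N1 HN1].
  (* Half the distance to [L] keeps the shifted abscissa above [L]. *)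
  assert (He0 : (0 < (Re s - L) / 2)%R) by lra.
  assert (Hpos : (L < Re s - (Re s - L) / 2)%R) by lra.
  destruct (Csum_values_lim beta d d' Hbeta Hnd Hd0 Hin Hperm Hd' HD0 s l0 _ He0 Hl0
    (F1_conv_0 (Re s) Hs) (digit_prod_conv_0 _ Hpos) _ Heps') as [N0 HN0].
  exists (max N0 N1). intros n Hn.
  assert (E : Csum (fun x => cpow x (- s)) (vals n) =
    / Gamma_int s * (Csum l0 (vals n) + Csum l1 (vals n))).
  { rewrite <- Csum_plus, <- Csum_scal. apply Csum_ext. intros v Hv.
    rewrite <- El by (apply (values_pos beta d' Hbeta Hd' n v Hv)). unfold l. now field. }
  rewrite E, (inv_Gamma_pos s Hs0).
  match goal with |- (Cmod ?z < _)%R => replace z with (/ Gamma_int s *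
    ((Csum l0 (vals n) - mellin F1 (at_right 0) (at_point a) s) + (Csum l1 (vals n) - upper_integral s))) by ring end.
  rewrite Cmod_mult, Cmod_inv by easy.
  assert (A := HN0 n ltac:(lia)). assert (B := HN1 n ltac:(lia)).
  fold (upper_integral s) in B.
  apply (Rmult_lt_reg_l (Cmod (Gamma_int s))); [easy|].
  rewrite <- Rmult_assoc, Rinv_r, Rmult_1_l by lra.
  eapply Rle_lt_trans; [apply Cmod_triangle|]. lra.
Qed.

End Zeta.

(** * The integral near zero *)

Lemma Rpower_nat (t : R) (n : nat) : (0 < t)%R -> Rpower t (INR n) = (t ^ n)%R.
Proof. intros Ht. now apply Rpower_pow. Qed.

Section Continuation.
Variables (beta : R) (d : list R).
Hypothesis Hbeta : (1 < beta)%R.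
Hypothesis Hnd : NoDup d.
Hypothesis Hd0 : forall delta, In delta d -> (0 <= delta)%R.
Hypothesis Hin : In 0%R d.
Hypothesis Hlen : (2 <= length d)%nat.
Variables (sigma : R) (c : nat).
Hypothesis Hsigma : is_sigma beta d sigma.
Hypothesis Hc : (/ beta ^ c < sigma)%R.

Notation L := (Lexp beta d).
Notation a := (/ beta ^ c)%R.
Notation cc := (ccoef beta d).
Notation E := (exp_periodic beta d).
Notation V := (Vsum beta d).

Lemma a_pos : (0 < a)%R.
Proof. apply Rinv_0_lt_compat, pow_lt. lra. Qed.

Let Ha := a_pos.

Definition remainder (N : nat) (t : R) : R :=
  (exp (V t) - Rsum (fun l => cc l * t ^ l) (seq 0 N))%R.

Definition tail_abs (N : nat) : R := Series (fun k => Rabs (cc (N + k)%nat * a ^ (N + k))).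

Lemma ex_series_cc_abs (t : R) : (0 <= t <= a)%R -> ex_series (fun k => Rabs (cc k * t ^ k)).
Proof.
intros Ht. apply CV_disk_inside. apply (CV_radius_ccoef_sigma beta d Hbeta Hd0 Hin Hlen sigma); [easy|].
rewrite Rabs_pos_eq; lra.
Qed.

Lemma ex_series_shift (u : nat -> R) (N : nat) : ex_series u -> ex_series (fun k => u (N + k)%nat).
Proof. apply (ex_series_incr_n (K := R_AbsRing) (V := R_NormedModule) u N). Qed.

Lemma remainder_Series (N : nat) (t : R) : (0 <= t <= a)%R ->
  remainder N t = Series (fun k => cc (N + k)%nat * t ^ (N + k))%R.
Proof.
intros Ht. induction N as [|N IH].
- unfold remainder. simpl seq. rewrite Rsum_nil, Rminus_0_r.
  rewrite (exp_Vsum_PSeries beta d Hbeta Hd0 Hin Hlen sigma t Hsigma) by lra. reflexivity.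
- unfold remainder in *. rewrite Rsum_seq_S. simpl (0 + N)%nat.
  rewrite Series_incr_1 in IH.
  + rewrite Nat.add_0_r in IH.
    transitivity (Series (fun k => cc (N + S k)%nat * t ^ (N + S k))%R); [lra|].
    apply Series_ext. intros k. now replace (N + S k)%nat with (S N + k)%nat by lia.
  + apply (ex_series_shift (fun k => cc k * t ^ k)%R N). apply ex_series_Rabs. now apply ex_series_cc_abs.
Qed.

(** The two indices do different work: the fixed power [t^N0] secures integrability at 0, while
    [tail_abs N] tends to 0 as [N] grows. *)
Lemma remainder_bound (N0 N : nat) (t : R) : (0 < t <= a)%R -> (N0 <= N)%nat ->
  (Rabs (remainder N t) <= t ^ N0 * (/ a ^ N0 * tail_abs N))%R.
Proof.
intros Ht HN. rewrite remainder_Series by lra.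
assert (A : ex_series (fun k => Rabs (cc (N + k)%nat * a ^ (N + k)))).
{ apply (ex_series_shift (fun k => Rabs (cc k * a ^ k)) N). apply ex_series_cc_abs. lra. }
eapply Rle_trans.
{ apply Series_Rabs. apply (ex_series_shift (fun k => Rabs (cc k * t ^ k)) N). apply ex_series_cc_abs. lra. }
unfold tail_abs. rewrite <- Rmult_assoc, <- Series_scal_l. apply Series_le.
- intros k. split; [apply Rabs_pos|]. rewrite !Rabs_mult.
  rewrite (Rabs_pos_eq (t ^ _)) by (apply pow_le; lra). rewrite (Rabs_pos_eq (a ^ _)) by (apply pow_le; lra).
  replace (t ^ N0 * / a ^ N0 * (Rabs (cc (N + k)%nat) * a ^ (N + k)))%R
    with (Rabs (cc (N + k)%nat) * (t ^ N0 * / a ^ N0 * a ^ (N + k)))%R by ring.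
  apply Rmult_le_compat_l; [apply Rabs_pos|].
  replace (N + k)%nat with (N0 + (N + k - N0))%nat by lia. rewrite !pow_add.
  assert (P : (a ^ N0 <> 0)%R) by (apply pow_nonzero; lra).
  assert (X : forall x y z : R, (y <> 0 -> x * / y * (y * z) = x * z)%R) by (intros; field; easy).
  rewrite (X _ _ _ P).
  apply Rmult_le_compat_l; [apply pow_le; lra|]. apply pow_incr. lra.
- apply (ex_series_scal (V := R_NormedModule) (t ^ N0 * / a ^ N0)%R _ A).
Qed.

Lemma tail_abs_lim : is_lim_seq tail_abs 0.
Proof.
set (u := fun k => Rabs (cc k * a ^ k)).
assert (Hu : ex_series u) by (apply ex_series_cc_abs; lra).
apply is_lim_seq_incr_1.
apply is_lim_seq_ext with (u := fun n => (Series u - sum_n u n)%R).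
- intros n. unfold tail_abs. rewrite (Series_incr_n u (S n)) by (lia || easy).
  rewrite sum_n_Reals. simpl pred. unfold u. ring.
- replace (Finite 0) with (Finite (Series u - Series u)) by (f_equal; ring).
  apply is_lim_seq_minus'; [apply is_lim_seq_const|]. now apply Series_correct.
Qed.

Lemma continuous_remainder (N : nat) (t : R) : (0 < t)%R -> continuous (remainder N) t.
Proof.
intros Ht. apply continuous_Rplus; [apply continuous_exp_comp; now apply continuous_Vsum|].
apply (continuous_Ropp (fun t => Rsum (fun l => cc l * t ^ l)%R (seq 0 N))).
apply (continuous_Rsum (fun l t => cc l * t ^ l)%R). intros l.
apply (ex_derive_continuous (K := R_AbsRing) (V := R_NormedModule)). now auto_derive.
Qed.

Definition tail_integrand (N : nat) (t : R) : R := (Rpower t (- L) * E t * remainder N t)%R.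

Lemma continuous_tail_integrand (N : nat) (t : R) : (0 < t)%R -> continuous (tail_integrand N) t.
Proof.
intros Ht. apply continuous_Rmult; [|now apply continuous_remainder].
apply continuous_Rmult; [now apply continuous_Rpower|now apply continuous_exp_periodic].
Qed.

Lemma tail_integrand_bound : exists K, (0 < K)%R /\ forall N0 N t, (0 < t <= a)%R -> (N0 <= N)%nat ->
  (Rabs (tail_integrand N t) <= K * (/ a ^ N0 * tail_abs N) * Rpower t (INR N0 - L))%R.
Proof.
destruct (exp_periodic_bounded beta d Hbeta Hnd Hd0 Hin Hlen) as [K [HK H]]. exists K. split; [easy|].
intros N0 N t Ht HN. unfold tail_integrand. rewrite !Rabs_mult.
rewrite (Rabs_pos_eq (Rpower _ _)) by (left; apply exp_pos).
rewrite (Rabs_pos_eq (E t)) by (left; apply exp_pos).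
unfold Rminus. rewrite Rpower_plus, Rpower_nat by lra.
replace (K * (/ a ^ N0 * tail_abs N) * (t ^ N0 * Rpower t (- L)))%R
  with (Rpower t (- L) * K * (t ^ N0 * (/ a ^ N0 * tail_abs N)))%R by ring.
apply Rmult_le_compat.
- apply Rmult_le_pos; left; apply exp_pos.
- apply Rabs_pos.
- apply Rmult_le_compat_l; [left; apply exp_pos|apply H; lra].
- now apply remainder_bound.
Qed.

Lemma tail_integrand_conv (N : nat) (p : R) : (L - INR N < p)%R -> mellin_conv (tail_integrand N) (at_right 0) (at_point a) p.
Proof.
intros Hp. destruct tail_integrand_bound as [K [HK H]].
apply mellin_conv_0 with (K := (K * (/ a ^ N * tail_abs N))%R) (q := (L - INR N)%R); try easy.
- intros t Ht. apply continuous_tail_integrand. lra.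
- intros t Ht. replace (- (L - INR N))%R with (INR N - L)%R by ring. now apply H.
Qed.

Definition tail_integral (N : nat) (s : C) : C := mellin (tail_integrand N) (at_right 0) (at_point a) s.

Lemma is_tail_integral (N : nat) (s : C) : (L - INR N < Re s)%R ->
  is_CInt (fun t => RtoC (tail_integrand N t) * cpow t (s - 1)) (at_right 0) (at_point a) (tail_integral N s).
Proof.
intros Hs. apply (is_mellin (idom_0_point a Ha)); [|now apply tail_integrand_conv].
intros t Ht. apply continuous_tail_integrand. lra.
Qed.

Lemma tail_integral_smooth (N : nat) (s : C) : (L - INR N < Re s)%R -> smooth (tail_integral N) s.
Proof.
intros Hs. unfold tail_integral.
refine (mellin_smooth (idom_0_point a Ha) (tail_integrand N) _ s (Re s - (L - INR N))%R _ _).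
- intros t Ht. apply continuous_tail_integrand. lra.
- lra.
- intros p Hp. apply tail_integrand_conv. lra.
Qed.

Lemma tail_integrand_0 (t : R) : (0 < t)%R -> tail_integrand 0 t = digit_prod beta d t.
Proof.
intros Ht. unfold tail_integrand, remainder. simpl seq. rewrite Rsum_nil, Rminus_0_r. symmetry. now apply digit_prod_eq.
Qed.

Definition period_integral (e : C) : C := mellin E (at_point a) (at_point (beta * a)%R) e.
Definition head_integral (e : C) : C := mellin E (at_right 0) (at_point a) e.

Lemma a_le_beta_a : (a <= beta * a)%R.
Proof. pose proof Ha. nra. Qed.

Lemma period_integral_smooth (e : C) : smooth period_integral e.
Proof.
unfold period_integral. refine (mellin_smooth (idom_points a (beta * a)%R Ha a_le_beta_a) E _ e 1%R Rlt_0_1 _).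
- intros t Ht. apply continuous_exp_periodic; trivial. lra.
- intros p _. apply mellin_conv_points; [exact Ha|apply a_le_beta_a|].
  intros t Ht. apply continuous_exp_periodic; trivial. lra.
Qed.

Lemma exp_periodic_conv_0 (x p : R) : (0 < x)%R -> (0 < p)%R -> mellin_conv E (at_right 0) (at_point x) p.
Proof.
intros Hx Hp. destruct (exp_periodic_bounded beta d Hbeta Hnd Hd0 Hin Hlen) as [K [HK H]].
apply mellin_conv_0 with (K := K) (q := 0%R); try easy.
- intros t Ht. apply continuous_exp_periodic; trivial. lra.
- intros t Ht. rewrite Rabs_pos_eq by (left; apply exp_pos).
  rewrite Ropp_0, Rpower_O, Rmult_1_r by lra. apply H. lra.
Qed.

Lemma is_head_integral (e : C) : (0 < Re e)%R ->
  is_CInt (fun t => RtoC (E t) * cpow t (e - 1)) (at_right 0) (at_point a) (head_integral e).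
Proof.
intros He. apply (is_mellin (idom_0_point a Ha)); [|now apply exp_periodic_conv_0].
intros t Ht. apply continuous_exp_periodic; trivial. lra.
Qed.

Lemma cpow_beta_neq_1 (e : C) : (0 < Re e)%R -> cpow beta e - 1 <> 0.
Proof.
intros He H. assert (E1 : cpow beta e = 1) by (replace (cpow beta e) with (cpow beta e - 1 + 1) by ring; rewrite H; ring).
apply (f_equal Cmod) in E1. rewrite Cmod_cpow, Cmod_1 in E1.
assert (LT := Rpower_lt beta 0 (Re e) Hbeta He). rewrite Rpower_O in LT; lra.
Qed.

Lemma head_integral_eq (e : C) : (0 < Re e)%R -> head_integral e = period_integral e / (cpow beta e - 1).
Proof.
intros He. assert (HD := idom_0_point a Ha).
assert (Hb0 : (0 < beta)%R) by lra.
assert (Hab : (0 < beta * a)%R) by (pose proof Ha; nra).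
assert (HDb := idom_0_point (beta * a)%R Hab).
set (l := mellin E (at_right 0) (at_point (beta * a)%R) e).
assert (Il : is_CInt (fun t => RtoC (E t) * cpow t (e - 1)) (at_right 0) (at_point (beta * a)%R) l).
{ apply (is_mellin HDb); [|now apply exp_periodic_conv_0]. intros t Ht. apply continuous_exp_periodic; trivial. lra. }
assert (IK : is_CInt (fun t => RtoC (E t) * cpow t (e - 1)) (at_point a) (at_point (beta * a)%R) (period_integral e)).
{ apply (is_mellin (idom_points a (beta * a)%R Ha a_le_beta_a)).
  - intros t Ht. apply continuous_exp_periodic; trivial. lra.
  - apply mellin_conv_points; [exact Ha|apply a_le_beta_a|].
    intros t Ht. apply continuous_exp_periodic; trivial. lra. }
assert (E1 : l = head_integral e + period_integral e).
{ rewrite <- (is_CInt_unique HDb _ _ Il). apply (is_CInt_unique HDb).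
  apply (is_RInt_gen_Chasles (V := C_R_NormedModule)) with (b := a); [now apply is_head_integral|exact IK]. }
(* Substituting [beta t] for [t] and using the period, the integral over [(0, beta a)] is [beta^e]
   times the one over [(0, a)]. *)
assert (E2 : cpow beta (- e) * l = head_integral e).
{ rewrite <- (is_CInt_unique HD _ _ (is_head_integral e He)). symmetry. apply (is_CInt_unique HD).
  assert (I := is_CInt_scale (at_right 0) (at_point a) _ _ _ beta l
    (filterlim_scale_right_0 beta Hb0) (filterlim_scale_point beta a) Il).
  apply (is_CInt_Cmult HD _ (cpow beta (- e))) in I.
  apply (is_CInt_ext HD) with (2 := I). intros t Ht.
  rewrite (exp_periodic_periodic beta d) by (trivial; lra). now apply cpow_opp_scale. }
assert (N1 := cpow_beta_neq_1 e He). assert (N0 := cpow_neq_0 beta e).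
rewrite cpow_opp in E2.
assert (E3 : head_integral e * (cpow beta e - 1) = period_integral e).
{ replace (period_integral e) with (l - head_integral e) by (rewrite E1; ring). rewrite <- E2. field. exact N0. }
rewrite <- E3. field. exact N1.
Qed.

Definition expo (l : nat) (s : C) : C := s + RtoC (INR l) - RtoC L.

Definition pole_term (l : nat) (s : C) : C :=
  RtoC (cc l) * (period_integral (expo l s) / (cpow beta (expo l s) - 1)).

Lemma Re_expo (l : nat) (s : C) : Re (expo l s) = (Re s + INR l - L)%R.
Proof. reflexivity. Qed.

Lemma tail_integral_succ (N : nat) (s : C) : (L - INR N < Re s)%R -> tail_integral N s = pole_term N s + tail_integral (S N) s.
Proof.
intros Hs. assert (HD := idom_0_point a Ha).
assert (He : (0 < Re (expo N s))%R) by (rewrite Re_expo; lra).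
assert (I1 := is_tail_integral N s Hs). assert (I2 := is_tail_integral (S N) s ltac:(rewrite S_INR; lra)).
unfold pole_term. rewrite <- (head_integral_eq _ He).
assert (I3 := is_CInt_Cmult HD _ (RtoC (cc N)) _ (is_head_integral _ He)).
rewrite <- (is_CInt_unique HD _ _ I1). apply (is_CInt_unique HD).
apply (is_CInt_ext HD) with (2 := is_CInt_plus HD _ _ _ _ I3 I2). intros t Ht.
assert (G : (tail_integrand N t = tail_integrand (S N) t + cc N * E t * Rpower t (INR N - L))%R).
{ unfold tail_integrand, remainder. rewrite Rsum_seq_S. simpl (0 + N)%nat.
  unfold Rminus at 3. rewrite Rpower_plus, Rpower_nat by lra. ring. }
rewrite G.
replace (expo N s - 1) with (RtoC (INR N - L) + (s - 1)) by (unfold expo; rewrite RtoC_minus; ring).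
rewrite cpow_plus, cpow_RtoC, RtoC_plus, !RtoC_mult. ring.
Qed.

Lemma tail_integral_split (N k : nat) (s : C) : (L - INR N < Re s)%R ->
  tail_integral N s = Csum (fun l => pole_term l s) (seq N k) + tail_integral (N + k) s.
Proof.
intros Hs. induction k as [|k IH].
- simpl seq. rewrite Csum_nil, Nat.add_0_r. ring.
- rewrite IH, seq_S, Csum_app, Csum_cons, Csum_nil, tail_integral_succ by (rewrite plus_INR; pose proof (pos_INR k); lra).
  replace (N + S k)%nat with (S (N + k)) by lia. ring.
Qed.

Lemma tail_integral_lim (N0 : nat) (s : C) : (L - INR N0 < Re s)%R ->
  forall eps, (0 < eps)%R -> exists M, forall N, (M <= N)%nat -> (Cmod (tail_integral N s) < eps)%R.
Proof.
intros Hs eps Heps. assert (HD := idom_0_point a Ha).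
destruct tail_integrand_bound as [K [HK H]].
destruct (ex_RInt_Rpower_0 (INR N0 - L + Re s) a ltac:(lra) Ha) as [m Hm].
assert (B : forall N, (N0 <= N)%nat -> (Cmod (tail_integral N s) <= K * / a ^ N0 * m * tail_abs N)%R).
{ intros N HN.
  assert (Hm' := is_RInt_gen_scal (V := R_NormedModule) _ (K * (/ a ^ N0 * tail_abs N))%R _ Hm).
  apply Rle_trans with (scal (K * (/ a ^ N0 * tail_abs N))%R m).
  2:{ right. unfold scal; simpl; unfold mult; simpl. ring. }
  apply (is_CInt_norm HD) with (2 := is_tail_integral N s ltac:(apply le_INR in HN; lra)) (3 := Hm').
  intros t Ht. rewrite (Cmod_mellin_kernel (tail_integrand N)).
  match goal with |- (_ <= scal ?c ?x)%R => change (scal c x) with (c * x)%R end.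
  replace (INR N0 - L + Re s - 1)%R with (INR N0 - L + (Re s - 1))%R by ring.
  rewrite Rpower_plus, <- Rmult_assoc.
  apply Rmult_le_compat_r; [left; apply exp_pos|now apply H]. }
assert (Lm := tail_abs_lim). apply (is_lim_seq_scal_l _ (K * / a ^ N0 * m)%R) in Lm.
simpl in Lm. rewrite Rmult_0_r in Lm. apply is_lim_seq_spec in Lm.
destruct (Lm (mkposreal eps Heps)) as [M HM]. exists (max N0 M). intros N HN.
eapply Rle_lt_trans; [apply B; lia|]. specialize (HM N ltac:(lia)). simpl in HM.
rewrite Rminus_0_r in HM. apply Rabs_def2 in HM. lra.
Qed.

(** The continuation of the integral of [F(t) t^(s-1)] over [(0, a)], with [F] and not [F - 1]. All
    [N] with [L - N < Re s] give the same value. *)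
Definition lower_integral (N : nat) (s : C) : C := Csum (fun l => pole_term l s) (seq 0 N) + tail_integral N s.

Lemma lower_integral_le (N k : nat) (s : C) : (L - INR N < Re s)%R -> lower_integral (N + k) s = lower_integral N s.
Proof.
intros Hs. unfold lower_integral. rewrite seq_app, Csum_app, (tail_integral_split N k s Hs). simpl (0 + N)%nat. ring.
Qed.

Lemma lower_integral_indep (N N' : nat) (s : C) : (L - INR N < Re s)%R -> (L - INR N' < Re s)%R ->
  lower_integral N s = lower_integral N' s.
Proof.
intros H H'. destruct (Nat.le_ge_cases N N') as [X|X].
- replace N' with (N + (N' - N))%nat by lia. symmetry. now apply lower_integral_le.
- replace N with (N' + (N - N'))%nat by lia. now apply lower_integral_le.
Qed.

Lemma sum_n_Csum (u : nat -> C) (n : nat) : sum_n (G := C_AbelianGroup) u n = Csum u (seq 0 (S n)).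
Proof.
induction n as [|n IH].
- rewrite sum_O. simpl. rewrite Csum_cons, Csum_nil. symmetry. apply Cplus_0_r.
- rewrite sum_Sn, IH, (seq_S (S n)), Csum_app, Csum_cons, Csum_nil. simpl (0 + S n)%nat.
  rewrite Cplus_0_r. reflexivity.
Qed.

(** The partial sum up to [n] misses the value by exactly [tail_integral (S n) s]. *)
Lemma is_series_pole_terms (N : nat) (s : C) : (L - INR N < Re s)%R ->
  is_series (K := C_AbsRing) (V := C_NormedModule) (fun l => pole_term l s) (lower_integral N s).
Proof.
intros Hs. apply (filterlim_C_eps eventually). intros eps Heps.
destruct (tail_integral_lim N s Hs eps Heps) as [M HM]. exists (max N M). intros n Hn.
refine (eq_ind_r (fun z : C => (Cmod (z - lower_integral N s) < eps)%R) _ (sum_n_Csum (fun l => pole_term l s) n)).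
rewrite (lower_integral_indep N (S n) s Hs).
2:{ assert (INR N <= INR (S n))%R by (apply le_INR; lia). lra. }
unfold lower_integral.
match goal with |- (Cmod ?z < _)%R => replace z with (- tail_integral (S n) s) by ring end.
rewrite Cmod_opp. apply HM. lia.
Qed.

Lemma exp_periodic_div_pow (n : nat) (t : R) : (0 < t)%R -> E (t / beta ^ n) = E t.
Proof.
intros Ht. induction n as [|n IH].
- simpl. f_equal. field.
- rewrite <- IH. assert (P : (0 < beta ^ n)%R) by (apply pow_lt; lra).
  replace (t / beta ^ n)%R with (beta * (t / beta ^ S n))%R by (simpl; field; lra).
  symmetry. apply exp_periodic_periodic; trivial. apply Rdiv_lt_0_compat; [easy|apply pow_lt; lra].
Qed.

(** The substitution [t = beta^(u - c)] maps [[0, 1]] onto [[a, beta a]], with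
    [dt = (ln beta) t du]. The shift by [c] does not change [E], which is periodic, and survives
    only in the factor [beta^(- e c)]. *)
Lemma period_integral_eq (e : C) :
  period_integral e = cpow beta (- (e * RtoC (INR c))) * RtoC (ln beta)
    * CInt (fun u => RtoC (exp (Pfun beta d u)) * cpow beta (e * RtoC u)) 0 1.
Proof.
set (f := fun t => RtoC (E t) * cpow t (e - 1)).
set (g := fun u => Rpower beta (u - INR c)).
assert (Lb := ln_beta_pos beta Hbeta).
assert (g0 : g 0%R = a).
{ unfold g. rewrite Rminus_0_l, Rpower_Ropp, Rpower_nat by lra. reflexivity. }
assert (g1 : g 1%R = (beta * a)%R).
{ unfold g, Rminus. rewrite Rpower_plus, Rpower_1, Rpower_Ropp, Rpower_nat by lra. reflexivity. }
assert (gp : forall u, (0 < g u)%R) by (intros; apply exp_pos).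
assert (gd : forall u, is_derive g u (ln beta * g u)%R).
{ intros u. unfold g, Rpower. auto_derive; [easy|]. unfold Rminus. ring. }
assert (fc : forall t, (0 < t)%R -> continuous (U := C_UniformSpace) f t).
{ intros t Ht. apply continuous_Cmult; [|now apply continuous_cpow].
  apply continuous_RtoC. now apply continuous_exp_periodic. }
assert (I := is_RInt_comp (V := C_R_CompleteNormedModule) f g (fun u => ln beta * g u)%R 0 1
  (fun u _ => fc (g u) (gp u))).
assert (I' : is_RInt (V := C_R_NormedModule) (fun u => scal (V := C_R_NormedModule) (ln beta * g u)%R (f (g u))) 0 1
   (RInt (V := C_R_CompleteNormedModule) f (g 0%R) (g 1%R))).
{ apply I. intros u _. split; [apply gd|].
  apply (continuous_Rmult (fun _ => ln beta)); [apply continuous_const|].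
  apply (ex_derive_continuous (K := R_AbsRing) (V := R_NormedModule)). eexists. apply gd. }
clear I. rewrite g0, g1 in I'.
assert (EK : period_integral e = RInt (V := C_R_CompleteNormedModule) f a (beta * a)%R).
{ unfold period_integral, mellin, CInt_gen. apply (RInt_gen_at_point (V := C_R_CompleteNormedModule)).
  apply (ex_RInt_dom (V := C_R_CompleteNormedModule) (idom_points a (beta * a)%R Ha a_le_beta_a)).
  - intros t Ht. apply fc. lra.
  - split; [lra|apply a_le_beta_a].
  - split; [apply a_le_beta_a|lra]. }
rewrite <- EK in I'.
set (h := fun u => RtoC (exp (Pfun beta d u)) * cpow beta (e * RtoC u)).
set (k := cpow beta (- (e * RtoC (INR c))) * RtoC (ln beta)).
assert (Ek : forall u, scal (V := C_R_NormedModule) (ln beta * g u)%R (f (g u)) = k * h u).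
{ intros u. transitivity (RtoC (ln beta * g u) * f (g u)).
  - unfold scal; simpl. unfold prod_scal, scal; simpl. unfold mult; simpl.
    unfold Cmult, RtoC; simpl. f_equal; ring_R.
  - unfold f, k, h.
    assert (Eg : E (g u) = exp (Pfun beta d u)).
    { rewrite <- exp_periodic_Rpower by easy. rewrite <- (exp_periodic_div_pow c (Rpower beta u)) by apply exp_pos.
      f_equal. unfold g, Rminus. rewrite Rpower_plus, Rpower_Ropp, Rpower_nat by lra. reflexivity. }
    rewrite Eg, RtoC_mult, <- (cpow_1 (g u) (gp u)) at 1.
    replace (RtoC (ln beta) * cpow (g u) 1 * (RtoC (exp (Pfun beta d u)) * cpow (g u) (e - 1)))
      with (RtoC (ln beta) * RtoC (exp (Pfun beta d u)) * (cpow (g u) 1 * cpow (g u) (e - 1))) by ring.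
    rewrite <- cpow_plus. replace (1 + (e - 1)) with e by ring.
    replace (cpow (g u) e) with (cpow beta (- (e * RtoC (INR c))) * cpow beta (e * RtoC u));
      [match goal with |- ?a = ?b => change (@eq C a b) end; ring|].
    rewrite <- cpow_plus. unfold cpow, g, Rpower. rewrite ln_exp. f_equal.
    rewrite RtoC_mult, RtoC_minus. ring. }
assert (Ih : is_RInt (V := C_R_NormedModule) h 0 1 (CInt h 0 1)).
{ apply (RInt_correct (V := C_R_CompleteNormedModule)).
  apply (ex_RInt_continuous (V := C_R_CompleteNormedModule)). intros u _.
  apply continuous_Cmult.
  - apply continuous_RtoC.
    apply continuous_ext with (f := fun u => E (Rpower beta u)); [intros y; now apply exp_periodic_Rpower|].
    apply (continuous_comp (fun u => Rpower beta u) E).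
    + apply (ex_derive_continuous (K := R_AbsRing) (V := R_NormedModule)). unfold Rpower. now auto_derive.
    + apply continuous_exp_periodic; trivial. apply exp_pos.
  - eapply cder_continuous. unfold cpow.
    apply cder_Cexp. eapply cder_eq; [|reflexivity].
    apply cder_mult; [|apply cder_const]. apply cder_mult; [apply cder_const|].
    apply cder_RtoC with (l := 1%R). apply (is_derive_id (K := R_AbsRing)). }
apply (is_RInt_gen_at_point (V := C_R_NormedModule)) in Ih.
assert (Ih' : is_RInt_gen (V := C_R_NormedModule) (fun u => k * h u) (at_point 0%R) (at_point 1%R) (k * CInt h 0 1)).
{ now apply is_CInt_Cmult_raw. }
apply (is_RInt_gen_at_point (V := C_R_NormedModule)) in Ih'.
rewrite <- (is_RInt_unique (V := C_R_CompleteNormedModule) _ _ _ _ I').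
apply (is_RInt_unique (V := C_R_CompleteNormedModule)).
revert Ih'. apply is_RInt_ext. intros u _. symmetry. apply Ek.
Qed.

End Continuation.

(** * Meromorphic continuation *)

Lemma Cexp_2PI_Ci (k : Z) : Cexp (RtoC (2 * PI * IZR k) * Ci) = 1.
Proof.
unfold Cexp, Ci, RtoC, Cmult; simpl.
replace (2 * PI * IZR k * 0 - 0 * 1)%R with 0%R by ring.
replace (2 * PI * IZR k * 1 + 0 * 0)%R with (2 * (IZR k * PI))%R by ring.
rewrite exp_0, cos_2a_sin, sin_2a, (sin_eq_0_1 (IZR k * PI)) by (now exists k). f_equal; ring.
Qed.

(** The modulus gives [Re z = 0]; with [y = Im z], the real part gives [1 - 2 sin^2 (y / 2) = 1], so
    [y / 2] is a multiple of [PI]. *)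
Lemma Cexp_eq_1 (z : C) : Cexp z = 1 -> exists k : Z, z = RtoC (2 * PI * IZR k) * Ci.
Proof.
intros H. assert (M := f_equal Cmod H). rewrite Cmod_Cexp, Cmod_1, <- exp_0 in M.
apply exp_inv in M.
assert (HR := f_equal Re H). unfold Cexp in HR. simpl in HR. rewrite M, exp_0, Rmult_1_l in HR.
replace (Im z) with (2 * (Im z / 2))%R in HR by field. rewrite cos_2a_sin in HR.
assert (S0 : sin (Im z / 2) = 0%R) by nra.
destruct (sin_eq_0_0 _ S0) as [k Hk]. exists k.
destruct z as [x y]. simpl in *. unfold Cmult, RtoC, Ci; simpl. unfold Re, Im in *; simpl in *.
f_equal; [rewrite M; ring|]. replace y with (2 * (y / 2))%R by field. rewrite Hk. ring.
Qed.

Lemma nice_Csum {T : Type} (f : T -> C -> C) (xs : list T) (z : C) :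
  (forall x, In x xs -> nice (f x) z) -> nice (fun w => Csum (fun x => f x w) xs) z.
Proof.
induction xs as [|x xs IH]; intros H; [exact (nice_const 0 z)|].
apply (nice_plus (f x)); [apply H; now left|]. apply IH. intros y Hy. apply H. now right.
Qed.

Lemma continuous_punctured_unique (f g : C -> C) (z : C) :
  continuous (T := C_UniformSpace) (U := C_UniformSpace) f z ->
  continuous (T := C_UniformSpace) (U := C_UniformSpace) g z ->
  locally' (T := C_UniformSpace) z (fun w => f w = g w) -> f z = g z.
Proof.
intros Hf Hg H. apply locally'_Cmod in H. destruct H as [del [Hd H]].
destruct (Req_dec (Cmod (f z - g z)) 0) as [E|E].
{ apply Cmod_eq_0 in E. replace (f z) with (f z - g z + g z) by ring. rewrite E. ring. }
exfalso. assert (P : (0 < Cmod (f z - g z))%R) by (pose proof (Cmod_ge_0 (f z - g z)); lra).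
set (eps := (Cmod (f z - g z) / 2)%R). assert (He : (0 < eps)%R) by (unfold eps; lra).
destruct (proj1 (continuous_C_eps f z) Hf eps He) as [d1 [Hd1 H1]].
destruct (proj1 (continuous_C_eps g z) Hg eps He) as [d2 [Hd2 H2]].
set (h := (Rmin del (Rmin d1 d2) / 2)%R).
assert (Hm : (0 < Rmin del (Rmin d1 d2))%R) by (repeat apply Rmin_pos; easy).
assert (Hh : Cmod (z + RtoC h - z) = h).
{ replace (z + RtoC h - z) with (RtoC h) by ring. rewrite Cmod_R, Rabs_pos_eq; unfold h; lra. }
assert (A0 := Rmin_l del (Rmin d1 d2)). assert (A1 := Rmin_r del (Rmin d1 d2)).
assert (A2 := Rmin_l d1 d2). assert (A3 := Rmin_r d1 d2).
assert (Hne : z + RtoC h <> z).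
{ intros Q. rewrite Q in Hh. replace (z - z) with (RtoC 0) in Hh by ring. rewrite Cmod_0 in Hh. unfold h in Hh; lra. }
assert (K1 := H1 (z + RtoC h) ltac:(rewrite Hh; unfold h; lra)).
assert (K2 := H2 (z + RtoC h) ltac:(rewrite Hh; unfold h; lra)).
rewrite (H (z + RtoC h) ltac:(rewrite Hh; unfold h; lra) Hne) in K1.
assert (T := Cmod_triangle_minus (g (z + RtoC h) - g z) (g (z + RtoC h) - f z)).
replace (g (z + RtoC h) - g z - (g (z + RtoC h) - f z)) with (f z - g z) in T by ring.
unfold eps in *. lra.
Qed.

Lemma locally'_of_locally (z : C) (P : C -> Prop) :
  locally (T := C_UniformSpace) z P -> locally' (T := C_UniformSpace) z P.
Proof. intros H. unfold locally', within. revert H. apply filter_imp. now intros. Qed.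

Lemma rising_neg (n : nat) : rising n (RtoC (- INR n)) = RtoC ((-1) ^ n * INR (fact n)).
Proof.
induction n as [|n IH].
- unfold rising, Cprod; simpl. now rewrite Rmult_1_l.
- rewrite rising_shift. replace (RtoC (- INR (S n)) + 1) with (RtoC (- INR n)).
  + rewrite IH, <- RtoC_mult. f_equal. change (fact (S n)) with (S n * fact n)%nat.
    rewrite mult_INR. simpl pow. ring.
  + rewrite <- RtoC_plus. f_equal. rewrite S_INR. ring.
Qed.

Section Main.
Variables (beta : R) (d d' : list R).
Hypothesis Hbeta : (1 < beta)%R.
Hypothesis Hnd : NoDup d.
Hypothesis Hd0 : forall delta, In delta d -> (0 <= delta)%R.
Hypothesis Hin : In 0%R d.
Hypothesis Hlen : (2 <= length d)%nat.
Hypothesis Hperm : Permutation d (0%R :: d').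
Hypothesis Hd' : forall x, In x d' -> (0 < x)%R.
Variables (sigma : R) (c : nat).
Hypothesis Hsigma : is_sigma beta d sigma.
Hypothesis Hc : (/ beta ^ c < sigma)%R.

Notation L := (Lexp beta d).
Notation a := (/ beta ^ c)%R.
Notation cc := (ccoef beta d).
Notation H1 := (upper_integral beta d a).
Notation H2 := (lower_integral beta d c).
Notation T := (tail_integral beta d c).
Notation K := (period_integral beta d c).
Notation term := (pole_term beta d c).
Notation ex := (expo beta d).
Notation is_pole s := (exists j k, s = pole_point beta d j k).

Let Ha : (0 < a)%R := a_pos beta Hbeta c.
Let Hln : (0 < ln beta)%R := ln_beta_pos beta Hbeta.

Lemma expo_pole (j : nat) (k : Z) : ex j (pole_point beta d j k) * RtoC (ln beta) = RtoC (2 * PI * IZR (- k)) * Ci.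
Proof.
unfold expo, pole_point. rewrite opp_IZR.
unfold Cmult, Cminus, Cplus, Copp, RtoC, Ci; simpl. f_equal; field; lra.
Qed.

Lemma cpow_expo_pole (j : nat) (k : Z) : cpow beta (ex j (pole_point beta d j k)) = 1.
Proof. unfold cpow. rewrite expo_pole. apply Cexp_2PI_Ci. Qed.

Lemma cpow_expo_eq_1 (l : nat) (s : C) : cpow beta (ex l s) = 1 -> exists k, s = pole_point beta d l k.
Proof.
intros H. apply Cexp_eq_1 in H. destruct H as [k Hk]. exists (- k)%Z.
assert (E : ex l s = ex l (pole_point beta d l (- k))).
{ assert (N : RtoC (ln beta) <> 0) by (intros Q; injection Q; lra).
  assert (E2 := expo_pole l (- k)). rewrite Z.opp_involutive, <- Hk in E2.
  replace (ex l s) with (ex l s * RtoC (ln beta) / RtoC (ln beta)) by (now field).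
  rewrite <- E2. now field. }
unfold expo in E.
replace s with (s + RtoC (INR l) - RtoC L - RtoC (INR l) + RtoC L) by ring. rewrite E. ring.
Qed.

Lemma Re_pole_point (j : nat) (k : Z) : Re (pole_point beta d j k) = (L - INR j)%R.
Proof. unfold pole_point. simpl. ring. Qed.

Definition level (s : C) : nat := Z.to_nat (up (L - Re s)).

Lemma level_spec (s : C) : (L - INR (level s) < Re s)%R.
Proof.
unfold level. destruct (archimed (L - Re s)) as [U _].
assert (IZR (up (L - Re s)) <= INR (Z.to_nat (up (L - Re s))))%R; [|lra].
rewrite INR_IZR_INZ. apply IZR_le. lia.
Qed.

Definition zeta_form (N : nat) (s : C) : C :=
  inv_Gamma s * H1 s - cpow beta (- (RtoC (INR c) * s)) * inv_Gamma (s + 1) + inv_Gamma s * H2 N s.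

Definition zeta_formula (s : C) : C := zeta_form (level s) s.

(** [level s] jumps with [s], whereas local arguments need the same [N] on a whole neighbourhood. *)
Lemma zeta_formula_zeta_form (N : nat) (s : C) : (L - INR N < Re s)%R -> zeta_formula s = zeta_form N s.
Proof.
intros Hs. unfold zeta_formula, zeta_form. f_equal. f_equal.
apply (lower_integral_indep beta d Hbeta Hnd Hd0 Hin Hlen sigma c Hsigma Hc); [apply level_spec|exact Hs].
Qed.

Lemma nice_cpow_c (z : C) : nice (fun s => cpow beta (- (RtoC (INR c) * s))) z.
Proof.
apply nice_ext with (f := fun s => Cexp ((- RtoC (INR c) * RtoC (ln beta)) * s + 0)).
- intros w. unfold cpow. f_equal. ring.
- apply smooth_nice, smooth_affine, smooth_Cexp.
Qed.

Lemma nice_K_expo (l : nat) (z : C) : nice (fun s => K (ex l s)) z.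
Proof.
apply nice_ext with (f := fun s => K (s + (RtoC (INR l) - RtoC L))).
- intros w. f_equal. unfold expo. ring.
- apply nice_translate, smooth_nice.
  apply (period_integral_smooth beta d Hbeta Hnd Hd0 Hin Hlen).
Qed.

Lemma nice_cpow_expo (l : nat) (z : C) : nice (fun s => cpow beta (ex l s)) z.
Proof.
apply nice_ext with (f := fun s => Cexp (RtoC (ln beta) * s + (RtoC (INR l) - RtoC L) * RtoC (ln beta))).
- intros w. unfold cpow, expo. f_equal. ring.
- apply smooth_nice, smooth_affine, smooth_Cexp.
Qed.

Lemma nice_term (l : nat) (z : C) : (forall k, z <> pole_point beta d l k) -> nice (term l) z.
Proof.
intros H. unfold pole_term. apply nice_mult; [apply nice_const|].
apply (nice_mult (fun s => K (ex l s)) (fun s => / (cpow beta (ex l s) - 1))); [apply nice_K_expo|].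
apply nice_inv.
- apply (nice_plus _ (fun _ => - (1))); [apply nice_cpow_expo|apply nice_const].
- intros Q. destruct (cpow_expo_eq_1 l z) as [k Hk].
  + replace (cpow beta (ex l z)) with (cpow beta (ex l z) - 1 + 1) by ring. rewrite Q. ring.
  + now apply (H k).
Qed.

Lemma nice_T (N : nat) (z : C) : (L - INR N < Re z)%R -> nice (T N) z.
Proof.
intros H. apply smooth_nice. now apply (tail_integral_smooth beta d Hbeta Hnd Hd0 Hin Hlen sigma c Hsigma Hc).
Qed.

Lemma nice_H1 (z : C) : nice H1 z.
Proof. apply smooth_nice. now apply (upper_integral_smooth beta d Hbeta Hnd Hd0 Hin). Qed.

(* The part of [zeta_form (S j)] that is regular at the points [pole_point j k]. *)
Definition regular_part (j : nat) (s : C) : C :=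
  inv_Gamma s * H1 s - cpow beta (- (RtoC (INR c) * s)) * inv_Gamma (s + 1)
  + inv_Gamma s * (Csum (fun l => term l s) (seq 0 j) + T (S j) s).

Lemma zeta_form_regular_part (j : nat) (s : C) :
  zeta_form (S j) s = regular_part j s + inv_Gamma s * term j s.
Proof.
unfold zeta_form, regular_part, lower_integral. rewrite seq_S, Csum_app, Csum_cons, Csum_nil. simpl (0 + j)%nat. ring.
Qed.

(** Pole points with different [j] have different real parts, so the earlier terms are regular here,
    and the tail from [S j] on converges to the left of this line. *)
Lemma nice_regular_part (j : nat) (k : Z) : nice (regular_part j) (pole_point beta d j k).
Proof.
unfold regular_part. apply nice_plus.
- apply (nice_plus _ (fun s => - (cpow beta (- (RtoC (INR c) * s)) * inv_Gamma (s + 1)))).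
  + apply nice_mult; [apply inv_Gamma_nice|apply nice_H1].
  + apply nice_ext with (f := fun s => - (1) * (cpow beta (- (RtoC (INR c) * s)) * inv_Gamma (s + 1)));
      [intros; ring|].
    apply nice_mult; [apply nice_const|]. apply nice_mult; [apply nice_cpow_c|].
    apply nice_translate, inv_Gamma_nice.
- apply nice_mult; [apply inv_Gamma_nice|]. apply nice_plus.
  + apply nice_Csum. intros l Hl. apply in_seq in Hl. apply nice_term. intros k' E.
    assert (ER := f_equal Re E). rewrite !Re_pole_point in ER.
    assert (INR l = INR j) by lra. apply INR_eq in H. lia.
  + apply nice_T. rewrite Re_pole_point, S_INR. lra.
Qed.

(** [g] is the divided difference at [z] of [exp] with argument [ln beta] times [w - z]; its value
    [ln beta] at [z] is nonzero, so it can be inverted there. *)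
Lemma cpow_factor (j : nat) (k : Z) :
  exists g : C -> C, nice g (pole_point beta d j k) /\ g (pole_point beta d j k) = RtoC (ln beta) /\
    forall w, cpow beta (ex j w) - 1 = (w - pole_point beta d j k) * g w.
Proof.
set (z := pole_point beta d j k). set (y := RtoC (ln beta)).
assert (E : forall w, cpow beta (ex j w) = Cexp (y * w + - (y * z))).
{ intros w. replace (ex j w) with (ex j z + (w - z)) by (unfold expo; ring).
  rewrite cpow_plus. unfold z at 1. rewrite cpow_expo_pole, Cmult_1_l. unfold cpow. f_equal. unfold y. ring. }
assert (S0 : smooth (fun w => Cexp (y * w + - (y * z))) z) by (apply smooth_affine, smooth_Cexp).
destruct (smooth_nice_dquot _ z y (y ^ 2 * RtoC (/ 2)) (y ^ 3 * RtoC (/ 6))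
  (Cmod y ^ 4 * exp (Cmod y))%R S0) as [g [Hg [Eg Hw]]].
- apply (locally_C_imp _ _ _ (locally_Cmod_lt z 1 Rlt_0_1)). intros w Hw.
  replace (y * z + - (y * z)) with (RtoC 0) by ring. rewrite Cexp_0.
  set (h := w - z) in *. replace (y * w + - (y * z)) with (y * h) by (unfold h; ring).
  match goal with |- (Cmod ?x <= _)%R => replace x with (Cexp (y * h) - cexp_trunc 4 (y * h)) end.
  2:{ rewrite cexp_trunc_4. ring. }
  eapply Rle_trans; [apply Cexp_remainder|]. rewrite Cmod_mult, Rpow_mult_distr.
  replace (Cmod y ^ 4 * exp (Cmod y) * Cmod h ^ 4)%R with (Cmod y ^ 4 * Cmod h ^ 4 * exp (Cmod y))%R by ring.
  apply Rmult_le_compat_l.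
  + apply Rmult_le_pos; apply pow_le, Cmod_ge_0.
  + assert (Q : (Cmod y * Cmod h <= Cmod y)%R) by (pose proof (Cmod_ge_0 y); pose proof (Cmod_ge_0 h); nra).
    destruct Q as [Q|Q]; [left; now apply exp_increasing|rewrite Q; lra].
- exists g. split; [exact Hg|]. split; [exact Eg|]. intros w. rewrite E, (Hw w).
  replace (y * z + - (y * z)) with (RtoC 0) by ring. rewrite Cexp_0. ring.
Qed.

Lemma locally_zeta_formula_zeta_form (N : nat) (z : C) : (L - INR N < Re z)%R ->
  locally (T := C_UniformSpace) z (fun w => zeta_formula w = zeta_form N w).
Proof.
intros H. apply (locally_C_imp _ _ _ (locally_Re_gt z _ H)). intros w. apply zeta_formula_zeta_form.
Qed.

Definition pole_numerator (j : nat) (k : Z) : C :=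
  RtoC (cc j) * inv_Gamma (pole_point beta d j k) * K (ex j (pole_point beta d j k)) / RtoC (ln beta).

Lemma ln_beta_C : RtoC (ln beta) <> 0.
Proof. intros Q; injection Q; lra. Qed.

(** The factorisation of [1 / Gamma] is a parameter because two cases occur: [F = 1] for the Laurent
    expansion, and [F(w) = w - z] at nonpositive integers, where a zero of [1 / Gamma] cancels the
    pole. *)
Lemma zeta_formula_near_pole (j : nat) (k : Z) (F G : C -> C) (z := pole_point beta d j k) :
  nice F z -> nice G z -> locally (T := C_UniformSpace) z (fun w => inv_Gamma w = F w * G w) ->
  exists A : C -> C, nice A z /\ A z = G z * RtoC (cc j) * K (ex j z) / RtoC (ln beta) /\
    locally' (T := C_UniformSpace) z (fun w => zeta_formula w = regular_part j w + F w * A w / (w - z)).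
Proof.
intros HF HG HFG. destruct (cpow_factor j k) as [g [Hg [Eg Hw]]]. fold z in Hg, Eg, Hw.
assert (Ng : g z <> 0) by (rewrite Eg; apply ln_beta_C).
exists (fun w => G w * RtoC (cc j) * K (ex j w) * / g w). split; [|split].
- apply nice_mult; [|now apply nice_inv].
  apply nice_mult; [|apply nice_K_expo]. apply nice_mult; [exact HG|apply nice_const].
- rewrite Eg. reflexivity.
- assert (Hz : (L - INR (S j) < Re z)%R) by (unfold z; rewrite Re_pole_point, S_INR; lra).
  assert (Lz := locally_zeta_formula_zeta_form (S j) z Hz).
  assert (Lg := continuous_C_neq_0 g z (hol_continuous _ _ (nice_hol _ _ Hg)) Ng).
  unfold locally', within.
  refine (locally_C_imp2 _ _ _ _ HFG (locally_C_imp2 _ _ _ _ Lz Lg (fun w P Q => conj P Q)) _).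
  intros w E [Ew Nw] Hne. rewrite Ew, zeta_form_regular_part. unfold pole_term. rewrite (Hw w), E.
  assert (N := Cminus_neq_0 w z Hne). field. split; assumption.
Qed.

Lemma zeta_formula_hol (z : C) : ~ is_pole z -> hol zeta_formula z.
Proof.
intros H. assert (Hz := level_spec z). set (N := level z) in *.
apply hol_ext_loc with (f := zeta_form N).
- apply (locally_C_imp _ _ _ (locally_zeta_formula_zeta_form N z Hz)). now intros.
- apply nice_hol. unfold zeta_form, lower_integral. apply nice_plus.
  + apply (nice_plus _ (fun s => - (cpow beta (- (RtoC (INR c) * s)) * inv_Gamma (s + 1)))).
    * apply nice_mult; [apply inv_Gamma_nice|apply nice_H1].
    * apply nice_ext with (f := fun s => - (1) * (cpow beta (- (RtoC (INR c) * s)) * inv_Gamma (s + 1)));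
        [intros; ring|].
      apply nice_mult; [apply nice_const|]. apply nice_mult; [apply nice_cpow_c|].
      apply nice_translate, inv_Gamma_nice.
  + apply nice_mult; [apply inv_Gamma_nice|]. apply nice_plus; [|now apply nice_T].
    apply nice_Csum. intros l _. apply nice_term. intros k E. apply H. now exists l, k.
Qed.

Lemma poles_isolated (z : C) : locally' (T := C_UniformSpace) z (fun w => ~ is_pole w).
Proof.
assert (Q : (0 < 2 * PI * / ln beta)%R).
{ apply Rmult_lt_0_compat; [pose proof PI_RGT_0; lra|now apply Rinv_0_lt_compat]. }
(* Pole points with different [j] are at least 1 apart in real part, distinct ones with equal [j] at
   least [2 PI / ln beta] apart in imaginary part. *)
set (r := Rmin 1 (2 * PI * / ln beta)). assert (Hr : (0 < r)%R) by (apply Rmin_pos; lra).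
assert (U : forall j k j' k', (Cmod (pole_point beta d j k - pole_point beta d j' k') < r)%R ->
  pole_point beta d j k = pole_point beta d j' k').
{ intros j k j' k' H.
  assert (HR := Rle_lt_trans _ _ _ (re_le_Cmod _) H).
  replace (Re (pole_point beta d j k - pole_point beta d j' k')) with (INR j' - INR j)%R in HR
    by (unfold pole_point; simpl; ring).
  assert (Ej : j = j').
  { assert (B := Rlt_le_trans _ _ _ HR (Rmin_l _ _)). rewrite !INR_IZR_INZ, <- minus_IZR, <- abs_IZR in B.
    apply lt_IZR in B. lia. }
  assert (HI := Rle_lt_trans _ _ _ (Rle_trans _ _ _ (Rmax_r _ _) (Rmax_Cmod _)) H).
  replace (snd (pole_point beta d j k - pole_point beta d j' k')) with (2 * PI * / ln beta * (IZR k' - IZR k))%R in HI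
    by (unfold pole_point; simpl; ring).
  assert (Ek : k = k').
  { assert (B := Rlt_le_trans _ _ _ HI (Rmin_r _ _)).
    rewrite Rabs_mult, (Rabs_pos_eq (2 * PI * / ln beta)) in B by lra.
    assert (B' : (Rabs (IZR k' - IZR k) < 1)%R).
    { apply (Rmult_lt_reg_l (2 * PI * / ln beta)); [exact Q|]. lra. }
    rewrite <- minus_IZR, <- abs_IZR in B'. apply lt_IZR in B'. lia. }
  now subst. }
(* At most one pole point other than [z] lies within [r / 2] of [z]; if there is one, its distance
   from [z] serves as the radius. *)
destruct (excluded_middle_informative (exists w, w <> z /\ (Cmod (w - z) < r / 2)%R /\ is_pole w)) as [[w [Hw [Hr' [j [k E]]]]]|N].
- apply locally'_Cmod. exists (Cmod (w - z)).
  split; [now apply Cmod_gt_0, Cminus_neq_0|]. intros v Hv Hne [j' [k' E']].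
  assert (v = w).
  { subst v w. apply U. eapply Rle_lt_trans.
    - replace (pole_point beta d j' k' - pole_point beta d j k) with
        ((pole_point beta d j' k' - z) - (pole_point beta d j k - z)) by ring. apply Cmod_triangle_minus.
    - lra. }
  rewrite H in Hv. lra.
- apply locally'_Cmod. exists (r / 2)%R. split; [lra|]. intros w Hw Hne Hp. apply N. now exists w.
Qed.

(* At a removable pole point the value is the one of the holomorphic extension. *)
Definition zeta (s : C) : C :=
  if excluded_middle_informative (is_pole s)
  then epsilon (inhabits (RtoC 0)) (fun v => exists g, hol g s /\ g s = v /\
         locally' (T := C_UniformSpace) s (fun w => zeta_formula w = g w))
  else zeta_formula s.

Lemma zeta_not_pole (s : C) : ~ is_pole s -> zeta s = zeta_formula s.
Proof. intros H. unfold zeta. now destruct (excluded_middle_informative (is_pole s)). Qed.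

Lemma zeta_zeta_formula (z : C) : locally' (T := C_UniformSpace) z (fun w => zeta w = zeta_formula w).
Proof.
assert (H := poles_isolated z). revert H. unfold locally'. apply filter_imp. apply zeta_not_pole.
Qed.

(** By continuity the extension to a removable point is unique, so the value chosen by [epsilon] is
    that of any given extension [g]. *)
Lemma zeta_removable (z : C) (g : C -> C) : hol g z ->
  locally' (T := C_UniformSpace) z (fun w => zeta_formula w = g w) -> zeta z = g z /\ hol zeta z.
Proof.
intros Hg H.
assert (E : zeta z = g z).
{ unfold zeta. destruct (excluded_middle_informative (is_pole z)) as [P|P].
  - destruct (epsilon_spec (inhabits (RtoC 0)) (fun v => exists g, hol g z /\ g z = v /\
         locally' (T := C_UniformSpace) z (fun w => zeta_formula w = g w))
      (ex_intro _ (g z) (ex_intro _ g (conj Hg (conj eq_refl H))))) as [g' [Hg' [E' H']]].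
    rewrite <- E'. apply continuous_punctured_unique; [now apply hol_continuous|now apply hol_continuous|].
    generalize (filter_and _ _ H H'). apply filter_imp. intros w [A B]. congruence.
  - apply continuous_punctured_unique; [apply hol_continuous; now apply zeta_formula_hol|now apply hol_continuous|exact H]. }
split; [exact E|]. apply hol_ext_loc with (f := g); [|exact Hg].
assert (Z := filter_and _ _ (zeta_zeta_formula z) H). apply locally'_Cmod in Z. destruct Z as [del [Hd Z]].
apply locally_Cmod. exists del. split; [easy|]. intros w Hw.
destruct (excluded_middle_informative (w = z)) as [->|N]; [now symmetry|].
destruct (Z w Hw N) as [A B]. now rewrite A, B.
Qed.

Lemma zeta_hol (z : C) : ~ is_pole z -> hol zeta z.
Proof.
intros H. apply (zeta_removable z zeta_formula (zeta_formula_hol z H)). apply locally'_of_locally. now apply locally_all.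
Qed.

(** Writing [A(w) = A(z) + (w - z) A1(w)] separates the residue [A(z)] from a part holomorphic at
    [z]; this is where the divided differences are needed. *)
Lemma zeta_laurent (j : nat) (k : Z) (z := pole_point beta d j k) :
  exists B : C -> C, hol B z /\
    locally' (T := C_UniformSpace) z (fun w => zeta w = B w + pole_numerator j k / (w - z)).
Proof.
destruct (zeta_formula_near_pole j k (fun _ => 1) inv_Gamma (nice_const 1 z) (inv_Gamma_nice z)) as [A [HA [EA HL]]].
{ apply locally_all. intros w. ring. }
fold z in HA, EA, HL. destruct HA as [_ [A1 [HA1 E1]]].
exists (fun w => regular_part j w + A1 w). split.
{ apply hol_plus; [apply nice_hol, nice_regular_part|exact HA1]. }
assert (E : A z = pole_numerator j k) by (rewrite EA; unfold pole_numerator, z; unfold Cdiv; ring).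
assert (X := filter_and _ _ (filter_and _ _ (zeta_zeta_formula z) HL) (locally'_of_locally _ _ E1)).
apply locally'_Cmod in X. destruct X as [del [Hd X]]. apply locally'_Cmod. exists del. split; [easy|].
intros w Hw Hne. destruct (X w Hw Hne) as [[P Q] S0].
rewrite P, Q, S0, E. assert (N := Cminus_neq_0 w z Hne). field. exact N.
Qed.

Lemma zeta_hol_of_numerator_0 (j : nat) (k : Z) : pole_numerator j k = 0 ->
  hol zeta (pole_point beta d j k).
Proof.
intros E. destruct (zeta_laurent j k) as [B [HB HL]].
apply (zeta_removable _ B HB).
generalize (filter_and _ _ (zeta_zeta_formula (pole_point beta d j k)) HL). apply filter_imp.
intros w [P Q]. rewrite <- P, Q, E. unfold Cdiv. ring.
Qed.

Lemma zeta_hol_or_simple_pole (j : nat) (k : Z) :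
  hol zeta (pole_point beta d j k) \/ has_pole zeta (pole_point beta d j k) 1.
Proof.
set (z := pole_point beta d j k).
destruct (excluded_middle_informative (pole_numerator j k = 0)) as [E|E].
- left. now apply zeta_hol_of_numerator_0.
- right. split; [easy|]. destruct (zeta_laurent j k) as [B [HB HL]]. fold z in HB, HL.
  exists (fun w => (w + - z) * B w + pole_numerator j k). split; [|split].
  + apply hol_holomorphic_at. apply hol_plus; [|apply hol_const]. apply hol_mult; [|exact HB].
    apply hol_plus; [apply hol_id|apply hol_const].
  + replace ((z + - z) * B z + pole_numerator j k) with (pole_numerator j k) by ring. exact E.
  + apply locally'_Cmod in HL. destruct HL as [del [Hd HL]]. apply locally'_Cmod. exists del.
    split; [easy|]. intros w Hw Hne. rewrite (HL w Hw Hne). assert (N := Cminus_neq_0 w z Hne).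
    simpl. field. exact N.
Qed.

Lemma zeta_residue (j : nat) (k : Z) : is_residue zeta (pole_point beta d j k) (pole_numerator j k).
Proof.
destruct (zeta_laurent j k) as [B [HB HL]].
exists (pole_numerator j k :: nil), B. split; [now apply hol_holomorphic_at|]. split; [reflexivity|].
set (z := pole_point beta d j k) in *.
apply locally'_Cmod in HL. destruct HL as [del [Hd HL]]. apply locally'_Cmod. exists del.
split; [easy|]. intros w Hw Hne. rewrite (HL w Hw Hne). assert (N := Cminus_neq_0 w z Hne).
simpl. rewrite Csum_cons, Csum_nil. simpl. field. exact N.
Qed.

Lemma pole_numerator_eq (j : nat) (k : Z) :
  pole_numerator j k = RtoC (cc j) * inv_Gamma (pole_point beta d j k)
    * CInt (fun u => RtoC (exp (Pfun beta d u)) * Cexp (- (RtoC (2 * PI * IZR k * u) * Ci))) 0 1.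
Proof.
unfold pole_numerator.
rewrite (period_integral_eq beta d Hbeta Hnd Hd0 Hin Hlen). set (e := ex j (pole_point beta d j k)).
(* [e ln beta] is an integral multiple of [2 PI i] and [c] is an integer, so the residue does not
   depend on [c]. *)
assert (E1 : cpow beta (- (e * RtoC (INR c))) = 1).
{ unfold cpow. replace (- (e * RtoC (INR c)) * RtoC (ln beta)) with (- (RtoC (INR c) * (e * RtoC (ln beta)))) by ring.
  unfold e. rewrite expo_pole.
  replace (- (RtoC (INR c) * (RtoC (2 * PI * IZR (- k)) * Ci))) with (RtoC (2 * PI * IZR (k * Z.of_nat c)) * Ci).
  - apply Cexp_2PI_Ci.
  - rewrite mult_IZR, <- INR_IZR_INZ, opp_IZR, !RtoC_mult, RtoC_opp. ring. }
rewrite E1.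
replace (CInt (fun u => RtoC (exp (Pfun beta d u)) * cpow beta (e * RtoC u)) 0 1) with
  (CInt (fun u => RtoC (exp (Pfun beta d u)) * Cexp (- (RtoC (2 * PI * IZR k * u) * Ci))) 0 1).
- field. apply ln_beta_C.
- f_equal. apply functional_extensionality. intros u. f_equal. unfold cpow. f_equal.
  replace (e * RtoC u * RtoC (ln beta)) with (RtoC u * (e * RtoC (ln beta))) by ring.
  unfold e. rewrite expo_pole, opp_IZR, !RtoC_mult, RtoC_opp. ring.
Qed.

(** For [Re s > L] one may take [N = 0]. The lower integral then contains [F] in place of [F - 1],
    and the surplus [a^s / s] is what the term with [1 / Gamma(s + 1)] removes. *)
Lemma zeta_is_zeta (s : C) : (L < Re s)%R -> is_zeta (fun k => (beta ^ k)%R) d s (zeta s).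
Proof.
intros Hs. assert (L0 := Lexp_pos beta d Hbeta Hlen).
assert (HD := idom_0_point a Ha).
rewrite zeta_not_pole.
2:{ intros [j [k E]]. apply (f_equal Re) in E. rewrite Re_pole_point in E. pose proof (pos_INR j). lra. }
rewrite (zeta_formula_zeta_form 0) by (simpl; lra).
assert (E := is_zeta_integral beta d d' Hbeta Hnd Hd0 Hin Hlen Hperm Hd' a Ha s Hs).
match type of E with is_zeta _ _ _ ?v => replace (zeta_form 0 s) with v; [exact E|] end. clear E.
set (m1 := mellin (fun t => (digit_prod beta d t - 1)%R) (at_right 0) (at_point a) s).
assert (EF : T 0 s = m1 + / s * cpow a s).
{ assert (I0 := is_tail_integral beta d Hbeta Hnd Hd0 Hin Hlen sigma c Hsigma Hc 0 s ltac:(simpl; lra)).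
  rewrite <- (is_CInt_unique HD _ _ I0). apply (is_CInt_unique HD).
  assert (I1 : is_CInt (fun t => RtoC (digit_prod beta d t - 1) * cpow t (s - 1)) (at_right 0) (at_point a) m1).
  { apply (is_mellin HD); [|now apply F1_conv_0]. intros t Ht.
    apply (continuous_F1 beta d Hbeta Hnd Hd0 Hin); lra. }
  assert (I2 := is_CInt_cpow_0 s a ltac:(lra) Ha).
  apply (is_CInt_ext HD) with (2 := is_CInt_plus HD _ _ _ _ I1 I2). intros t Ht.
  rewrite (tail_integrand_0 beta d Hbeta Hnd Hd0 Hin Hlen) by lra. rewrite RtoC_minus. ring. }
assert (Ea : cpow beta (- (RtoC (INR c) * s)) = cpow a s).
{ unfold cpow. f_equal. rewrite ln_Rinv by (apply pow_lt; lra). rewrite ln_pow by lra.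
  rewrite RtoC_opp, RtoC_mult. ring. }
unfold zeta_form, lower_integral. simpl seq. rewrite Csum_nil, EF, Ea, (inv_Gamma_succ s).
assert (s <> 0) by (apply Re_neq_0; lra). field. easy.
Qed.

Lemma zeta_holomorphic_neg_nat (n : nat) : hol zeta (RtoC (- INR n)).
Proof.
destruct (excluded_middle_informative (is_pole (RtoC (- INR n)))) as [[j [k E]]|N]; [|now apply zeta_hol].
rewrite E. apply zeta_hol_of_numerator_0. unfold pole_numerator. rewrite <- E, inv_Gamma_nonpos_int.
unfold Cdiv. ring.
Qed.

Lemma inv_Gamma_neg_nat_succ (n : nat) : inv_Gamma (RtoC (- INR n) + 1) = if Nat.eqb n 0 then 1 else 0.
Proof.
destruct n as [|n].
- simpl. replace (RtoC (- 0) + 1) with (RtoC 1) by (rewrite RtoC_opp; ring). apply inv_Gamma_1.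
- replace (RtoC (- INR (S n)) + 1) with (RtoC (- INR n)).
  + simpl. apply inv_Gamma_nonpos_int.
  + rewrite <- RtoC_plus. f_equal. rewrite S_INR. ring.
Qed.

(** The zero of [1 / Gamma] at [- n] leaves only the middle term. The hypothesis excludes pole
    points, since [- n = L - j] with [L > 0] would make [L] a positive integer. *)
Lemma zeta_neg_nat_regular (n : nat) : ~ (exists N : nat, (1 <= N)%nat /\ L = INR N) ->
  zeta (RtoC (- INR n)) = - (if Nat.eqb n 0 then 1 else 0).
Proof.
intros H. rewrite zeta_not_pole.
- unfold zeta_formula, zeta_form. rewrite inv_Gamma_nonpos_int, inv_Gamma_neg_nat_succ.
  destruct n as [|n]; simpl Nat.eqb; cbv iota; [|ring].
  replace (- (RtoC (INR c) * RtoC (- INR 0))) with (RtoC 0) by (simpl; rewrite Ropp_0; ring).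
  rewrite cpow_0. ring.
- intros [j [k E]]. apply H. apply (f_equal Re) in E. rewrite Re_pole_point in E. simpl in E.
  assert (L0 := Lexp_pos beta d Hbeta Hlen).
  assert (Hjn : (n < j)%nat) by (apply INR_lt; lra).
  exists (j - n)%nat. split; [lia|]. rewrite minus_INR by lia. lra.
Qed.

Lemma CInt_RtoC (f : R -> R) : (forall u, continuous f u) ->
  CInt (fun u => RtoC (f u)) 0 1 = RtoC (RInt f 0 1).
Proof.
intros Hf. apply (is_RInt_unique (V := C_R_CompleteNormedModule)).
apply (is_RInt_fct_extend_pair (U := R_NormedModule) (V := R_NormedModule)
  (fun u => RtoC (f u)) 0 1 (RInt f 0 1) 0%R).
- apply (RInt_correct (V := R_CompleteNormedModule)).
  apply (ex_RInt_continuous (V := R_CompleteNormedModule)). intros u _. apply Hf.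
- assert (Z : is_RInt (V := R_NormedModule) (fun _ => 0%R) 0 1 ((1 - 0) * 0)%R)
    by exact (is_RInt_const (V := R_NormedModule) 0 1 0%R).
  rewrite Rmult_0_r in Z. exact Z.
Qed.

(** Here [- n] is the pole point with [j = n + N] and [k = 0]. Writing [1 / Gamma(s) = (s + n) G(s)]
    with [G(- n) = (-1)^n n!] cancels the simple pole; in the regular part only the middle term
    survives. *)
Lemma zeta_neg_nat_integer (N n : nat) : L = INR N ->
  zeta (RtoC (- INR n)) =
    RtoC ((-1) ^ n * INR (fact n) * cc (n + N) * RInt (fun u => exp (Pfun beta d u)) 0 1
      - (if Nat.eqb n 0 then 1 else 0))%R.
Proof.
intros HN. set (j := (n + N)%nat).
assert (Ez : pole_point beta d j 0 = RtoC (- INR n)).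
{ unfold pole_point. replace (2 * PI * / ln beta * 0)%R with 0%R by ring.
  unfold j. rewrite HN, plus_INR. replace (INR N - (INR n + INR N))%R with (- INR n)%R by ring. ring. }
set (G := fun s => rising n s * inv_Gamma (s + RtoC (INR (S n)))).
destruct (zeta_formula_near_pole j 0 (fun s => s + - pole_point beta d j 0) G) as [A [HA [EA HL]]].
{ apply nice_plus; [apply nice_id|apply nice_const]. }
{ apply nice_mult; [apply nice_rising|]. apply nice_translate, inv_Gamma_nice. }
{ apply locally_all. intros w. rewrite Ez. unfold G. rewrite (inv_Gamma_rising (S n) w), rising_S.
  rewrite RtoC_opp. ring. }
destruct (zeta_removable (pole_point beta d j 0) (fun w => regular_part j w + A w)) as [E _].
{ apply hol_plus; apply nice_hol; [apply nice_regular_part|exact HA]. }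
{ apply locally'_Cmod in HL. destruct HL as [del [Hd HL]]. apply locally'_Cmod. exists del.
  split; [easy|]. intros w Hw Hne. rewrite (HL w Hw Hne). assert (X := Cminus_neq_0 w _ Hne). field. exact X. }
cbv beta in E. rewrite EA, Ez in E. rewrite E.
assert (Ee : ex j (RtoC (- INR n)) = 0).
{ unfold expo, j. rewrite HN, plus_INR, !RtoC_plus, RtoC_opp. ring. }
rewrite Ee, (period_integral_eq beta d Hbeta Hnd Hd0 Hin Hlen), Cmult_0_l.
replace (- 0) with (RtoC 0) by ring. rewrite cpow_0.
replace (CInt (fun u => RtoC (exp (Pfun beta d u)) * cpow beta (0 * RtoC u)) 0 1)
  with (RtoC (RInt (fun u => exp (Pfun beta d u)) 0 1)).
2:{ rewrite <- CInt_RtoC.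
    - f_equal. apply functional_extensionality. intros u. rewrite Cmult_0_l, cpow_0. ring.
    - intros u. apply continuous_ext with (f := fun u => exp_periodic beta d (Rpower beta u)); [intros y; now apply exp_periodic_Rpower|].
      apply (continuous_comp (fun u => Rpower beta u) (exp_periodic beta d)).
      + apply (ex_derive_continuous (K := R_AbsRing) (V := R_NormedModule)). unfold Rpower. now auto_derive.
      + apply continuous_exp_periodic; trivial. apply exp_pos. }
unfold G. rewrite rising_neg, <- RtoC_plus.
replace (- INR n + INR (S n))%R with 1%R by (rewrite S_INR; ring). rewrite inv_Gamma_1.
unfold regular_part. rewrite inv_Gamma_nonpos_int, inv_Gamma_neg_nat_succ.
assert (P : cpow beta (- (RtoC (INR c) * RtoC (- INR n))) * (if Nat.eqb n 0 then 1 else 0) =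
  RtoC (if Nat.eqb n 0 then 1 else 0)).
{ destruct n as [|n0]; simpl Nat.eqb; cbv iota; [|ring].
  replace (- (RtoC (INR c) * RtoC (- INR 0))) with (RtoC 0) by (simpl; rewrite Ropp_0; ring).
  rewrite cpow_0. ring. }
rewrite P, RtoC_minus, !RtoC_mult. field. apply ln_beta_C.
Qed.

End Main.

Local Close Scope C_scope.

Theorem theorem3p4 :
  forall (beta : R) (d : list R),
    (1 < beta)%R ->
    NoDup d -> (forall delta, In delta d -> (0 <= delta)%R) -> In 0%R d ->
    (2 <= length d)%nat ->
  forall (sigma : R) (rho : nat) (c : Z),
    is_sigma beta d sigma -> is_rho beta sigma rho -> (Z.of_nat rho <= c)%Z ->
  let b := fun k : nat => (beta ^ k)%R in
  let L := Lexp beta d in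
  exists zeta : C -> C,
    (forall s : C, (L < Re s)%R -> is_zeta b d s (zeta s)) /\
    meromorphic zeta /\
    (forall s : C, (forall j k, s <> pole_point beta d j k) ->
       holomorphic_at zeta s /\
       exists S1 S2 : C,
         has_sum (fun lambda => (0 < lambda)%R /\ (0 < rep_count b d lambda)%nat)
           (fun lambda => RtoC (INR (rep_count b d lambda)) / cpow lambda s *
                          inc_Gamma s (lambda * powerRZ beta (- c)))%C S1 /\
         is_series (K := C_AbsRing) (V := C_NormedModule)
           (fun l : nat =>
              let e := (s + RtoC (INR l) - RtoC L)%C in
              cpow beta (- (e * RtoC (IZR c))) * RtoC (ln beta)
                / (cpow beta e - RtoC 1)
              * RtoC (ccoef beta d l)
              * CInt (fun u => RtoC (exp (Pfun beta d u)) * cpow beta (e * RtoC u)) 0 1)%C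
           S2 /\
         zeta s = (inv_Gamma s * S1
                   - cpow beta (- (RtoC (IZR c) * s)) * inv_Gamma (s + RtoC 1)
                   + inv_Gamma s * S2)%C) /\
    (forall (j : nat) (k : Z),
       let s0 := pole_point beta d j k in
       (holomorphic_at zeta s0 \/ has_pole zeta s0 1) /\
       is_residue zeta s0
         (RtoC (ccoef beta d j) * inv_Gamma s0
          * CInt (fun u => RtoC (exp (Pfun beta d u))
                           * Cexp (- (RtoC (2 * PI * IZR k * u) * Ci))) 0 1)%C) /\
    (forall n : nat, holomorphic_at zeta (RtoC (- INR n))) /\
    (~ (exists N : nat, (1 <= N)%nat /\ L = INR N) ->
       zeta (RtoC 0) = RtoC (- 1) /\
       forall n : nat, (1 <= n)%nat -> zeta (RtoC (- INR n)) = RtoC 0) /\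
    (forall N : nat, (1 <= N)%nat -> L = INR N ->
       forall n : nat,
         zeta (RtoC (- INR n)) =
         RtoC ((- 1) ^ n * INR (fact n) * ccoef beta d (n + N)
               * RInt (fun u => exp (Pfun beta d u)) 0 1
               - (if Nat.eqb n 0 then 1 else 0))%R).
Proof.
intros beta d Hbeta Hnd Hd0 Hin Hlen sigma rho c Hsigma Hrho Hc b L.
destruct (digits_split d Hnd Hd0 Hin) as [d' [Hperm Hd']].
(* Since [c >= rho >= 0], the integer [c] is a natural number. *)
destruct (Z_of_nat_complete c ltac:(lia)) as [n ->]. apply Nat2Z.inj_le in Hc.
assert (Hn : (/ beta ^ n < sigma)%R).
{ eapply Rle_lt_trans; [|exact (proj1 Hrho)].
  apply Rinv_le_contravar; [apply pow_lt; lra|]. apply Rle_pow; [lra|exact Hc]. }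
rewrite <- INR_IZR_INZ. rewrite powerRZ_neg', <- pow_powerRZ.
assert (Hbp := fun j k => zeta_hol_or_simple_pole beta d Hbeta Hnd Hd0 Hin Hlen sigma n Hsigma Hn j k).
exists (zeta beta d n). split; [|split; [|split; [|split; [|split; [|split]]]]].
- exact (zeta_is_zeta beta d d' Hbeta Hnd Hd0 Hin Hlen Hperm Hd' sigma n Hsigma Hn).
- intros z. destruct (excluded_middle_informative (exists j k, z = pole_point beta d j k)) as [[j [k ->]]|H].
  + destruct (Hbp j k) as [A|A]; [left; now apply hol_holomorphic_at|right; now exists 1%nat].
  + left. apply hol_holomorphic_at. now apply (zeta_hol beta d Hbeta Hnd Hd0 Hin Hlen sigma n Hsigma Hn).
- intros s Hs.
  assert (H : ~ (exists j k, s = pole_point beta d j k)) by (intros [j [k E]]; exact (Hs j k E)).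
  split; [apply hol_holomorphic_at; now apply (zeta_hol beta d Hbeta Hnd Hd0 Hin Hlen sigma n Hsigma Hn)|].
  exists (upper_integral beta d (/ beta ^ n) s), (lower_integral beta d n (level beta d s) s). split; [|split].
  + apply (has_sum_inc_Gamma beta d d' Hbeta Hnd Hd0 Hin Hperm Hd').
    apply Rinv_0_lt_compat, pow_lt; lra.
  + apply is_series_ext with (2 := is_series_pole_terms beta d Hbeta Hnd Hd0 Hin Hlen sigma n Hsigma Hn
      (level beta d s) s (level_spec beta d Hlen s)).
    intros l. unfold pole_term. rewrite (period_integral_eq beta d Hbeta Hnd Hd0 Hin Hlen). fold (expo beta d l s).
    match goal with |- ?x = ?y => change (@eq C x y) end. unfold L, expo, Cdiv. ring.
  + rewrite zeta_not_pole by exact H. reflexivity.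
- intros j k s0. split.
  + destruct (Hbp j k) as [A|A]; [left; now apply hol_holomorphic_at|now right].
  + unfold s0. rewrite <- (pole_numerator_eq beta d Hbeta Hnd Hd0 Hin Hlen n).
    exact (zeta_residue beta d Hbeta Hnd Hd0 Hin Hlen sigma n Hsigma Hn j k).
- intros m. apply hol_holomorphic_at.
  exact (zeta_holomorphic_neg_nat beta d Hbeta Hnd Hd0 Hin Hlen sigma n Hsigma Hn m).
- intros H. assert (Z := fun m => zeta_neg_nat_regular beta d Hbeta Hlen n m H). split.
  + specialize (Z 0%nat). simpl in Z. rewrite Ropp_0 in Z. rewrite Z. symmetry. exact (RtoC_opp 1).
  + intros m Hm. rewrite Z. destruct m as [|m]; [lia|]. simpl. ring.
- intros N _ HN m. exact (zeta_neg_nat_integer beta d Hbeta Hnd Hd0 Hin Hlen sigma n Hsigma Hn N m HN).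
Qed.
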